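(* There is an efficient (polynomial-time, randomized) algorithm that, for every instance of FZA, computes a set $F\subseteq E$ whose expected revenue is at least $\mathrm{OPT}/\mathcal{O}\!\left(\frac{\log n}{\log\log n}\right)$, where $\mathrm{OPT}$ is the optimal revenue; i.e., an $\mathcal{O}(\log n/\log\log n)$-approximation for FZA in expectation.
   Context: Fare Zone Assignment (FZA): given a tree $T=(V,E)$ with $n=|V|$, a non-decreasing concave function $f\colon\mathbb{N}_0\to\mathbb{R}_{\ge 0}$, and commodities $i\in[k]$, each given by a path $P_i\subseteq E$, a bound $u_i\in\mathbb{N}_0$ and a weight $w_i\in\mathbb{N}$, find $F\subseteq E$ maximizing $\sum_{i\in[k]}\mathrm{rev}_i(F)$, where $\mathrm{rev}_i(F)=w_i f(|P_i\cap F|)$ if $|P_i\cap F|\le u_i$ and $0$ otherwise. *)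

(* Defs.v *)
From HB Require Import structures.
From mathcomp Require Import all_boot all_order all_algebra.
From mathcomp Require Import all_classical all_reals all_analysis.

Set Implicit Arguments.
Unset Strict Implicit.
Unset Printing Implicit Defensive.

Import Order.TTheory GRing.Theory Num.Theory.
Import numFieldNormedType.Exports.

Local Open Scope nat_scope.

(** * Fare Zone Assignment *)

Section Graphs.
Variable V : finType.
Implicit Types (e : rel V) (x : V) (p : seq V).

(* For a simple graph, a cycle is a duplicate-free closed walk visiting at
   least three vertices; shorter ones do not count (a 2-cycle is one edge). *)
Definition is_tree e : Prop :=
  [/\ symmetric e, irreflexive e, 0 < #|V|, (forall x y, connect e x y)
    & forall c : seq V, 2 < size c -> ~~ (cycle e c && uniq c)].

Definition edge_set e : {set {set V}} :=
  [set [set xy.1; xy.2] | xy : V * V & e xy.1 xy.2].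

Definition walk_edges x p : {set {set V}} :=
  [set [set xy.1; xy.2] | xy in zip (x :: p) p].

Definition is_path_edges e (P : {set {set V}}) : Prop :=
  exists x p, [/\ path e x p, uniq (x :: p) & P = walk_edges x p].

End Graphs.

Record fza (R : realType) := FZA {
  fza_n : nat;
  fza_adj : rel 'I_fza_n;
  fza_tree : is_tree fza_adj;
  fza_f : nat -> R;
  fza_f_ge0 : forall j, (0 <= fza_f j)%R;
  fza_f_nondecreasing : forall i j, i <= j -> (fza_f i <= fza_f j)%R;
  fza_f_concave : forall j,
    (fza_f j.+2 - fza_f j.+1 <= fza_f j.+1 - fza_f j)%R;
  fza_k : nat;
  fza_P : 'I_fza_k -> {set {set 'I_fza_n}};
  fza_P_path : forall i, is_path_edges fza_adj (fza_P i);
  fza_u : 'I_fza_k -> nat;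
  fza_w : 'I_fza_k -> nat;
  fza_w_gt0 : forall i, 0 < fza_w i
}.

Section Revenue.
Variables (R : realType) (I : fza R).
Local Open Scope ring_scope.

Definition fza_E : {set {set 'I_(fza_n I)}} := edge_set (@fza_adj _ I).

Definition fza_rev (i : 'I_(fza_k I)) (F : {set {set 'I_(fza_n I)}}) : R :=
  let c := #|fza_P i :&: F| in
  if (c <= fza_u i)%N then (fza_w i)%:R * fza_f I c else 0.

Definition revenue (F : {set {set 'I_(fza_n I)}}) : R := \sum_i fza_rev i F.

(* The default value 0 is harmless: revenues are nonnegative and the empty set
   is feasible. *)
Definition opt : R :=
  \big[Num.max/0]_(F : {set {set 'I_(fza_n I)}} | F \subset fza_E) revenue F.

End Revenue.

(** * Randomized programs with access to a real-valued oracle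

   A program is a finite piece of syntax, hence uniform over all instances.
   Natural numbers are charged logarithmic cost. Real numbers are opaque: they
   come only from oracle answers, are combined only by addition, subtraction and
   multiplication by a natural number (charged its bit length), and influence
   the control flow only through comparisons. Thus, when the oracle answers are
   rationals of polynomial bit length, a run of polynomial cost manipulates only
   rationals of polynomial bit length, and polynomial cost here is polynomial
   time on a probabilistic Turing machine. *)

Inductive aexp :=
| ANat of nat
| AGet of nat & aexp
| AAdd of aexp & aexp
| ASub of aexp & aexp
| AMul of aexp & aexp
| ADiv of aexp & aexp
| AMod of aexp & aexp.

Inductive rexp :=
| RGet of nat & aexp
| ROracle of aexp
| RAdd of rexp & rexp
| RSub of rexp & rexp
| RScale of aexp & rexp.

Inductive bexp :=
| BLeN of aexp & aexp
| BLeR of rexp & rexp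
| BNot of bexp
| BAnd of bexp & bexp.

Inductive cmd :=
| CSkip
| CSetN of nat & aexp & aexp
| CSetR of nat & aexp & rexp
| CFlip of nat & aexp
| CSeq of cmd & cmd
| CIf of bexp & cmd & cmd
| CWhile of bexp & cmd.

Definition bitlen (m : nat) : nat := (trunc_log 2 m).+1.

(* A memory is a family of unbounded arrays: [M A j] is cell [j] of array [A].
   Array names are constants of the program text, so a program uses only
   finitely many arrays. *)
Definition memory (T : Type) := nat -> nat -> T.

Definition upd T (M : memory T) (A j : nat) (v : T) : memory T :=
  fun B i => if (B == A) && (i == j) then v else M B i.

Record state (R : realType) := State {
  nmem : memory nat;
  rmem : memory R;
  coins : seq bool
}.

Section Semantics.
Variables (R : realType) (f : nat -> R).
Implicit Types (s : state R).

Fixpoint aval s (a : aexp) : nat :=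
  match a with
  | ANat m => m
  | AGet A a1 => nmem s A (aval s a1)
  | AAdd a1 a2 => aval s a1 + aval s a2
  | ASub a1 a2 => aval s a1 - aval s a2
  | AMul a1 a2 => aval s a1 * aval s a2
  | ADiv a1 a2 => aval s a1 %/ aval s a2
  | AMod a1 a2 => aval s a1 %% aval s a2
  end.

Fixpoint acost s (a : aexp) : nat :=
  bitlen (aval s a) +
  match a with
  | ANat _ => 0
  | AGet _ a1 => acost s a1
  | AAdd a1 a2 | ASub a1 a2 | AMul a1 a2 | ADiv a1 a2 | AMod a1 a2 =>
      acost s a1 + acost s a2
  end.

Fixpoint rval s (r : rexp) : R :=
  match r with
  | RGet A a => rmem s A (aval s a)
  | ROracle a => f (aval s a)
  | RAdd r1 r2 => (rval s r1 + rval s r2)%R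
  | RSub r1 r2 => (rval s r1 - rval s r2)%R
  | RScale a r1 => ((aval s a)%:R * rval s r1)%R
  end.

Fixpoint rcost s (r : rexp) : nat :=
  1 +
  match r with
  | RGet _ a | ROracle a => acost s a
  | RAdd r1 r2 | RSub r1 r2 => rcost s r1 + rcost s r2
  | RScale a r1 => acost s a + rcost s r1
  end.

Fixpoint bval s (b : bexp) : bool :=
  match b with
  | BLeN a1 a2 => aval s a1 <= aval s a2
  | BLeR r1 r2 => (rval s r1 <= rval s r2)%R
  | BNot b1 => ~~ bval s b1
  | BAnd b1 b2 => bval s b1 && bval s b2
  end.

Fixpoint bcost s (b : bexp) : nat :=
  1 +
  match b with
  | BLeN a1 a2 => acost s a1 + acost s a2
  | BLeR r1 r2 => rcost s r1 + rcost s r2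
  | BNot b1 => bcost s b1
  | BAnd b1 b2 => bcost s b1 + bcost s b2
  end.

(* [exec c s t s']: started in [s], the program [c] halts in [s'] at cost [t].
   Each coin flip consumes one bit of the random tape [coins]; there is no
   transition when the tape is exhausted. *)
Inductive exec : cmd -> state R -> nat -> state R -> Prop :=
| ExecSkip s : exec CSkip s 1 s
| ExecSetN A a v s :
    exec (CSetN A a v) s (1 + acost s a + acost s v)
      (State (upd (nmem s) A (aval s a) (aval s v)) (rmem s) (coins s))
| ExecSetR A a v s :
    exec (CSetR A a v) s (1 + acost s a + rcost s v)
      (State (nmem s) (upd (rmem s) A (aval s a) (rval s v)) (coins s))
| ExecFlip A a s (b : bool) r : coins s = b :: r ->
    exec (CFlip A a) s (1 + acost s a)
      (State (upd (nmem s) A (aval s a) (nat_of_bool b)) (rmem s) r)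
| ExecSeq c1 c2 s t1 s1 t2 s2 :
    exec c1 s t1 s1 -> exec c2 s1 t2 s2 ->
    exec (CSeq c1 c2) s (1 + t1 + t2) s2
| ExecIf b c1 c2 s t s' :
    exec (if bval s b then c1 else c2) s t s' ->
    exec (CIf b c1 c2) s (1 + bcost s b + t) s'
| ExecWhileF b c s : ~~ bval s b ->
    exec (CWhile b c) s (1 + bcost s b) s
| ExecWhileT b c s t1 s1 t2 s2 : bval s b ->
    exec c s t1 s1 -> exec (CWhile b c) s1 t2 s2 ->
    exec (CWhile b c) s (1 + bcost s b + t1 + t2) s2.

Lemma exec_det c s t1 s1 t2 s2 :
  exec c s t1 s1 -> exec c s t2 s2 -> t1 = t2 /\ s1 = s2.
Proof.
move=> H; elim: H t2 s2 => {c s t1 s1}.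
- by move=> s t2 s2 H; inversion H.
- by move=> A a v s t2 s2 H; inversion H.
- by move=> A a v s t2 s2 H; inversion H.
- move=> A a s b r E t2 s2 H; inversion H as [| | |A' a' s' b' r' E'| | | |].
  by move: E'; rewrite E => -[-> ->].
- move=> c1 c2 s u1 s1 u2 s2 _ IH1 _ IH2 t s' H.
  inversion H as [| | | |? ? ? v1 s3 v2 s4 H1 H2| | |].
  by have [? ?] := IH1 _ _ H1; subst; have [-> ->] := IH2 _ _ H2.
- move=> b c1 c2 s t s' _ IH t2 s2 H.
  inversion H as [| | | | |? ? ? ? ? ? H1| |].
  by have [-> ->] := IH _ _ H1.
- move=> b c s Hb t2 s2 H.
  inversion H as [| | | | | | |? ? ? ? ? ? ? Hb']; first by [].
  by rewrite Hb' in Hb.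
- move=> b c s u1 s1 u2 s2 Hb _ IH1 _ IH2 t s' H.
  inversion H as [| | | | | |? ? ? Hb'|? ? ? v1 s3 v2 s4 Hb' H1 H2].
    by subst; case/negP: Hb'.
  by have [? ?] := IH1 _ _ H1; subst; have [-> ->] := IH2 _ _ H2.
Qed.

End Semantics.

(** * Instances as program inputs, and program outputs *)

Section InputOutput.
Variables (R : realType) (I : fza R).
Local Notation n := (fza_n I).
Local Notation k := (fza_k I).

(* Array 0 holds [n] and [k]; array 1 the adjacency matrix, row by row; array 2
   the [k] adjacency matrices of the paths, one after the other; arrays 3 and 4
   the bounds and the weights. All other cells are 0. The function [f] is not
   part of the memory; it is the oracle. *)
Definition input_nmem : memory nat := fun A j =>
  match A with
  | 0 => match j with 0 => n | 1 => k | _ => 0 end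
  | 1 => [exists x : 'I_n, exists y : 'I_n,
           (j == x * n + y) && fza_adj x y]
  | 2 => [exists i : 'I_k, exists x : 'I_n, exists y : 'I_n,
           (j == (i * n + x) * n + y) && ([set x; y] \in fza_P i)]
  | 3 => if @insub _ _ 'I_k j is Some i then fza_u i else 0
  | 4 => if @insub _ _ 'I_k j is Some i then fza_w i else 0
  | _ => 0
  end.

Definition init_state (r : seq bool) : state R :=
  State input_nmem (fun _ _ => 0%R) r.

Definition input_size : nat :=
  n ^ 2 * k.+1 + \sum_(i < k) (bitlen (fza_u i) + bitlen (fza_w i)).

(* The output is read off array 5 as a matrix of marked vertex pairs. *)
Definition output_set (s : state R) : {set {set 'I_n}} :=
  [set [set xy.1; xy.2] | xy : 'I_n * 'I_n & nmem s 5 (xy.1 * n + xy.2) != 0].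

(* On every random tape of length [T], [c] halts within cost [T] (so that the
   tape is long enough) with output [F r]. By [exec_det], [F] is determined by
   [c], [I] and [T]. *)
Definition computes_within (c : cmd) (T : nat)
    (F : T.-tuple bool -> {set {set 'I_n}}) : Prop :=
  forall r : T.-tuple bool, exists t s,
    [/\ exec (fza_f I) c (init_state r) t s, t <= T & output_set s = F r].

End InputOutput.

Definition coin_expectation (R : realType) (T : nat) (X : T.-tuple bool -> R) : R :=
  ((\sum_(r : T.-tuple bool) X r) / 2 ^+ T)%R.

(* Main.v *)
Require Import Defs.
From HB Require Import structures.
From mathcomp Require Import all_boot all_order all_algebra.
From mathcomp Require Import all_classical all_reals all_analysis.
From mathcomp Require Import zify lra.

(** Root the tree at vertex 0 and represent an edge by its lower end. For a branching
    parameter [b] of order [log n / log log n], the vertices at which the integer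
    parts of (subtree size) / [b ^ l] jump form a separator of level [l]; every path
    has a level [l] at which it meets the separator of level [l] but not the one of
    level [l + 1], and there are only [O(log n / log b)] levels. Fix the level. A
    component left by the coarser separator contains fewer than [b] marks of the finer
    one, hence fewer than [2 b] segments between branching marks, and a path consists
    of full segments, of at most three partial segments, and of two side pieces
    hanging off the marks. By concavity the revenue of the optimum on a commodity is
    at most the sum of what these pieces earn separately.

    The number of optimal edges in every segment, rounded down to a power of two, can
    be guessed component by component, since [(log n + 2) ^ (2 b) <= 64 n ^ 2]. A fair
    coin per segment and per side piece isolates, with constant probability, one kind
    of piece on a given path. Then the full segments are served by their lowest edges,
    the partial segments and the sides by a dynamic program over a forest, and the
    bound [u_i] is respected because every piece takes at most what the optimum takes
    there. Trying all levels and guesses and keeping the best candidate costs a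
    constant factor per level.

    Polynomial cost is obtained from closure properties: a function of the read-only
    input and of the tables is definable if some command evaluates it at polynomial
    cost, and definable functions are closed under arithmetic, bounded sums, products
    and quantifiers, table updates and bounded loops. *)

Set Implicit Arguments.
Unset Strict Implicit.
Unset Printing Implicit Defensive.

Import Order.TTheory GRing.Theory Num.Theory.
Import numFieldNormedType.Exports.

Local Open Scope nat_scope.

(** The hard bounds u_i shape everything: exceeding one forfeits the revenue, so a dynamic program
    must know how much a commodity collects outside the part that it optimises. The guessed budgets
    supply this: they cap the other segments, and for the code used in the analysis they never
    exceed what the optimum takes there. Rounding to powers of two leaves [lam + 2] values per
    segment and costs a factor two, since a concave [f] with [f 0 >= 0] is subadditive. With fewer
    than [2 * b] segments per component, all codes can be enumerated as long as
    [(lam + 2) ^ (2 * b)] is polynomial; the largest such [b] minimises the number of levels, which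
    is about the logarithm of n to base [b]. Only [ln b] enters the ratio, so [b] of order at least
    the square root of log n already gives O(ln n / ln ln n). The same n coins serve all levels. On
    every tape the kept solution earns at least as much as the candidates of each level, so the
    expectation is handled as a sum over tapes, in which fixing the coins of at most three segments
    costs a factor of at most eight. *)

Definition sumN n (F : nat -> nat) := \sum_(i < n) F i.
Definition prodN n (F : nat -> nat) := \prod_(i < n) F i.
Definition allN n (p : nat -> bool) := all p (iota 0 n).
Definition hasN n (p : nat -> bool) := has p (iota 0 n).

Lemma allNP n (p : pred nat) : reflect (forall x, x < n -> p x) (allN n p).
Proof.
apply: (iffP allP) => H x; first by move=> ltx; apply: H; rewrite mem_iota.
by rewrite mem_iota => /andP[_]; apply: H.
Qed.

Lemma hasNP n (p : pred nat) : reflect (exists2 x, x < n & p x) (hasN n p).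
Proof.
apply: (iffP hasP) => -[x]; first by rewrite mem_iota => /andP[_ ltx] px; exists x.
by move=> ltx px; exists x; rewrite ?mem_iota.
Qed.

Lemma eq_sumN n F G : (forall i, i < n -> F i = G i) -> sumN n F = sumN n G.
Proof. by move=> E; apply: eq_bigr => i _; apply: E. Qed.

Lemma leq_sumN n F G : (forall i, i < n -> F i <= G i) -> sumN n F <= sumN n G.
Proof. by move=> E; apply: leq_sum => i _; apply: E. Qed.

Lemma sumND n F G : sumN n (fun i => F i + G i) = sumN n F + sumN n G.
Proof. exact: big_split. Qed.

Lemma sumN_exch n m (F : nat -> nat -> nat) :
  sumN n (fun i => sumN m (F i)) = sumN m (fun j => sumN n (fun i => F i j)).
Proof. exact: exchange_big. Qed.

Lemma sumN_muln n c F : sumN n (fun i => c * F i) = c * sumN n F.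
Proof. by rewrite /sumN big_distrr. Qed.

Lemma sumN_mulnr n c F : sumN n (fun i => F i * c) = sumN n F * c.
Proof. by rewrite /sumN big_distrl. Qed.

Lemma sumN0 n F : (forall i, i < n -> F i = 0) -> sumN n F = 0.
Proof. by move=> E; apply: big1 => i _; apply: E. Qed.

Lemma sumN_pick n F j : j < n -> (forall i, i < n -> i != j -> F i = 0) -> sumN n F = F j.
Proof.
move=> jn E; rewrite /sumN (bigD1 (Ordinal jn)) //= big1 ?addn0 // => i ne.
by apply: E => //; apply: contra ne => /eqP e; apply/eqP; apply: val_inj.
Qed.

Lemma leq_sumN1 n F j : j < n -> F j <= sumN n F.
Proof. by move=> jn; rewrite /sumN (bigD1 (Ordinal jn)) //= leq_addr. Qed.

Lemma sumN_le1 n (p : pred nat) :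
  (forall i j, i < n -> j < n -> p i -> p j -> i = j) -> sumN n p <= 1.
Proof.
move=> U; case: (boolP (hasN n p)) => [/hasNP[j jn pj]|/hasNP np].
  rewrite (@sumN_pick n _ j) //; first by case: (p j).
  move=> i lin ne; case pi: (p i) => //; case/eqP: ne; exact: U.
by rewrite sumN0 // => i lin; case pi: (p i) => //; case: np; exists i.
Qed.

(** * The combinatorial notions used by the algorithm *)

(* Vertices are the numbers below [n]. [anc v w] reads "[v] is an ancestor of [w]",
   [prl c v] reads "[v] is the parent of [c]"; an edge is represented by its lower
   end point, so that sets of edges are sets of vertices. *)
Section Notions.
Variables (n : nat) (anc prl : nat -> nat -> bool).

Definition conn (U : nat -> bool) v w :=
  anc v w && allN n (fun y => anc v y && anc y w ==> U y).

Definition sz v := sumN n (fun w => anc v w).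

(* The [q]-marked vertices are those at which the quotients [sz / q] of the children
   fall short of that of the vertex: a separator with pieces of size about [q]. *)
Definition mk q v := sz v %/ q != sumN n (fun c => prl c v * (sz c %/ q)).

(* [b ^ l] for [l <= n] and the binary logarithm of [n], as bounded loops. *)
Definition pw b l := prodN n (fun x => if x < l then b else 1).

Definition lam := sumN n (fun y => pw 2 y.+1 <= n).

Section Level.
(* [U] are the vertices avoided by the coarser separator, [M] is the separator. *)
Variables U M : nat -> bool.

(* [Mh] is the closure of [M] under branching; it cuts the vertices above a mark into
   vertical segments, and [zr v z] says that [v] lies in the segment with lowest
   vertex [z]. *)
Definition hasm v := hasN n (fun w => conn U v w && M w).

Definition Mh v := U v && (M v || (1 < sumN n (fun c => prl c v && hasm c))).

Definition zr v z := [&& conn U v z, Mh z &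
  allN n (fun y => [&& anc v y, anc y z & y != z] ==> ~~ Mh y)].

Definition top c := U c && ~~ hasN n (fun p => prl c p && U p).

(* A code [g] assigns to each segment of the component below [c] a digit in base
   [lam + 2], and thereby a budget [xz], which is zero or a power of two. *)
Definition idx c z := sumN n (fun y => [&& y < z, conn U c y & Mh y]).

Definition same v w := hasN n (fun z => zr v z && zr w z).

Definition dgt c g z := (g %/ pw (lam + 2) (idx c z)) %% (lam + 2).

Definition xz c g z := if dgt c g z == 0 then 0 else pw 2 (dgt c g z - 1).

(* The side candidate uses vertices below which no mark is left, in the hanging
   subtrees whose root has coin 1. A commodity is served at [v] if the usable part
   of its path is the chain from [v] up to the root of one such subtree. *)
Definition NA (coin : nat -> bool) v := [&& U v, ~~ hasm v &
  hasN n (fun y => [&& conn U y v, ~~ hasm y, hasN n (fun p => prl y p && hasm p) & coin y])].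

Definition PrA coin v p := [&& NA coin v, NA coin p & prl v p].

Definition ChA coin v w := [&& NA coin v, NA coin w, conn U w v & w != v].

Definition RwA coin (inP : nat -> nat -> bool) (u : nat -> nat) i v j :=
  [&& NA coin v, allN n (fun w => NA coin w ==> (inP i w == conn U w v)) & j <= u i].

Section Code.
Variables (x : nat -> nat) (c : nat).

(* The segment candidate uses the segments with positive budget [x], at most [x z]
   vertices in segment [z]. A commodity is served at [v] if its path covers exactly
   the vertices above [v] ([kap = 0]) or below [v] ([kap = 1]) in the segment of [v],
   and each other segment entirely or not at all; [XK] bounds what it meets there. *)
Definition NK v := conn U c v && hasN n (fun z => zr v z && (0 < x z)).

Definition chK kap v w := if kap == 0 then anc w v else anc v w.

Definition PrK kap v p := [&& NK v, NK p, same v p & if kap == 0 then prl v p else prl p v].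

Definition ChK kap v w := [&& NK v, NK w, same v w, chK kap v w & w != v].

Definition CapK v j := hasN n (fun z => zr v z && (j <= x z)).

Definition GoodK kap (inP : nat -> nat -> bool) i v := [&& NK v,
  allN n (fun w => NK w ==> (if same v w then inP i w == chK kap v w
    else allN n (fun z => zr w z ==> (inP i w == inP i z)))) &
  hasN n (fun w => [&& NK w, same v w & ~~ chK kap v w])].

Definition XK (inP : nat -> nat -> bool) i v :=
  sumN n (fun z => [&& conn U c z, Mh z, ~~ zr v z & inP i z] * x z).

Definition RwK kap inP (u : nat -> nat) i v j :=
  [&& allN n (fun w => inP i w ==> conn U c w), GoodK kap inP i v & j + XK inP i v <= u i].

(* The candidate made of the lowest [x z] vertices of each segment [z]. *)
Definition FM v := conn U c v && hasN n (fun z => zr v z &&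
  (sumN n (fun w => [&& zr w z, anc v w & w != v]) < x z)).

End Code.
End Level.
End Notions.

(** * Rooted trees *)

Record rtree (n : nat) (par dep : nat -> nat) : Prop := RTree {
  rt_n : 0 < n;
  rt_par0 : par 0 = 0;
  rt_dep0 : dep 0 = 0;
  rt_par : forall v, v < n -> par v < n;
  rt_dep : forall v, 0 < v < n -> dep v = (dep (par v)).+1;
  rt_depn : forall v, v < n -> dep v < n }.

Section Tree.
Variables (n : nat) (par dep : nat -> nat).
Hypothesis T : rtree n par dep.

Definition ancM v w := [&& v < n, w < n, dep v <= dep w & iter (dep w - dep v) par w == v].
Definition prlM v w := [&& v < n, 0 < v & par v == w].
Local Notation anc := ancM.
Local Notation prl := prlM.
Local Notation conn := (conn n ancM).
Local Notation sz := (sz n ancM).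
Local Notation mk := (mk n ancM prlM).

Lemma iter_par_lt k v : v < n -> iter k par v < n.
Proof. by move=> vn; elim: k => //= k; exact: (rt_par T). Qed.

Lemma dep_par v : v < n -> dep (par v) = (dep v).-1.
Proof.
case: v => [|v] vn; first by rewrite (rt_par0 T) (rt_dep0 T).
by rewrite (@rt_dep _ _ _ T v.+1).
Qed.

Lemma dep_iter k v : v < n -> dep (iter k par v) = dep v - k.
Proof.
move=> vn; elim: k => [|k IH]; first by rewrite subn0.
by rewrite iterS dep_par ?iter_par_lt // IH subnS.
Qed.

Lemma dep_eq0 v : v < n -> (dep v == 0) = (v == 0).
Proof.
by case: v => [|v] vn; rewrite ?(rt_dep0 T) // (@rt_dep _ _ _ T v.+1).
Qed.

Lemma iter_par0 k : iter k par 0 = 0.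
Proof. by elim: k => //= k ->; exact: (rt_par0 T). Qed.

Lemma anc_ltl v w : anc v w -> v < n. Proof. by case/and4P. Qed.
Lemma anc_ltr v w : anc v w -> w < n. Proof. by case/and4P. Qed.

Lemma ancP v w : w < n -> reflect (exists k, iter k par w = v) (anc v w).
Proof.
move=> wn; apply: (iffP and4P) => [[_ _ _ /eqP E]|[k <-]]; first by exists (dep w - dep v).
rewrite dep_iter // leq_subr iter_par_lt //; split=> //; apply/eqP.
case: (leqP k (dep w)) => kw; first by rewrite subKn.
have z : iter (dep w) par w = 0 by apply/eqP; rewrite -dep_eq0 ?iter_par_lt // dep_iter // subnn.
have -> : dep w - k = 0 by lia.
by rewrite subn0 z -(subnK (ltnW kw)) iterD z iter_par0.
Qed.

Lemma anc_refl v : v < n -> anc v v.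
Proof. by move=> vn; rewrite /ancM vn leqnn subnn /=. Qed.

Lemma anc_trans u v w : anc u v -> anc v w -> anc u w.
Proof.
move=> uv vw; have vn := anc_ltl vw; have wn := anc_ltr vw.
move: uv vw => /(ancP _ vn)[k <-] /(ancP _ wn)[j <-]; apply/ancP => //.
by exists (k + j); rewrite iterD.
Qed.

Lemma anc_dep v w : anc v w -> dep v <= dep w. Proof. by case/and4P. Qed.

Lemma anc_eq v w : anc v w -> dep w <= dep v -> v = w.
Proof.
move=> /and4P[_ _ le /eqP E] le'; move: E; have -> : dep w - dep v = 0 by lia.
by [].
Qed.

Lemma anc_anti v w : anc v w -> anc w v -> v = w.
Proof. by move=> vw wv; apply: anc_eq => //; exact: anc_dep. Qed.

Lemma anc_ltdep v w : anc v w -> v != w -> dep v < dep w.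
Proof. by move=> vw; apply: contraNltn => /(anc_eq vw) ->. Qed.

Lemma anc_chain u v w : anc u w -> anc v w -> dep u <= dep v -> anc u v.
Proof.
move=> /and4P[un wn uw /eqP Eu] /and4P[vn _ vw /eqP Ev] uv; rewrite /ancM un vn uv /=; apply/eqP.
have -> : iter (dep v - dep u) par v = iter (dep v - dep u + (dep w - dep v)) par w by rewrite iterD Ev.
by rewrite -[RHS]Eu; congr (iter _ _ _); lia.
Qed.

Lemma anc_total u v w : anc u w -> anc v w -> anc u v || anc v u.
Proof.
move=> uw vw; case: (leqP (dep u) (dep v)) => le; first by rewrite (anc_chain uw vw).
by rewrite (anc_chain vw uw) ?orbT // ltnW.
Qed.

Lemma anc_par w : w < n -> anc (par w) w.
Proof. by move=> wn; apply/ancP => //; exists 1. Qed.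

Lemma anc_to_par v w : anc v w -> v != w -> anc v (par w).
Proof.
move=> vw ne; have lt := anc_ltdep vw ne; have wn := anc_ltr vw.
apply: (anc_chain vw (anc_par wn)); rewrite dep_par //; lia.
Qed.

Lemma prl_ltl c v : prl c v -> c < n. Proof. by case/and3P. Qed.

Lemma prlE c v : prl c v -> par c = v. Proof. by case/and3P=> _ _ /eqP. Qed.

Lemma prl_ltr c v : prl c v -> v < n.
Proof. by move=> p; rewrite -(prlE p); exact: (rt_par T) (prl_ltl p). Qed.

Lemma anc_child v w : anc v w -> v != w -> exists2 c, prl c v & anc c w.
Proof.
move=> vw ne; have lt := anc_ltdep vw ne; have vn := anc_ltl vw; have wn := anc_ltr vw.
have cn : iter (dep w - dep v).-1 par w < n by exact: iter_par_lt.
have dc : dep (iter (dep w - dep v).-1 par w) = (dep v).+1 by rewrite dep_iter //; lia.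
exists (iter (dep w - dep v).-1 par w); last by apply/ancP => //; eexists.
rewrite /prlM lt0n -dep_eq0 // dc cn /= -iterS prednK ?subn_gt0 //.
by case/and4P: vw.
Qed.

Lemma prl_dep c v : prl c v -> dep c = (dep v).+1.
Proof. by case/and3P=> cn c0 /eqP <-; rewrite (rt_dep T) ?c0. Qed.

Lemma prl_anc c v : prl c v -> anc v c.
Proof. by move=> p; rewrite -(prlE p) anc_par // (prl_ltl p). Qed.

Lemma prl_ne c v : prl c v -> c != v.
Proof. by move=> p; apply/eqP => e; have := prl_dep p; rewrite e; lia. Qed.

Lemma child_uniq c c' v w : prl c v -> prl c' v -> anc c w -> anc c' w -> c = c'.
Proof.
move=> p p' cw cw'.
have E : dep c = dep c' by rewrite (prl_dep p) (prl_dep p').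
by apply: anc_eq; rewrite ?E //; apply: (anc_chain cw cw'); rewrite E.
Qed.

(** Bottom-up induction; [n - dep v] decreases towards the leaves because depths stay below [n]. *)
Lemma tree_ind (P : nat -> Prop) :
  (forall v, v < n -> (forall c, prl c v -> P c) -> P v) ->
  forall v, v < n -> P v.
Proof.
move=> H v; move Ek : (n - dep v) => k; elim/ltn_ind: k v Ek => k IH v Ek vn.
apply: H => // c p; have cn := prl_ltl p; apply: (IH (n - dep c)) => //.
have := prl_dep p; have := rt_depn T cn; lia.
Qed.

(** * Vertical connections inside a vertex set *)

Section Conn.
Variable U : pred nat.
Local Notation conn := (conn U).

Lemma connP v w :
  reflect (anc v w /\ forall y, anc v y -> anc y w -> U y) (conn v w).
Proof.
apply: (iffP andP) => -[vw H]; split=> //.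
  by move=> y vy yw; move/allNP: H => /(_ y (anc_ltl yw)); rewrite vy yw.
by apply/allNP => y yn; apply/implyP => /andP[vy yw]; exact: H.
Qed.

Lemma conn_anc v w : conn v w -> anc v w. Proof. by case/andP. Qed.

Lemma conn_U v w : conn v w -> U v /\ U w.
Proof.
move=> /connP[vw H]; have vn := anc_ltl vw; have wn := anc_ltr vw.
by split; apply: H => //; exact: anc_refl.
Qed.

Lemma conn_trans u v w : conn u v -> conn v w -> conn u w.
Proof.
move=> /connP[uv H] /connP[vw H']; apply/connP.
split=> [|y uy yw]; first exact: anc_trans vw.
by case/orP: (anc_total vw yw) => [vy|yv]; [exact: H'|exact: H].
Qed.

Lemma conn_split u v w : conn u w -> anc u v -> anc v w -> conn u v /\ conn v w.
Proof.
move=> /connP[uw H] uv vw.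
split; apply/connP; split=> // y h1 h2; apply: H => //; first exact: anc_trans vw.
exact: anc_trans uv h1.
Qed.

Lemma conn_refl v : v < n -> U v -> conn v v.
Proof.
move=> vn Uv; apply/connP; split; first exact: anc_refl.
by move=> y h1 h2; rewrite -(anc_anti h1 h2).
Qed.

Lemma conn_prl c v : U c -> U v -> prl c v -> conn v c.
Proof.
move=> Uc Uv p; apply/connP; split; first exact: prl_anc.
move=> y vy yc; case: (eqVneq y c) => [->//|ne].
have yp := anc_to_par yc ne; rewrite (prlE p) in yp.
by rewrite (anc_anti yp vy).
Qed.

Lemma conn_child v w : conn v w -> v != w -> exists2 c, prl c v & conn c w.
Proof.
move=> cvw ne; have [c p cw] := anc_child (conn_anc cvw) ne; exists c => //.
by have [] := conn_split cvw (prl_anc p) cw.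
Qed.

Lemma conn_ind v w : v < n -> (conn v w : nat) =
  U v * ((w == v) + sumN n (fun c => prl c v && conn c w)).
Proof.
move=> vn; case: (eqVneq w v) => [->|ne].
  rewrite sumN0 ?addn0 ?muln1 => [|c cn].
    case Uv: (U v); first by rewrite conn_refl.
    by apply/eqP; rewrite eqb0; apply: contraFN Uv => /conn_U[].
  case p: (prl c v) => //=; case cv: (conn c v) => //.
  by have := anc_dep (conn_anc cv); rewrite (prl_dep p) ltnn.
rewrite add0n; case Uv: (U v); last first.
  by rewrite mul0n; apply/eqP; rewrite eqb0; apply: contraFN Uv => /conn_U[].
rewrite mul1n; case cvw: (conn v w).
  rewrite eq_sym in ne; have [c p cw] := conn_child cvw ne.
  rewrite (@sumN_pick _ _ c) ?p ?cw //; first exact: prl_ltl p.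
  move=> c' cn' ne'.
  case p': (prl c' v) => //=; case cw': (conn c' w) => //; case/eqP: ne'.
  exact: (child_uniq p' p (conn_anc cw') (conn_anc cw)).
rewrite sumN0 // => c cn; case p: (prl c v) => //=; case cw: (conn c w) => //.
have [Uc _] := conn_U cw.
by rewrite (conn_trans (conn_prl Uc Uv p) cw) in cvw.
Qed.

(** Splitting off the first step below [v] turns every count over a component into a recursion over
    children; both counts of marks run along it by [tree_ind]. *)
Lemma sum_conn v (F : nat -> nat) : v < n ->
  sumN n (fun w => conn v w * F w) =
  U v * (F v + sumN n (fun c => prl c v * sumN n (fun w => conn c w * F w))).
Proof.
move=> vn; rewrite (@eq_sumN _ _ (fun w => U v * ((w == v) * F w +
   sumN n (fun c => (prl c v && conn c w) * F w)))); last first.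
  by move=> w wn; rewrite conn_ind // -mulnA mulnDl sumN_mulnr.
rewrite sumN_muln sumND; congr (_ * (_ + _)).
  by rewrite (@sumN_pick _ _ v) // ?eqxx ?mul1n // => i _ /negPf ->.
rewrite sumN_exch; apply: eq_sumN => c cn; rewrite -sumN_muln; apply: eq_sumN => w _.
by rewrite -mulnb mulnA.
Qed.

End Conn.

Lemma connT v w : conn predT v w = anc v w.
Proof. by rewrite /conn andb_idr // => _; apply/allNP => y _; rewrite implybT. Qed.

Lemma szE v : v < n -> sz v = 1 + sumN n (fun c => prl c v * sz c).
Proof.
move=> vn; have := @sum_conn predT v (fun=> 1) vn; rewrite mul1n => E.
transitivity (sumN n (fun w => conn predT v w * 1)).
  by apply: eq_sumN => w wn; rewrite connT ?muln1.
rewrite E; congr (_ + _); apply: eq_sumN => c cn; congr (_ * _); apply: eq_sumN => w wn.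
by rewrite connT ?muln1.
Qed.

Lemma sz_le v : sz v <= n.
Proof.
rewrite /sz /sumN; apply: (@leq_trans (\sum_(i < n) 1)); last by rewrite sum1_card card_ord.
by apply: leq_sum => i _; case: (anc _ _).
Qed.

(** * Separators *)

(** The sizes of the children add up to one less than the size of [v]. With [mk_large] this gives
    the two ends of the scale between which every path finds its level: everything is marked,
    nothing is marked. *)
Lemma mk1 v : v < n -> mk 1 v.
Proof.
move=> vn; rewrite /mk divn1 szE // (@eq_sumN _ (fun c => _ * (_ %/ 1)) (fun c => prl c v * sz c)).
  by rewrite add1n neq_ltn ltnSn orbT.
by move=> c _; rewrite divn1.
Qed.

Lemma mk_large q v : n < q -> mk q v = false.
Proof.
move=> nq; apply/negbTE; rewrite negbK divn_small ?(leq_ltn_trans (sz_le _)) //.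
by rewrite sumN0 // => c _; rewrite divn_small ?muln0 // (leq_ltn_trans (sz_le _)).
Qed.

Lemma sum_div_le q v : v < n -> sumN n (fun c => prl c v * (sz c %/ q)) <= sz v %/ q.
Proof.
move=> vn; case: (posnP q) => [->|q0]; first by rewrite sumN0 // => c _; rewrite divn0 muln0.
rewrite leq_divRL // -sumN_mulnr szE //; apply: leq_trans (leq_addl _ _).
by apply: leq_sumN => c _; rewrite -mulnA leq_mul // leq_divM.
Qed.

(* At an unmarked vertex the quotients by [b * q] add up exactly, hence so do the
   remainders; the number of [q]-marks is controlled by the remainder alone. *)
Lemma marks_lt b q v : 0 < b -> 0 < q -> v < n ->
  sumN n (fun w => conn (fun y => ~~ mk (b * q) y) v w * mk q w) < b.
Proof.
move=> b0 q0 vn; set U := fun y => ~~ mk (b * q) y.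
have bq0 : 0 < b * q by rewrite muln_gt0 b0.
suff le : sumN n (fun w => conn U v w * mk q w) <= (sz v %% (b * q)) %/ q.
  apply: leq_ltn_trans le _; rewrite ltn_divLR //; exact: ltn_pmod.
elim/tree_ind: v / vn => v vn IH; rewrite sum_conn //.
case Uv: (U v); last by rewrite mul0n.
rewrite mul1n; move: Uv; rewrite /U /mk negbK => /eqP Uv.
have divq w : sz w %/ q = b * (sz w %/ (b * q)) + (sz w %% (b * q)) %/ q.
  by rewrite {1}(divn_eq (sz w) (b * q)) mulnA divnMDl // mulnC.
have sub : sumN n (fun c => prl c v * sumN n (fun w => conn U c w * mk q w)) <=
   sumN n (fun c => prl c v * ((sz c %% (b * q)) %/ q)).
  by apply: leq_sumN => c cn; case p: (prl c v); rewrite ?mul0n // !mul1n IH.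
(* A [q]-mark at [v] means that the quotient of [v] exceeds the sum over its children, and this
   excess pays for the mark; the parts divisible by [b * q] cancel because [v] is unmarked at the
   coarser level. *)
have inc : mk q v + sumN n (fun c => prl c v * ((sz c %% (b * q)) %/ q)) <= (sz v %% (b * q)) %/ q.
  have E : sumN n (fun c => prl c v * (sz c %/ q)) = b * (sz v %/ (b * q)) +
      sumN n (fun c => prl c v * ((sz c %% (b * q)) %/ q)).
    rewrite Uv -sumN_muln -sumND; apply: eq_sumN => c _.
    by rewrite divq mulnDr mulnCA.
  have := sum_div_le q vn; rewrite /mk; move: E (divq v); case: eqP => /=; lia.
exact: leq_trans (leq_add (leqnn _) sub) inc.
Qed.

(** * Skeleton, branching marks and segments *)

Section Level.
Variables U M : nat -> bool.
Local Notation cn := (conn U).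
Local Notation has := (hasm n ancM U M).
Local Notation Mh := (Mh n ancM prlM U M).
Local Notation zr := (zr n ancM prlM U M).

Lemma hasP v : reflect (exists2 w, cn v w & M w) (has v).
Proof.
apply: (iffP (hasNP _ _)) => [[w _ /andP[c m]]|[w c m]]; first by exists w.
by exists w; rewrite ?c //; exact: anc_ltr (conn_anc c).
Qed.

Lemma has_U v : has v -> U v.
Proof. by case/hasP=> w /conn_U[]. Qed.

Lemma has_lt v : has v -> v < n.
Proof. by case/hasP=> w /conn_anc /anc_ltl. Qed.

Lemma has_up u v : cn u v -> has v -> has u.
Proof. by move=> uv /hasP[w vw m]; apply/hasP; exists w => //; exact: conn_trans vw. Qed.

Lemma M_has v : v < n -> U v -> M v -> has v.
Proof. by move=> vn Uv m; apply/hasP; exists v => //; exact: conn_refl. Qed.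

Lemma Mh_has v : v < n -> Mh v -> has v.
Proof.
move=> vn /andP[Uv /orP[m|]]; first exact: M_has.
move=> gt1; have : 0 < sumN n (fun c => prl c v && has c) by exact: ltnW.
rewrite lt0n /sumN sum_nat_eq0 negb_forall => /existsP[c]; rewrite eqb0 negbK => /andP[p h].
exact: (has_up (conn_prl (has_U h) Uv p)).
Qed.

(* An unmarked skeleton vertex has exactly one skeleton child. *)
Lemma spine_child v : has v -> ~~ Mh v -> exists c, [/\ prl c v, has c &
  forall c', prl c' v -> has c' -> c' = c].
Proof.
move=> hv; rewrite negb_and (has_U hv) negb_or /= -leqNgt => /andP[nM le1].
have [w cvw m] := hasP _ hv.
have ne : v != w by apply: contraNneq nM => ->.
have [c p ccw] := conn_child cvw ne.
have hc : has c by apply/hasP; exists w.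
exists c; split=> // c' p' hc'; apply/eqP; apply: contraTT le1 => ne'; rewrite -ltnNge.
have cn := prl_ltl p; have cn' := prl_ltl p'.
rewrite /sumN (bigD1 (Ordinal cn)) //= p hc (bigD1 (Ordinal cn')) /=; first by rewrite p' hc'.
by apply: contra ne' => /eqP[->].
Qed.

Lemma zr_conn v z : zr v z -> cn v z. Proof. by case/and3P. Qed.
Lemma zr_anc v z : zr v z -> anc v z. Proof. by move/zr_conn/conn_anc. Qed.
Lemma zr_Mh v z : zr v z -> Mh z. Proof. by case/and3P. Qed.

Lemma zr_btw v z y : zr v z -> anc v y -> anc y z -> y != z -> ~~ Mh y.
Proof.
case/and3P=> _ _ /allNP H vy yz ne; have := H y (anc_ltl yz).
by rewrite vy yz ne.
Qed.

Lemma zr_has v z : zr v z -> has v.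
Proof.
move=> h; apply: (has_up (zr_conn h)); apply: Mh_has (zr_Mh h).
exact: anc_ltr (zr_anc h).
Qed.

Lemma zrI v z : cn v z -> Mh z -> (forall y, anc v y -> anc y z -> y != z -> ~~ Mh y) -> zr v z.
Proof.
move=> c m H; rewrite /zr c m; apply/allNP => y _; apply/implyP => /and3P[]; exact: H.
Qed.

Lemma zr_refl z : z < n -> Mh z -> zr z z.
Proof.
move=> zn m; apply: zrI => //; first by apply: conn_refl => //; case/andP: m.
by move=> y zy yz; rewrite (anc_anti zy yz) eqxx.
Qed.

Lemma zr_self v z : zr v z -> Mh v -> z = v.
Proof.
move=> h m; apply/eqP; apply: contraTT m => ne; rewrite eq_sym in ne.
apply: (zr_btw h) => //; [exact: anc_refl (anc_ltl (zr_anc h))|exact: zr_anc].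
Qed.

Lemma zr_mid v w z : zr v z -> anc v w -> anc w z -> zr w z.
Proof.
move=> h vw wz; have [_ c] := conn_split (zr_conn h) vw wz.
apply: zrI => //; first exact: zr_Mh h.
by move=> y wy yz ne; apply: (zr_btw h) => //; exact: anc_trans wy.
Qed.

Lemma zr_step v c z : ~~ Mh v -> U v -> prl c v -> zr c z -> zr v z.
Proof.
move=> nm Uv p h; have Uc := has_U (zr_has h).
apply: zrI => [||y vy yz ne].
- exact: (conn_trans (conn_prl Uc Uv p) (zr_conn h)).
- exact: zr_Mh h.
case: (eqVneq v y) => [<-//|vy'].
have [c' p' cy] := anc_child vy vy'.
have E : c' = c by apply: (child_uniq p' p _ (zr_anc h)); exact: anc_trans yz.
by rewrite E in cy; exact: (zr_btw h).
Qed.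

(** Walk down the unique skeleton children until [Mh] holds for the first time; the mark below
    guarantees that the walk ends. *)
Lemma zr_ex v : has v -> exists z, zr v z.
Proof.
move=> hv; have vn := has_lt hv; elim/tree_ind: v / vn hv => v vn IH hv.
case: (boolP (Mh v)) => [m|nm]; first by exists v; exact: zr_refl.
have [c [p hc _]] := spine_child hv nm; have [z h] := IH c p hc.
by exists z; exact: (zr_step nm (has_U hv) p).
Qed.

(** A segment end below a vertex outside [Mh] is reached through its only skeleton child, so the
    descent leaves no choice. *)
Lemma zr_uniq v z z' : zr v z -> zr v z' -> z = z'.
Proof.
move=> h; have vn := has_lt (zr_has h); elim/tree_ind: v / vn z z' h => v vn IH z z' h h'.
case: (boolP (Mh v)) => [m|nm]; first by rewrite (zr_self h m) (zr_self h' m).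
have [c [p hc uc]] := spine_child (zr_has h) nm.
have down y : zr v y -> zr c y.
  move=> hy; have ne : v != y by apply: contraNneq nm => ->; exact: zr_Mh hy.
  have [c' p' cy] := conn_child (zr_conn hy) ne.
  have hc' : has c'.
    by apply: (has_up cy); apply: (Mh_has _ (zr_Mh hy)); exact: anc_ltr (zr_anc hy).
  rewrite -(uc c' p' hc'); apply: (zr_mid hy (prl_anc p') (conn_anc cy)).
exact: (IH c p) (down _ h) (down _ h').
Qed.

(* Two nodes of the skeleton, one above the other, lie in the same segment
   unless a mark separates them. *)
Lemma zr_sep v w z z' : zr v z -> zr w z' -> cn v w -> z != z' -> anc z w.
Proof.
move=> h h' c ne; have vn := has_lt (zr_has h).
elim/tree_ind: v / vn h c => v vn IH h c.
case: (boolP (Mh v)) => [m|nm]; first by rewrite (zr_self h m) (conn_anc c).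
case: (eqVneq v w) => [E|vw]; first by rewrite E in h; rewrite (zr_uniq h h') eqxx in ne.
have [d p cd] := conn_child c vw.
have hd : has d by exact: (has_up cd (zr_has h')).
have [z2 h2] := zr_ex hd.
have E : z2 = z by apply: (zr_uniq _ h); exact: (zr_step nm (has_U (zr_has h)) p).
by rewrite E in h2; exact: (IH d p).
Qed.

(** The term [has v] is a credit. A mark pays for itself and for its credit by the factor 2; a
    branching vertex without a mark is paid by the credits of its at least two skeleton children. *)
Lemma Mh_count v : v < n ->
  sumN n (fun w => cn v w * Mh w) + (has v) <= 2 * sumN n (fun w => cn v w * M w).
Proof.
elim/tree_ind=> {}v vn IH; rewrite !sum_conn //.
case Uv: (U v); last first.
  rewrite !mul0n add0n muln0 leqn0 eqb0; apply: contraFN Uv; exact: has_U.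
rewrite !mul1n; set sH := sumN n _; set sM := sumN n _.
pose k := sumN n (fun c => prl c v && has c).
have le : sH + k <= 2 * sM.
  rewrite /sH /k /sM -sumND -sumN_muln; apply: leq_sumN => c cn.
  case p: (prl c v); rewrite ?mul0n ?muln0 //= !mul1n; exact: IH.
have hv : has v -> M v || (0 < k).
  case/hasP=> w c m; case: (eqVneq v w) => [->|ne]; first by rewrite m.
  have [d p cd] := conn_child c ne; apply/orP; right.
  apply: leq_trans (leq_sumN1 _ (prl_ltl p)); rewrite p /=.
  by rewrite lt0b; apply/hasP; exists w.
rewrite /Mh Uv /= -/k; move: hv le; case: (M v) => /=; case: (has v) => /= hv le; lia.
Qed.

End Level.

(** * Paths at one level of the decomposition *)

(* The path between [s] and [t] with topmost vertex [a], as a set of lower end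
   points of edges. *)
Definition pathP (anc : nat -> nat -> bool) a s t v := [&& anc a v, v != a & anc v s || anc v t].

Lemma pathPC anc a s t v : pathP anc a s t v = pathP anc a t s v.
Proof. by rewrite /pathP orbC. Qed.

Section PathLevel.
Variables U M : nat -> bool.
Local Notation cn := (conn U).
Local Notation has := (hasm n anc U M).
Local Notation Mh := (Mh n anc prl U M).
Local Notation zr := (zr n anc prl U M).

(** [lp_U] and [lp_M] say that the level fits the path: no vertex of it lies in the coarser
    separator, some vertex lies in the finer one. The top vertex [a] counts here, although its own
    edge is not on the path. *)
Record lpath (a s t : nat) : Prop := LPath {
  lp_s : anc a s;
  lp_t : anc a t;
  lp_lca : forall v, anc v s -> anc v t -> anc v a;
  lp_U : forall v, anc a v -> anc v s || anc v t -> U v;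
  lp_M : exists m, [/\ anc a m, anc m s || anc m t & M m] }.

Lemma lpathC a s t : lpath a s t -> lpath a t s.
Proof.
case=> h1 h2 h3 h4 [m [m1 m2 m3]]; split=> //.
- by move=> v v1 v2; apply: h3.
- by move=> v v1 v2; apply: h4 => //; rewrite orbC.
by exists m; split=> //; rewrite orbC.
Qed.

Section OnePath.
Variables a s t : nat.
Hypothesis P : lpath a s t.
Local Notation inP := (pathP anc a s t).

Lemma lp_conn v : anc a v -> anc v s || anc v t -> cn a v.
Proof.
move=> av vst; apply/connP; split=> // y ay yv; apply: (lp_U P) => //.
by case/orP: vst => h; rewrite (anc_trans yv h) ?orbT.
Qed.

Lemma lp_conns : cn a s.
Proof. by apply: lp_conn (lp_s P) _; rewrite (anc_refl) // (anc_ltr (lp_s P)). Qed.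

Lemma lp_connt : cn a t.
Proof. by apply: lp_conn (lp_t P) _; rewrite (anc_refl) ?orbT // (anc_ltr (lp_t P)). Qed.

Lemma lp_has : has a.
Proof. by have [m [am mst Mm]] := lp_M P; apply/hasP; exists m => //; exact: lp_conn. Qed.

(** [y] is the root of the subtree hanging off the skeleton that contains [v]; its coin decides
    about the whole subtree. *)
Definition keyr v y := [&& cn y v, ~~ has y & hasN n (fun p => prl y p && has p)].

Lemma keyrP v y : reflect [/\ cn y v, ~~ has y & exists2 p, prl y p & has p] (keyr v y).
Proof.
apply: (iffP and3P) => -[h1 h2 h3]; split=> //.
  by case/hasNP: h3 => p _ /andP[]; exists p.
by case: h3 => p p1 p2; apply/hasNP; exists p; rewrite ?p1 //; exact: prl_ltr p1.
Qed.

Lemma key_ex r x : cn r x -> has r -> ~~ has x -> exists y, keyr x y.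
Proof.
move=> crx hr; move Ek : (dep x) => k; elim: k x Ek crx => [|k IH] x Ek crx nx.
  have E : r = x by apply: (anc_eq (conn_anc crx)); rewrite Ek.
  by rewrite -E hr in nx.
have ne : r != x by apply: contraNneq nx => <-.
have xn := anc_ltr (conn_anc crx); have Ux := (conn_U crx).2.
have p : prl x (par x).
  by rewrite /prlM xn eqxx lt0n -(dep_eq0) // Ek.
have [crp cpx] := conn_split crx (anc_to_par (conn_anc crx) ne) (anc_par xn).
case: (boolP (has (par x))) => [hp|np].
  by exists x; apply/keyrP; split=> //; [exact: conn_refl|exists (par x)].
have [|y /keyrP[y1 y2 y3]] := IH (par x) _ crp np; first by rewrite (dep_par) // Ek.
by exists y; apply/keyrP; split=> //; exact: conn_trans y1 cpx.
Qed.

(** If [w] were strictly above [y], the skeleton parent of [y] would lie below [w], and [w] would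
    belong to the skeleton itself. *)
Lemma key_mid v w y : keyr v y -> cn w v -> ~~ has w -> keyr w y.
Proof.
case/keyrP=> y1 y2 [p p1 p2] wv nw; apply/keyrP; split=> //; last by exists p.
have yw : anc y w.
  case/orP: (anc_total (conn_anc y1) (conn_anc wv)) => // wy.
  case: (eqVneq w y) => [->|ne]; first by apply: anc_refl (anc_ltl (conn_anc y1)).
  have [cwy _] := conn_split wv wy (conn_anc y1).
  have wp : anc w p by rewrite -(prlE p1); exact: anc_to_par.
  have [cwp _] := conn_split cwy wp (prl_anc p1).
  by rewrite (has_up cwp p2) in nw.
by have [] := conn_split y1 yw (conn_anc wv).
Qed.

Lemma key_uniq v y y' : keyr v y -> keyr v y' -> y = y'.
Proof.
move=> h h'; have /keyrP[y1 y2 _] := h; have /keyrP[y1' y2' _] := h'.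
have /keyrP[k1 _ _] := key_mid h y1' y2'; have /keyrP[k2 _ _] := key_mid h' y1 y2.
exact: anc_anti (conn_anc k1) (conn_anc k2).
Qed.

Section SideNodes.
Variable coin : nat -> bool.
Local Notation NA := (NA n anc prl U M coin).

Lemma NA_P w : reflect [/\ U w, ~~ has w & exists2 y, keyr w y & coin y] (NA w).
Proof.
apply: (iffP and3P) => -[h1 h2 h3]; split=> //.
  by case/hasNP: h3 => y _ /and4P[y1 y2 y3 y4]; exists y => //; apply/and3P.
case: h3 => y /[dup] /keyrP[ /conn_anc /anc_ltl yn _ _] /and3P[y1 y2 y3] y4.
by apply/hasNP; exists y; rewrite ?y1 ?y2 ?y3.
Qed.

(** A usable path vertex on the leg towards [t] would lie in the hanging subtree of [t], whose coin
    is 0. Conversely, a usable vertex above [s] in the component cannot lie above [a], since [a] is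
    on the skeleton. *)
Lemma side_good : (forall y, keyr t y -> ~~ coin y) ->
  forall w, NA w -> inP w = cn w s.
Proof.
move=> Ht w /NA_P[Uw nw [y kw cy]]; apply/idP/idP => [/and3P[aw wa]|cws].
  case/orP=> [ws|wt].
    by have [] := conn_split lp_conns aw ws.
  have [_ cwt] := conn_split lp_connt aw wt.
  have nt : ~~ has t by apply: contra nw; exact: has_up.
  have [y' ky'] := key_ex lp_connt lp_has nt.
  by have := Ht _ ky'; rewrite -(key_uniq kw (key_mid ky' cwt nw)) cy.
have aw : anc a w.
  case/orP: (anc_total (lp_s P) (conn_anc cws)) => // wa.
  have [cwa _] := conn_split cws wa (lp_s P).
  by rewrite (has_up cwa lp_has) in nw.
rewrite /pathP aw (conn_anc cws) andbT /=.
by apply: contraNneq nw => ->; exact: lp_has.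
Qed.

Lemma side_NA w y : keyr s y -> coin y ->
  [&& anc a w, anc w s & ~~ has w] -> NA w && cn w s.
Proof.
move=> ky cy /and3P[aw ws nw].
have [_ cws] := conn_split lp_conns aw ws; rewrite cws andbT.
apply/NA_P; split=> //; first by case: (conn_U cws).
by exists y => //; exact: key_mid cws nw.
Qed.

End SideNodes.

(** The leg from [a] to [x] leaves the skeleton, or ends, in segment [z]: it enters the segment
    strictly below [a] but does not reach its lowest vertex. *)
Definition c2 x z := hasN n (fun w => [&& zr w z, anc w x, anc a w, w != a & ~~ anc z x]).

(** Of two segments met by one leg, [zr_sep] makes the leg pass the lowest vertex of the upper
    one. *)
Lemma c2_uniq x z z' : cn a x -> c2 x z -> c2 x z' -> z = z'.
Proof.
move=> cax /hasNP[w _ /and5P[h wx aw wa zx]] /hasNP[w' _ /and5P[h' wx' aw' wa' zx']].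
apply/eqP; apply: contraT => ne.
have [_ cw] := conn_split cax aw wx; have [_ cw'] := conn_split cax aw' wx'.
case/orP: (anc_total wx wx') => ww.
  have [cww _] := conn_split cw ww wx'.
  by rewrite (anc_trans (zr_sep h h' cww ne) wx') in zx.
have [cww _] := conn_split cw' ww wx; rewrite eq_sym in ne.
by rewrite (anc_trans (zr_sep h' h cww ne) wx) in zx'.
Qed.

Definition part z := hasN n (fun w => zr w z && inP w) && hasN n (fun w => zr w z && ~~ inP w).

Lemma partP z : reflect ((exists2 w, zr w z & inP w) /\ (exists2 w, zr w z & ~~ inP w)) (part z).
Proof.
apply: (iffP andP) => [[/hasNP[w _ /andP[w1 w2]] /hasNP[v _ /andP[v1 v2]]]|[[w w1 w2] [v v1 v2]]].
  by split; [exists w|exists v].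
split; apply/hasNP.
  by exists w; [exact: anc_ltl (zr_anc w1)|rewrite w1].
by exists v; [exact: anc_ltl (zr_anc v1)|rewrite v1].
Qed.

(* The part of a segment covered by the path is everything below some node
   ([kap = 1]) or everything above some node ([kap = 0]). *)
Definition piece kap z v :=
  [/\ zr v z, forall w, zr w z -> inP w = chK anc kap v w &
      exists w0, [/\ zr w0 z, ~~ chK anc kap v w0 & cn a w0]].

(** The top [a] of the path lies inside the segment, so exactly the part strictly below [a] is
    covered. It begins at the child of [a] towards [z], and [a] is the uncovered vertex. *)
Lemma lower_part z : zr a z -> a != z -> (forall w, zr w z -> anc w s || anc w t) ->
  exists v, piece 1 z v.
Proof.
move=> ha az hst; have [v p vz] := anc_child (zr_anc ha) az.
have hv := zr_mid ha (prl_anc p) vz; exists v; split=> //.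
  move=> w hw; rewrite /pathP hst // andbT /chK /=; apply/andP/idP => [[aw wa]|vw].
    apply: (anc_chain vz (zr_anc hw)); rewrite (prl_dep p).
    by apply: anc_ltdep aw _; rewrite eq_sym.
  split; first exact: anc_trans (prl_anc p) vw.
  apply/eqP => E; have := anc_dep vw; rewrite E (prl_dep p) ltnn //.
exists a; split=> //.
  by rewrite /chK /=; apply/negP => /anc_dep; rewrite (prl_dep p) ltnn.
apply: conn_refl => //; first exact: anc_ltl (lp_s P).
exact: has_U lp_has.
Qed.

(** The leg towards [x] stops short of [z]; the deepest segment vertex on this leg ends the covered
    part, and [z] is the uncovered vertex. *)
Lemma upper_part x x' z w : x = s /\ x' = t \/ x = t /\ x' = s ->
  ~~ anc z x -> ~~ anc z x' -> zr w z -> anc w x -> anc a w -> w != a ->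
  exists v, piece 0 z v.
Proof.
move=> Exx zx zx' hw wx aw wa.
have lca v : anc v x -> anc v x' -> anc v a.
  by case: Exx => -[-> ->] h1 h2; apply: (lp_lca P).
have inPE v : inP v = [&& anc a v, v != a & anc v x || anc v x'].
  by case: Exx => -[-> ->] //; exact: pathPC.
have wn := anc_ltl wx.
pose Q (i : 'I_n) := zr i z && anc i x.
have Qw : Q (Ordinal wn) by rewrite /Q /= hw wx.
case: (arg_maxnP (fun i : 'I_n => dep i) Qw) => v /andP[hv vx] vmax.
have wv : anc w v by apply: (anc_chain wx vx); exact: (vmax (Ordinal wn)).
have zv : ~~ anc z v by apply: contra zx => zv; exact: anc_trans zv vx.
exists v; split=> //; last first.
  have zn : z < n := anc_ltr (zr_anc hw).
  exists z; split=> //; first exact: (zr_refl zn (zr_Mh hw)).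
  apply: (conn_trans (lp_conn aw _) (zr_conn hw)).
  by case: Exx => -[<- _]; rewrite wx ?orbT.
move=> w' hw'; rewrite inPE /chK /=; apply/idP/idP => [/and3P[aw' wa' /orP[w'x|w'x']]|w'v].
- apply: (anc_chain w'x vx); exact: (vmax (Ordinal (anc_ltl w'x))) (introT andP (conj hw' w'x)).
- case/orP: (anc_total (zr_anc hw) (zr_anc hw')) => ww.
    have wa2 := lca w wx (anc_trans ww w'x').
    by rewrite (anc_anti wa2 aw) eqxx in wa.
  exact: anc_trans ww wv.
have w'x := anc_trans w'v vx; rewrite w'x /= andbT.
case: (boolP (anc w' a)) => [w'a|nw'a]; last first.
  have aw' : anc a w' by case/orP: (anc_total w'x (anc_trans aw wx)) => // h; rewrite h in nw'a.
  by rewrite aw' /=; apply: contraNneq nw'a => ->; apply: (anc_refl); exact: anc_ltl aw.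
have az : anc a z := anc_trans aw (zr_anc hw).
have ha : zr a z := zr_mid hw' w'a az.
(* Once the segment reaches up to [a], [zr_sep] puts the mark met by the path below or at [z], so
   one of the legs passes [z], a contradiction. *)
have [m [am mst Mm]] := lp_M P.
have cam := lp_conn am mst; have mn := anc_ltr am.
have Mhm : Mh m by rewrite /Mh (conn_U cam).2 Mm.
have zm : anc z m.
  case: (eqVneq z m) => [->|ne]; first exact: anc_refl.
  exact: (zr_sep ha (zr_refl mn Mhm) cam ne).
case: Exx => -[Ex Ex']; rewrite Ex Ex' in zx zx'; case/orP: mst => h;
  by move: (anc_trans zm h); rewrite ?(negPf zx) ?(negPf zx').
Qed.

Lemma part_cases z : part z -> (zr a z || c2 s z || c2 t z) /\
  exists kap v, kap < 2 /\ piece kap z v.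
Proof.
move=> /partP[[w hw /and3P[aw wa wst]] [w0 hw0 nw0]].
have wn := anc_ltr aw.
case: (boolP (anc z s || anc z t)) => [zst|/norP[zs zt]].
  have st v : zr v z -> anc v s || anc v t.
    by move=> hv; case/orP: zst => h; rewrite (anc_trans (zr_anc hv) h) ?orbT.
  have az : anc a z := anc_trans aw (zr_anc hw).
  have az' : a != z.
    by apply: contraNneq wa => E; rewrite E in aw *; rewrite (anc_anti aw (zr_anc hw)).
  have ha : zr a z.
    move: nw0; rewrite /pathP (st _ hw0) andbT negb_and negbK => /orP[naw0|/eqP <-//].
    apply: (zr_mid hw0 _ az); case/orP: (anc_total az (zr_anc hw0)) => // h.
    by rewrite h in naw0.
  split; first by rewrite ha.
  by have [v pv] := lower_part ha az' st; exists 1, v.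
case/orP: wst => wx.
  split; last by have [v pv] := upper_part (or_introl (conj erefl erefl)) zs zt hw wx aw wa; exists 0, v.
  by apply/orP; left; apply/orP; right; apply/hasNP; exists w; rewrite // hw wx aw wa zs.
split; last by have [v pv] := upper_part (or_intror (conj erefl erefl)) zt zs hw wx aw wa; exists 0, v.
by apply/orP; right; apply/hasNP; exists w; rewrite // hw wx aw wa zt.
Qed.

(** The candidates are the segment of [a] and, on each of the two legs, the segment in which the leg
    leaves the skeleton or ends. *)
Lemma part_le3 : sumN n part <= 3.
Proof.
apply: (@leq_trans (sumN n (fun z => zr a z) + sumN n (c2 s) + sumN n (c2 t))).
  rewrite -!sumND; apply: leq_sumN => z _; case pz: (part z) => //.
  by have [/orP[/orP[]|] ->] := part_cases pz; lia.
have l1 : sumN n (fun z => zr a z) <= 1 by apply: sumN_le1 => i j _ _; exact: zr_uniq.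
have l2 : sumN n (c2 s) <= 1 by apply: sumN_le1 => i j _ _; exact: c2_uniq lp_conns.
have l3 : sumN n (c2 t) <= 1 by apply: sumN_le1 => i j _ _; exact: c2_uniq lp_connt.
lia.
Qed.

Lemma npart z w : zr w z -> ~~ part z -> inP w = inP z.
Proof.
move=> hw np; have zn : z < n := anc_ltr (zr_anc hw).
have hz := zr_refl zn (zr_Mh hw); apply/idP/idP => h; apply: contraT => h'; case/negP: np.
  by apply/partP; split; [exists w|exists z].
by apply/partP; split; [exists z|exists w].
Qed.

(** * Optimal edges on a path, split into segments and sides *)

Section Counts.
Variable F : nat -> bool.

Definition side x := sumN n (fun w => [&& anc a w, anc w x, ~~ has w & F w]).
Definition segc z := sumN n (fun w => zr w z && F w).
Definition piecec z := sumN n (fun w => [&& zr w z, inP w & F w]).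
Definition fullc := sumN n (fun z => [&& Mh z, ~~ part z & inP z] * segc z).
Definition pathc := sumN n (fun w => inP w && F w).

Lemma pathc_segs : sumN n (fun w => has w && (inP w && F w)) = sumN n piecec.
Proof.
rewrite /piecec sumN_exch; apply: eq_sumN => w wn; case: (boolP (has w)) => [hw|nw] /=.
  have [z hz] := zr_ex hw; rewrite (@sumN_pick _ _ z) ?hz //; first exact: anc_ltr (zr_anc hz).
  by move=> z' _ ne; case h: (zr w z') => //; rewrite (zr_uniq h hz) eqxx in ne.
by rewrite sumN0 // => z _; case h: (zr w z) => //; rewrite (zr_has h) in nw.
Qed.

Lemma piecec_npart z : ~~ part z -> piecec z = inP z * segc z.
Proof.
move=> np; rewrite /piecec /segc -sumN_muln; apply: eq_sumN => w _.
by case h: (zr w z); rewrite ?muln0 //= (npart h np) mulnb.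
Qed.

Lemma piecec0 z : ~~ Mh z -> piecec z = 0.
Proof.
by move=> nm; apply: sumN0 => w _; case h: (zr w z) => //; rewrite (zr_Mh h) in nm.
Qed.

Lemma piecec_sum : sumN n piecec = fullc + sumN n (fun z => part z * piecec z).
Proof.
rewrite /fullc -sumND; apply: eq_sumN => z _; case pz: (part z) => /=.
  by rewrite andbF mul1n.
rewrite mul0n addn0; case mz: (Mh z); first by rewrite piecec_npart ?pz.
by rewrite piecec0 ?mz.
Qed.

Lemma pathc_le : pathc <= fullc + (side s + side t + sumN n (fun z => part z * piecec z)).
Proof.
rewrite addnCA -piecec_sum -pathc_segs /side /pathc -!sumND; apply: leq_sumN => w _.
case: (boolP (inP w)) => //= /and3P[aw wa wst]; case: (F w) => //=.
by case: (boolP (has w)) => hw //=; rewrite ?aw /=; case/orP: wst => -> //=; lia.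
Qed.

(** Feasibility in a partial segment rests on this: the full segments and one partial piece are
    disjoint parts of the path, so staying within the counts of the optimum on them keeps the total
    within [u_i]. *)
Lemma full_piece_le z : part z -> fullc + piecec z <= pathc.
Proof.
move=> pz; have zn : z < n.
  by have /partP[[w h _] _] := pz; exact: anc_ltr (zr_anc h).
apply: (@leq_trans (sumN n piecec)).
  rewrite piecec_sum leq_add2l.
  by apply: leq_trans (leq_sumN1 (fun z => part z * piecec z) zn); rewrite pz mul1n.
by rewrite -pathc_segs; apply: leq_sumN => w _; case: (has w).
Qed.

Lemma full_le : fullc <= pathc.
Proof.
apply: (@leq_trans (sumN n piecec)); first by rewrite piecec_sum leq_addr.
by rewrite -pathc_segs; apply: leq_sumN => w _; case: (has w).
Qed.

Lemma side_le : side s <= pathc.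
Proof.
apply: leq_sumN => w _; case: (boolP [&& _, _, _ & _]) => // /and4P[aw ws nw Fw].
rewrite /pathP aw ws Fw /= andbT; have -> // : w != a.
by apply: contraNneq nw => ->; exact: lp_has.
Qed.

Lemma segc_le z : segc z <= n.
Proof.
rewrite /segc /sumN; apply: (@leq_trans (\sum_(i < n) 1)); last by rewrite sum1_card card_ord.
by apply: leq_sum => i _; case: (_ && _).
Qed.

End Counts.
End OnePath.
End PathLevel.

(** * The three kinds of candidate solutions *)

Section Kinds.
Variables U M : nat -> bool.
Local Notation cn := (conn U).
Local Notation has := (hasm n anc U M).
Local Notation Mh := (Mh n anc prl U M).
Local Notation zr := (zr n anc prl U M).
Local Notation same := (same n anc prl U M).

Lemma sameP v w : reflect (exists2 z, zr v z & zr w z) (same v w).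
Proof.
apply: (iffP (hasNP _ _)) => [[z _ /andP[]]|[z h1 h2]]; first by exists z.
by exists z; rewrite ?h1 ?h2 //; exact: anc_ltr (zr_anc h1).
Qed.

Lemma same_zr v w z : same v w -> zr v z -> zr w z.
Proof. by case/sameP=> z' h h' hv; rewrite -(zr_uniq h hv). Qed.

Lemma zr_same v w z : zr v z -> zr w z -> same v w.
Proof. by move=> h h'; apply/sameP; exists z. Qed.

(** * The forest of the side candidate *)

Section SideForest.
Variable coin : nat -> bool.
Local Notation NA := (NA n anc prl U M coin).
Local Notation PrA := (PrA n anc prl U M coin).
Local Notation ChA := (ChA n anc prl U M coin).

Lemma PrA_P v p : reflect [/\ NA v, NA p & prl v p] (PrA v p).
Proof. exact: and3P. Qed.

Lemma ChA_P v w : reflect [/\ NA v, NA w, cn w v & w != v] (ChA v w).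
Proof. exact: and4P. Qed.

(** [ChA] is the transitive closure of [PrA], the form that the dynamic program expects. All
    vertices between two usable ones of a chain lie in the same hanging subtree, hence are usable
    too. *)
Lemma ChA_step v w : ChA v w <-> exists2 p, PrA v p & w = p \/ ChA p w.
Proof.
split=> [/ChA_P[Nv Nw wv ne]|[p /PrA_P[Nv Np pv]]].
  have vn := anc_ltr (conn_anc wv).
  have v0 : 0 < v.
    rewrite lt0n -dep_eq0 // -lt0n; apply: leq_ltn_trans (anc_ltdep (conn_anc wv) ne); exact: leq0n.
  have pv : prl v (par v) by rewrite /prlM vn v0 eqxx.
  have [cwp cpv] := conn_split wv (anc_to_par (conn_anc wv) ne) (anc_par vn).
  have /(NA_P)[Uw nw _] := Nw; have /NA_P[Uv nv [y ky cy]] := Nv.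
  have np : ~~ has (par v) by apply: contra nw; exact: has_up.
  have Np : NA (par v).
    apply/NA_P; split=> //; first by case: (conn_U cpv).
    by exists y => //; exact: key_mid cpv np.
  exists (par v); first by apply/PrA_P.
  by case: (eqVneq w (par v)) => [->|ne']; [left|right; apply/ChA_P].
have cpv : cn p v.
  by apply: conn_prl => //; [case/NA_P: Nv|case/NA_P: Np].
case=> [->|/ChA_P[_ Nw wp ne]]; apply/ChA_P; split=> //.
- by rewrite eq_sym; exact: prl_ne.
- exact: conn_trans cpv.
by apply/eqP => E; have := anc_dep (conn_anc wp); rewrite E (prl_dep pv) ltnn.
Qed.

(** Each of two serving vertices is on the path, hence on the chain of the other. A commodity is
    therefore paid at one vertex only and its weight is never counted twice. *)
Lemma RwA_uniq inP u i v v' j j' :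
  RwA n anc prl U M coin inP u i v j -> RwA n anc prl U M coin inP u i v' j' -> v = v'.
Proof.
case/and3P=> Nv /allNP H _ /and3P[Nv' /allNP H' _].
have lt w : NA w -> w < n by case/NA_P=> _ _ [y /and3P[/conn_anc/anc_ltr]].
have refl w : NA w -> cn w w by move=> Nw; apply: conn_refl (lt _ Nw) _; case/NA_P: Nw.
have e1 : inP i v by have := H v (lt _ Nv); rewrite Nv refl // => /eqP.
have e2 : inP i v' by have := H' v' (lt _ Nv'); rewrite Nv' refl // => /eqP.
have := H' v (lt _ Nv); have := H v' (lt _ Nv'); rewrite Nv Nv' e1 e2 /= => /eqP h1 /eqP h2.
exact: anc_anti (conn_anc (esym h2)) (conn_anc (esym h1)).
Qed.

Lemma RwA_count inP u i v j (F : nat -> bool) : RwA n anc prl U M coin inP u i v j ->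
  (forall w, w < n -> F w -> NA w) ->
  sumN n (fun w => inP i w && F w) = sumN n (fun w => ChA v w && F w) + F v.
Proof.
case/and3P=> Nv /allNP H _ FN; have vn : v < n by case/NA_P: Nv => _ _ [y /and3P[/conn_anc/anc_ltr]].
have cvv : cn v v by apply: conn_refl => //; case/NA_P: Nv.
have -> : (F v : nat) = sumN n (fun w => (w == v) && F w).
  by rewrite (@sumN_pick _ _ v) ?eqxx // => i' _ /negPf ->.
rewrite -sumND; apply: eq_sumN => w wn; case Fw: (F w); last by rewrite !andbF.
have Nw := FN w wn Fw; have := H w wn; rewrite Nw /= => /eqP ->.
rewrite !andbT /ChA Nv Nw /=; case: (eqVneq w v) => [->|ne]; first by rewrite cvv andbF.
by rewrite andbT addn0.
Qed.

End SideForest.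

(** * The chains of the segment candidate *)

Section SegForest.
Variables (x : nat -> nat) (c : nat).
Local Notation NK := (NK n anc prl U M x c).
Local Notation PrK := (PrK n anc prl U M x c).
Local Notation ChK := (ChK n anc prl U M x c).
Local Notation CapK := (CapK n anc prl U M x).
Local Notation chK := (chK anc).

Lemma NK_P v : reflect (cn c v /\ exists2 z, zr v z & 0 < x z) (NK v).
Proof.
apply: (iffP andP) => -[cv]; first by case/hasNP=> z _ /andP[]; split=> //; exists z.
by case=> z h xz; split=> //; apply/hasNP; exists z; rewrite ?h //; exact: anc_ltr (zr_anc h).
Qed.

Lemma NK_lt v : NK v -> v < n.
Proof. by case/NK_P=> /conn_anc/anc_ltr. Qed.

Lemma NK_seg v w z : NK v -> zr v z -> zr w z -> cn c w -> NK w.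
Proof.
case/NK_P=> cv [z' h' xz] h hw cw; apply/NK_P; split=> //; exists z => //.
by rewrite (zr_uniq h h').
Qed.

Lemma PrK_P kap v p : reflect [/\ NK v, NK p, same v p & if kap == 0 then prl v p else prl p v]
  (PrK kap v p).
Proof. exact: and4P. Qed.

Lemma ChK_P kap v w : reflect [/\ NK v, NK w, same v w, chK kap v w & w != v] (ChK kap v w).
Proof. exact: and5P. Qed.

Lemma chK_refl kap v : v < n -> chK kap v v.
Proof. by move=> vn; rewrite /chK; case: ifP => _; exact: anc_refl. Qed.

Lemma ChK_step kap v w : ChK kap v w <-> exists2 p, PrK kap v p & w = p \/ ChK kap p w.
Proof.
split=> [/ChK_P[Nv Nw s ch ne]|[p /PrK_P[Nv Np s pv]]].
  have vn := NK_lt Nv; have wn := NK_lt Nw.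
  have [z hv hw] := sameP _ _ s; have /NK_P[cv _] := Nv; have /NK_P[cw _] := Nw.
  move: ch; rewrite /chK; case E: (kap == 0) => ch.
    have v0 : 0 < v.
      rewrite lt0n -dep_eq0 // -lt0n; apply: leq_ltn_trans (anc_ltdep ch ne); exact: leq0n.
    have pv : prl v (par v) by rewrite /prlM vn v0 eqxx.
    have wp := anc_to_par ch ne; have ap := anc_par vn.
    have hp : zr (par v) z := zr_mid hw wp (anc_trans ap (zr_anc hv)).
    have [cp _] := conn_split cv (anc_trans (conn_anc cw) wp) ap.
    have Np := NK_seg Nv hv hp cp.
    exists (par v); first by apply/PrK_P; rewrite E; split=> //; exact: zr_same hp.
    case: (eqVneq w (par v)) => [->|ne']; [by left|right; apply/ChK_P; split=> //].
      exact: zr_same hw.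
    by rewrite /chK E.
  rewrite eq_sym in ne; have [p pv pw] := anc_child ch ne.
  have hp : zr p z := zr_mid hv (prl_anc pv) (anc_trans pw (zr_anc hw)).
  have cvp : cn v p.
    by have [] := conn_split (zr_conn hv) (prl_anc pv) (zr_anc hp).
  have Np := NK_seg Nv hv hp (conn_trans cv cvp).
  exists p; first by apply/PrK_P; rewrite E; split=> //; exact: zr_same hp.
  case: (eqVneq w p) => [->|ne']; [by left|right; apply/ChK_P; split=> //].
    exact: zr_same hw.
  by rewrite /chK E.
have [z hv hp] := sameP _ _ s.
case=> [->|/ChK_P[_ Nw s' ch ne]]; apply/ChK_P; split=> //.
- by rewrite /chK; case: ifP pv => _ pv; exact: prl_anc.
- by case: ifP pv => _ pv; [rewrite eq_sym|]; exact: prl_ne.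
- exact: zr_same hv (same_zr s' hp).
- move: ch; rewrite /chK; case: ifP pv => _ pv ch.
    exact: anc_trans (prl_anc pv).
  exact: anc_trans (prl_anc pv) ch.
- apply/eqP => E; rewrite E in ch; move: ch; rewrite /chK; case: ifP pv => _ pv /anc_dep;
  by rewrite (prl_dep pv) ltnn.
Qed.

(** Segments are vertical, so they are chains in both directions: downwards ([kap = 1]), the
    successor is the only child above or at the lowest vertex of the segment. *)
Lemma PrK_uniq kap v p p' : PrK kap v p -> PrK kap v p' -> p = p'.
Proof.
case/PrK_P=> _ _ s pv /PrK_P[_ _ s' pv']; have [z hv hp] := sameP _ _ s.
have hp' := same_zr s' hv.
move: pv pv'; case: ifP => _ pv pv'; first by rewrite -(prlE pv) -(prlE pv').
exact: (child_uniq pv pv' (zr_anc hp) (zr_anc hp')).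
Qed.

Lemma PrK_rho kap v p : PrK kap v p ->
  (if kap == 0 then dep p else n.-1 - dep p) < (if kap == 0 then dep v else n.-1 - dep v).
Proof.
case/PrK_P=> Nv Np _; have := rt_depn T (NK_lt Nv); have := rt_depn T (NK_lt Np).
by case: ifP => _ h1 h2 /prl_dep; lia.
Qed.

(** The budget of a segment read off at any of its vertices; it is constant along chains, as the
    truncation in [solve_opt] requires. *)
Definition xcap v := sumN n (fun z => zr v z * x z).

Lemma xcapE v z : zr v z -> xcap v = x z.
Proof.
move=> h; rewrite /xcap (@sumN_pick _ _ z) ?h ?mul1n //; first exact: anc_ltr (zr_anc h).
by move=> z' _ ne; case h': (zr v z') => //; rewrite (zr_uniq h' h) eqxx in ne.
Qed.

Lemma CapK_xcap v j : NK v -> j <= xcap v -> CapK v j.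
Proof.
case/NK_P=> _ [z h _]; rewrite (xcapE h) => le; apply/hasNP; exists z; rewrite ?h //.
exact: anc_ltr (zr_anc h).
Qed.

Section Sound.
Variables (kap : nat) (inP : nat -> nat -> bool) (i : nat) (F : nat -> bool).
Local Notation Good := (GoodK n anc prl U M x c kap inP i).
Hypothesis FN : forall w, w < n -> F w -> NK w.
Local Notation h v := (sumN n (fun w => ChK kap v w && F w) + F v).
Hypothesis FC : forall w, w < n -> F w -> CapK w (h w).

Lemma Good_in v w : Good v -> NK w -> same v w -> inP i w = chK kap v w.
Proof. by case/and3P=> _ /allNP H _ Nw s; have := H w (NK_lt Nw); rewrite Nw s => /eqP. Qed.

Lemma Good_out v w z : Good v -> NK w -> ~~ same v w -> zr w z -> inP i w = inP i z.
Proof.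
case/and3P=> _ /allNP H _ Nw s hw; have := H w (NK_lt Nw); rewrite Nw (negPf s) /=.
by move/allNP/(_ z (anc_ltr (zr_anc hw))); rewrite hw => /eqP.
Qed.

(** Within one segment each vertex lies on the chain of the other. In different segments, the
    segment of [v'] must be covered uniformly as seen from [v], yet it contains the covered [v']
    and, by the last clause of [GoodK], an uncovered vertex. *)
Lemma Good_uniq v v' : Good v -> Good v' -> v = v'.
Proof.
move=> g g'; have /and3P[Nv _ _] := g; have /and3P[Nv' _ /hasNP[w wn /and3P[Nw s' nch]]] := g'.
have in' : inP i v'.
  have /NK_P[_ [z hz _]] := Nv'.
  by rewrite (Good_in g' Nv' (zr_same hz hz)) chK_refl // NK_lt.
have iv : inP i v.
  have /NK_P[_ [z hz _]] := Nv.
  by rewrite (Good_in g Nv (zr_same hz hz)) chK_refl // NK_lt.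
case: (boolP (same v v')) => [s|ns].
  have s2 : same v' v by case/sameP: s => z h1 h2; exact: zr_same h2 h1.
  have h1 := Good_in g Nv' s; have h2 := Good_in g' Nv s2.
  rewrite iv in h2; rewrite in' in h1; move: h1 h2; rewrite /chK; case: ifP => _ h1 h2.
    exact: anc_anti (esym h2) (esym h1).
  exact: anc_anti (esym h1) (esym h2).
have [z hz hwz] := sameP _ _ s'.
have ns2 : ~~ same v w.
  by apply: contra ns => /sameP[z' h1 h2]; rewrite (zr_uniq h2 hwz) in h1; exact: zr_same hz.
have := Good_in g' Nw s'; rewrite (negPf nch).
by rewrite (Good_out g Nw ns2 hwz) -(Good_out g Nv' ns hz) in'.
Qed.

(** The capacity test at the chosen vertex from which the chain direction reaches all others (the
    deepest or the topmost one) sees every chosen vertex of the segment. *)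
Lemma seg_total z : sumN n (fun w => zr w z && F w) <= x z.
Proof.
case: (boolP (hasN n (fun w => zr w z && F w))) => [/hasNP[w0 w0n w0F]|no]; last first.
  rewrite sumN0 // => w wn; apply/eqP; rewrite eqb0; apply: contra no => hw.
  by apply/hasNP; exists w.
pose Q (j : 'I_n) := zr j z && F j.
have [v hv [Fv vmax]] : exists2 v : 'I_n, zr v z & F v /\ forall w, w < n -> zr w z -> F w -> chK kap v w.
  case E: (kap == 0).
    case: (arg_maxnP (fun j : 'I_n => dep j) (w0F : Q (Ordinal w0n))) => v /andP[hv Fv] vmax.
    exists v => //; split=> // w wn hw Fw; rewrite /chK E.
    by apply: (anc_chain (zr_anc hw) (zr_anc hv)); apply: (vmax (Ordinal wn)); rewrite /Q hw.
  case: (arg_minnP (fun j : 'I_n => dep j) (w0F : Q (Ordinal w0n))) => v /andP[hv Fv] vmin.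
  exists v => //; split=> // w wn hw Fw; rewrite /chK E.
  by apply: (anc_chain (zr_anc hv) (zr_anc hw)); apply: (vmin (Ordinal wn)); rewrite /Q hw.
have vn := ltn_ord v; have Nv := FN vn Fv.
have /hasNP[z' _ /andP[hv' le]] := FC vn Fv.
rewrite (zr_uniq hv hv'); apply: leq_trans le.
have -> : (F v : nat) = sumN n (fun w => (w == v) && F w).
  by rewrite (@sumN_pick _ _ v) ?eqxx // => j _ /negPf ->.
rewrite -sumND; apply: leq_sumN => w wn; case hw: (zr w z') => //=; case Fw: (F w) => //=.
rewrite !andbT; case: (eqVneq w v) => [->|ne]; first by rewrite addn1.
rewrite addn0 /ChK Nv (FN wn Fw) (zr_same hv' hw) ne vmax //.
by rewrite -(zr_uniq hv hv') in hw.
Qed.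

(** The lower bound yields the revenue, through monotonicity of [f]; the upper bound yields
    feasibility, each other covered segment contributing at most its budget. *)
Lemma Good_count v : Good v ->
  h v <= sumN n (fun w => inP i w && F w) <= h v + XK n anc prl U M x c inP i v.
Proof.
move=> g; have /and3P[Nv _ _] := g; have vn := NK_lt Nv.
have /NK_P[cv [zv hv _]] := Nv.
have Fv : (F v : nat) = sumN n (fun w => (w == v) && F w).
  by rewrite (@sumN_pick _ _ v) ?eqxx // => j _ /negPf ->.
have hE : h v = sumN n (fun w => [&& same v w, inP i w & F w]).
  rewrite Fv -sumND; apply: eq_sumN => w wn; case Fw: (F w); last by rewrite !andbF.
  rewrite !andbT; have Nw := FN wn Fw; case s: (same v w) => /=; last first.
    rewrite /ChK s /= !andbF add0n; case: eqP => // E.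
    by rewrite E (zr_same hv hv) in s.
  rewrite (Good_in g Nw s) /ChK Nv Nw s /=; case: (eqVneq w v) => [->|ne].
    by rewrite chK_refl.
  by rewrite andbT addn0.
have cE : sumN n (fun w => inP i w && F w) = h v +
    sumN n (fun w => [&& ~~ same v w, inP i w & F w]).
  rewrite hE -sumND; apply: eq_sumN => w _; case: (same v w) => /=; by rewrite ?addn0 ?add0n.
rewrite cE leq_addr leq_add2l /=.
rewrite /XK; apply: (@leq_trans (sumN n (fun z =>
   [&& cn c z, Mh z, ~~ zr v z & inP i z] * sumN n (fun w => zr w z && F w)))); last first.
  by apply: leq_sumN => z _; rewrite leq_mul2l seg_total orbT.
rewrite (@eq_sumN _ (fun z => _ * sumN _ _) (fun z => sumN n (fun w =>
   [&& cn c z, Mh z, ~~ zr v z & inP i z] * (zr w z && F w)))); last first.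
  by move=> z _; rewrite sumN_muln.
rewrite sumN_exch; apply: leq_sumN => w wn.
case: (boolP [&& _, _ & _]) => // /and3P[ns iw Fw]; have Nw := FN wn Fw.
have /NK_P[cw [z hw _]] := Nw.
apply: leq_trans (leq_sumN1 _ (anc_ltr (zr_anc hw))).
rewrite (conn_trans cw (zr_conn hw)) (zr_Mh hw) hw Fw -(Good_out g Nw ns hw) iw andbT /=.
by case hvz: (zr v z) => //; rewrite (zr_same hvz hw) in ns.
Qed.

End Sound.

(** Budget zero removes a segment from [NK]. With the other partial segments removed, every
    remaining segment is covered entirely or not at all, as [GoodK] demands. *)
Lemma Good_complete a s t inP i kap z v : lpath U M a s t ->
  (forall w, w < n -> inP i w = pathP anc a s t w) ->
  cn c a -> 0 < x z -> piece U M a s t kap z v ->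
  (forall z', z' != z -> part U M a s t z' -> x z' = 0) ->
  GoodK n anc prl U M x c kap inP i v.
Proof.
move=> P iE ca xz [hv Hv [w0 [hw0 nw0 cw0]]] off.
have iv : pathP anc a s t v.
  by rewrite Hv // chK_refl //; exact: anc_ltl (zr_anc hv).
have cv : cn c v.
  by case/and3P: iv => av _ vst; apply: conn_trans ca (lp_conn P av vst).
have Nv : NK v by apply/NK_P; split=> //; exists z.
apply/and3P; split=> //; last first.
  have Nw0 := NK_seg Nv hv hw0 (conn_trans ca cw0).
  apply/hasNP; exists w0; first exact: NK_lt.
  by rewrite Nw0 (zr_same hv hw0) nw0.
apply/allNP => w wn; apply/implyP => Nw; case: ifP => [sm|ns].
  by rewrite iE // Hv //; exact: same_zr sm hv.
apply/allNP => z' zn'; apply/implyP => hw; rewrite !iE //; apply/eqP.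
have /NK_P[_ [z2 h2 xz2]] := Nw; have E := zr_uniq h2 hw.
apply: npart hw _; apply/negP => pz; move: xz2; rewrite E off // -?E.
by apply/eqP => E2; rewrite E2 in h2; rewrite (zr_same hv h2) in ns.
Qed.

Lemma XK_full a s t inP i z v F : lpath U M a s t ->
  (forall w, w < n -> inP i w = pathP anc a s t w) -> zr v z ->
  (forall z', z' != z -> part U M a s t z' -> x z' = 0) ->
  (forall z', cn c z' -> Mh z' -> x z' <= segc U M F z') ->
  XK n anc prl U M x c inP i v <= fullc U M a s t F.
Proof.
move=> P iE hv off xle; apply: leq_sumN => z' zn'; rewrite iE //.
case: (boolP (zr v z')) => [_|nv]; first by rewrite /= !andbF.
have ne : z' != z by apply: contraNneq nv => ->.
case: (boolP (part U M a s t z')) => pz; first by rewrite (off _ ne pz) muln0.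
case: (boolP (cn c z')) => //= cz; case: (boolP (Mh z')) => //= mz.
by rewrite leq_mul // xle.
Qed.

(** * The candidate of lowest segment vertices *)

Section Mid.
Local Notation FM := (FM n anc prl U M x c).

(** Counting the segment vertices below is a bijection from the segment onto an initial interval:
    depths are distinct along a vertical chain, and so are these ranks. *)
Lemma seg_rank z k : k <= sumN n (fun w => zr w z) ->
  sumN n (fun v => zr v z && (sumN n (fun w => [&& zr w z, anc v w & w != v]) < k)) = k.
Proof.
pose S := [set v : 'I_n | zr v z]; pose m := #|S|.
have sumS (p : pred nat) : sumN n (fun w => zr w z && p w) = #|[set v in S | p v]|.
  rewrite /sumN -sum1_card [RHS]big_mkcond; apply: eq_bigr => w _.
  by rewrite !inE; case: (zr w z); case: (p w).
pose rk v := sumN n (fun w => [&& zr w z, anc v w & w != v]).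
have mE : sumN n (fun w => zr w z) = m.
  rewrite -[m]/#|S| /sumN -sum1_card [RHS]big_mkcond; apply: eq_bigr => w _.
  by rewrite inE; case: (zr w z).
have rk_lt (v : 'I_n) : v \in S -> rk v < m.
  move=> vS; rewrite /rk sumS; apply: proper_card; apply/properP; split.
    by apply/fintype.subsetP => w; rewrite inE => /andP[].
  by exists v => //; rewrite inE eqxx andbF andbF.
have rk_mono (v w : 'I_n) : v \in S -> w \in S -> dep v < dep w -> rk w < rk v.
  rewrite !inE => hv hw lt; rewrite /rk !sumS; apply: proper_card; apply/properP; split.
    apply/fintype.subsetP => y; rewrite !inE => /and3P[hy wy ne].
    have vw : anc v w by apply: (anc_chain (zr_anc hv) (zr_anc hw)); exact: ltnW.
    rewrite hy (anc_trans vw wy) /=; apply/eqP => E.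
    by have := anc_dep wy; rewrite E leqNgt lt.
  exists w; rewrite !inE ?eqxx ?andbF // hw /=.
  rewrite (anc_chain (zr_anc hv) (zr_anc hw)) ?(ltnW lt) //=.
  by apply/eqP => E; rewrite E ltnn in lt.
have rk_inj : {in S &, injective (fun v : 'I_n => rk v)}.
  move=> v w vS wS E; case: (ltngtP (dep v) (dep w)) => cmp.
  - by have := rk_mono _ _ vS wS cmp; rewrite E ltnn.
  - by have := rk_mono _ _ wS vS cmp; rewrite E ltnn.
  rewrite !inE in vS wS; apply: val_inj.
  by apply: anc_eq; rewrite ?cmp //; apply: (anc_chain (zr_anc vS) (zr_anc wS)); rewrite cmp.
rewrite mE => km; rewrite (sumS (fun v => rk v < k)).
have m0 : m <= n by rewrite -[m]/#|S|; apply: leq_trans (max_card _) _; rewrite card_ord.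
case: (posnP m) => [m_0|m_gt0].
  have -> : k = 0 by lia.
  by apply/eqP; rewrite cards_eq0; apply/eqP/setP => v; rewrite !inE ltn0 andbF.
pose g (v : 'I_n) : 'I_m := Ordinal (ltn_pmod (rk v) m_gt0).
have gE v : v \in S -> g v = rk v :> nat by move=> vS; rewrite /= modn_small // rk_lt.
have g_inj : {in S &, injective g}.
  by move=> v w vS wS /(congr1 val) /= E; apply: rk_inj => //; rewrite -!gE //= E.
have gS : g @: S = [set: 'I_m].
  by apply/eqP; rewrite eqEcard finset.subsetT cardsT card_ord (card_in_imset g_inj) leqnn.
rewrite -(@card_in_imset _ _ g [set v in S | rk v < k]); last first.
  by move=> v w; rewrite inE => /andP[vS _]; rewrite inE => /andP[wS _]; exact: g_inj.
have -> : g @: [set v in S | rk v < k] = [set j : 'I_m | j < k].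
  apply/setP => j; rewrite inE; apply/imsetP/idP => [[v]|jk].
    by rewrite inE => /andP[vS lt] ->; rewrite gE.
  have : j \in g @: S by rewrite gS inE.
  by case/imsetP=> v vS E; exists v => //; rewrite inE vS -gE // -E.
rewrite -sum1_card (eq_bigl (fun j : 'I_m => j < k)) => [|j]; last by rewrite inE.
by rewrite -(big_ord_widen m (fun=> 1) km) sum1_card card_ord.
Qed.

Lemma Mid_count a s t (inP : nat -> nat -> bool) i F : lpath U M a s t ->
  (forall w, w < n -> inP i w = pathP anc a s t w) -> cn c a ->
  (forall z, part U M a s t z -> x z = 0) ->
  (forall z, cn c z -> Mh z -> x z <= segc U M F z) ->
  sumN n (fun w => inP i w && FM w) =
  sumN n (fun z => [&& Mh z, ~~ part U M a s t z & pathP anc a s t z] * x z).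
Proof.
move=> P iE ca off xle.
pose rk z v := sumN n (fun w => [&& zr w z, anc v w & w != v]).
have inC w : pathP anc a s t w -> cn c w.
  by case/and3P=> av _ vst; apply: conn_trans ca (lp_conn P av vst).
transitivity (sumN n (fun w => sumN n (fun z => pathP anc a s t w && (zr w z && (rk z w < x z))))).
  apply: eq_sumN => w wn; rewrite iE //; case iw: (pathP anc a s t w); last by rewrite sumN0.
  rewrite /FM (inC _ iw) /=; case: (boolP (hasN n _)) => [/hasNP[z zn hz]|no].
    rewrite (@sumN_pick _ _ z) ?hz // => z' zn' ne; apply/eqP; rewrite eqb0.
    apply/negP => /andP[h' _]; case/andP: hz => h _; by rewrite (zr_uniq h' h) eqxx in ne.
  rewrite sumN0 // => z zn; apply/eqP; rewrite eqb0; apply: contra no => hz.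
  by apply/hasNP; exists z.
rewrite sumN_exch; apply: eq_sumN => z zn.
case: (boolP (part U M a s t z)) => pz.
  by rewrite andbF /= mul0n; apply: sumN0 => w _; rewrite off // ltn0 !andbF.
case: (boolP (Mh z)) => [mz|nmz]; last first.
  by rewrite mul0n; apply: sumN0 => w _; case h: (zr w z); rewrite ?andbF //; rewrite (zr_Mh h) in nmz.
rewrite /=; transitivity (sumN n (fun w => pathP anc a s t z * (zr w z && (rk z w < x z)))).
  by apply: eq_sumN => w _; case h: (zr w z); rewrite ?andbF ?muln0 //= (npart h pz) mulnb.
rewrite sumN_muln; case: (boolP (pathP anc a s t z)) => [iz|_]; last by rewrite !mul0n.
rewrite seg_rank //; apply: leq_trans (xle z (inC _ iz) mz) _; apply: leq_sumN => w _.
by case: (zr w z); case: (F w).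
Qed.

End Mid.
End SegForest.
End Kinds.

End Tree.

(** * Polynomially bounded functions *)

(** One constant serves as factor and as exponent, the form in which the final time bound is stated;
    [0 < X] makes powers monotone in the exponent. *)
Definition polyb (g : nat -> nat) := exists a, forall X, 0 < X -> g X <= a * X ^ a.

Lemma polyb_le g h : (forall X, 0 < X -> g X <= h X) -> polyb h -> polyb g.
Proof. by move=> gh [a Ha]; exists a => X X0; apply: leq_trans (gh _ X0) (Ha _ X0). Qed.

Lemma polyb_const c : polyb (fun=> c).
Proof. by exists c => X X0; rewrite leq_pmulr // expn_gt0 X0. Qed.

Lemma polyb_id : polyb id.
Proof. by exists 1 => X X0; rewrite mul1n expn1. Qed.

Lemma polyb_add g h : polyb g -> polyb h -> polyb (fun X => g X + h X).
Proof.
move=> [a Ha] [b Hb]; exists (a + b) => X X0.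
rewrite mulnDl leq_add //.
  by apply: leq_trans (Ha _ X0) _; rewrite leq_mul2l leq_pexp2l ?orbT ?leq_addr.
by apply: leq_trans (Hb _ X0) _; rewrite leq_mul2l leq_pexp2l ?orbT ?leq_addl.
Qed.

Lemma polyb_mul g h : polyb g -> polyb h -> polyb (fun X => g X * h X).
Proof.
move=> [a Ha] [b Hb]; exists (a * b + (a + b)) => X X0.
apply: leq_trans (leq_mul (Ha _ X0) (Hb _ X0)) _.
rewrite mulnACA -expnD leq_mul ?leq_addr // leq_pexp2l //; lia.
Qed.

Lemma polyb_comp g h : (forall X, 0 < X -> 0 < h X) -> polyb g -> polyb h ->
  polyb (fun X => g (h X)).
Proof.
move=> h0 [a Ha] [b Hb]; exists (a * b ^ a + b * a) => X X0.
apply: leq_trans (Ha _ (h0 _ X0)) _.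
have le1 : h X ^ a <= b ^ a * X ^ (b * a).
  by rewrite expnM -expnMn; case: (posnP a) => [->//|a0]; rewrite leq_exp2r // Hb.
apply: (@leq_trans (a * b ^ a * X ^ (b * a))).
  by rewrite -mulnA leq_mul2l le1 orbT.
by rewrite leq_mul ?leq_addr // leq_pexp2l // leq_addl.
Qed.

Ltac polyb_tac :=
  repeat first [ assumption | exact: polyb_const | exact: polyb_id
               | apply: polyb_add | apply: polyb_mul ].

Lemma bitlen_le v y : v <= 2 ^ y -> bitlen v <= y.+1.
Proof.
move=> le; rewrite /bitlen ltnS.
case: v le => [|v] le; first by rewrite trunc_log0.
by rewrite -(@trunc_expnK 2 y) // leq_trunc_log.
Qed.

Lemma bitlen_leS v : bitlen v <= v.+1.
Proof. by apply: bitlen_le; exact: ltnW (ltn_expl _ _). Qed.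

(** * Bounded loops and definable functions *)

Definition sumR (R : realType) n (F : nat -> R) : R := (\sum_(i < n) F i)%R.

Inductive bnd := Bn | Bk | Bc of nat | Badd of bnd & bnd | Bmul of bnd & bnd.

Fixpoint bv b (st : memory nat) : nat :=
  match b with
  | Bn => st 0 0
  | Bk => st 0 1
  | Bc c => c
  | Badd b1 b2 => bv b1 st + bv b2 st
  | Bmul b1 b2 => bv b1 st * bv b2 st
  end.
Arguments bv : simpl never.

Fixpoint ba b : aexp :=
  match b with
  | Bn => AGet 0 (ANat 0)
  | Bk => AGet 0 (ANat 1)
  | Bc c => ANat c
  | Badd b1 b2 => AAdd (ba b1) (ba b2)
  | Bmul b1 b2 => AMul (ba b1) (ba b2)
  end.

Fixpoint bT b (X : nat) : nat :=
  match b with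
  | Bn => X + 5
  | Bk => X + 5
  | Bc c => c.+1
  | Badd b1 b2 => (bT b1 X + bT b2 X) + 1 + (bT b1 X + bT b2 X)
  | Bmul b1 b2 => (bT b1 X * bT b2 X) + 1 + (bT b1 X + bT b2 X)
  end.

Lemma polyb_bT b : polyb (bT b).
Proof. by elim: b => [||c|b1 IH1 b2 IH2|b1 IH1 b2 IH2] /=; polyb_tac. Qed.

Inductive bop := OAdd | OSub | OMul | ODiv | OMod.

Definition opv o x y :=
  match o with
  | OAdd => x + y | OSub => x - y | OMul => x * y | ODiv => x %/ y | OMod => x %% y
  end.

Definition opa o :=
  match o with
  | OAdd => AAdd | OSub => ASub | OMul => AMul | ODiv => ADiv | OMod => AMod
  end.

(** All five operations are bounded by [x.+1 * y.+1], so bit lengths add up with an excess of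
    two. *)
Lemma opv_le o x y a b : x <= 2 ^ a -> y <= 2 ^ b -> opv o x y <= 2 ^ (a + b).+2.
Proof.
move=> xa yb; apply: (@leq_trans (x.+1 * y.+1)).
  case: o => /=; [lia|lia|lia| |].
    by apply: leq_trans (leq_div _ _) _; nia.
  by apply: leq_trans (leq_mod _ _) _; nia.
have -> : (a + b).+2 = a.+1 + b.+1 by lia.
rewrite expnD leq_mul // expnS; have := expn_gt0 2 a; have := expn_gt0 2 b; lia.
Qed.

(** The newest loop variable is the outer component and has the largest number, so that existing
    variables keep their numbers when a loop is entered. *)
Fixpoint ctxT (m : nat) : Type := if m is m'.+1 then (ctxT m' * nat)%type else unit.

Fixpoint cget m : ctxT m -> nat -> nat :=
  if m is m'.+1 then fun e i => if i == m' then e.2 else cget e.1 i else fun _ _ => 0.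

Section Language.
Variable R : realType.
Local Notation state := (state R).

(* What a run reads but never changes: the read-only arrays and the oracle. *)
Record env := Env { em : memory nat; ef : nat -> R }.
Coercion em : env >-> memory.

Record dyn := Dyn { dB : nat -> nat -> bool; dR : nat -> nat -> R }.

(* The scratch arrays invisible to definable functions: natural arrays 6 (evaluation
   stack), 7 (loop variables) and 9, real arrays 0 (evaluation stack) and 1. *)
Definition scr (A : nat) := [|| A == 6, A == 7 | A == 9].

(* Array 5 and the arrays from [lim] on are Boolean and writable; the others are
   read-only. *)
Definition dy (lim A : nat) := (A == 5) || (lim <= A).

Definition setn (s : state) A i v : state :=
  State (upd (nmem s) A i v) (rmem s) (coins s).

Definition setr (s : state) A i v : state :=
  State (nmem s) (upd (rmem s) A i v) (coins s).

Definition wf X (st : memory nat) :=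
  [/\ 0 < X, st 0 0 <= X, st 0 1 <= X & forall A j, st A j <= 2 ^ X].

Definition rep lim (st : memory nat) (d : dyn) (s : state) :=
  (forall (A j : nat), ~~ scr A -> nmem s A j = if dy lim A then nat_of_bool (dB d A j) else st A j) /\
  (forall A j, 1 < A -> rmem s A j = dR d A j).

Definition repc X m (loc : nat -> nat) (e : ctxT m) (s : state) :=
  forall i, i < m -> nmem s 7 (loc i) = cget e i /\ cget e i <= 2 ^ X.

(** Evaluating an expression disturbs only the stack from [k] on and the loop cells from [m] on, so
    operands can be evaluated one after the other at increasing stack positions. *)
Definition pres m k (s s' : state) :=
  [/\ coins s' = coins s,
      (forall (A i : nat), ~~ ((A == 6) && (k <= i) || (A == 7) && (m <= i)) ->
         nmem s' A i = nmem s A i) &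
      (forall (A i : nat), ~~ ((A == 0) && (k <= i)) -> rmem s' A i = rmem s A i)].

Lemma pres_refl m k s : pres m k s s. Proof. by []. Qed.

Lemma pres_trans m k m1 k1 m2 k2 s1 s2 s3 : m <= m1 -> k <= k1 -> m <= m2 -> k <= k2 ->
  pres m1 k1 s1 s2 -> pres m2 k2 s2 s3 -> pres m k s1 s3.
Proof.
move=> m1m k1k m2m k2k [c1 n1 r1] [c2 n2 r2]; split; first by rewrite c2.
  by move=> A i H; rewrite n2 ?n1 //; apply: contra H => /orP[]/andP[-> H]; apply/orP;
     [left|right|left|right]; lia.
by move=> A i H; rewrite r2 ?r1 //; apply: contra H => /andP[-> H]; lia.
Qed.

Lemma pres_setn6 m k s i v : k <= i -> pres m k s (setn s 6 i v).
Proof.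
by move=> ki; split=> // A j; rewrite /= /upd; case: (A =P 6) => //= ->; case: (j =P i) => [->|//]; rewrite ki.
Qed.

Lemma pres_setn7 m k s i v : m <= i -> pres m k s (setn s 7 i v).
Proof.
by move=> ki; split=> // A j; rewrite /= /upd; case: (A =P 7) => //= ->; case: (j =P i) => [->|//]; rewrite ki.
Qed.

Lemma pres_setr m k s i v : k <= i -> pres m k s (setr s 0 i v).
Proof.
by move=> ki; split=> // A j; rewrite /= /upd; case: eqP => //= _; case: eqP => [->|//]; rewrite ki.
Qed.

Lemma pres_thenn m k k1 s s1 i v : k <= k1 -> k <= i -> pres m k1 s s1 -> pres m k s (setn s1 6 i v).
Proof.
move=> kk ki P; apply: (@pres_trans m k m k1 m k _ s1) => //; exact: pres_setn6.
Qed.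

Lemma pres_thenr m k k1 s s1 i v : k <= k1 -> k <= i -> pres m k1 s s1 -> pres m k s (setr s1 0 i v).
Proof.
move=> kk ki P; apply: (@pres_trans m k m k1 m k _ s1) => //; exact: pres_setr.
Qed.

Lemma rep_pres lim st d m k s s' : pres m k s s' -> rep lim st d s -> rep lim st d s'.
Proof.
move=> [_ Hn Hr] [rn rr]; split=> A j H.
  rewrite Hn ?rn //; apply: contra H; rewrite /scr; by case/orP=> /andP[-> _]; rewrite ?orbT.
by rewrite Hr ?rr //; case: A H.
Qed.

Lemma repc_pres X m loc (e : ctxT m) m' k s s' : (forall i, i < m -> loc i < m') ->
  pres m' k s s' -> repc X loc e s -> repc X loc e s'.
Proof.
move=> Hl [_ Hn _] H i im; have [H1 H2] := H i im; split => //.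
by rewrite Hn // negb_or /= leqNgt negbK Hl.
Qed.

Lemma wf_mono X Y st : X <= Y -> wf X st -> wf Y st.
Proof.
move=> XY [X0 n1 k1 H]; split; [lia|lia|lia|] => A j.
by apply: leq_trans (H A j) _; rewrite leq_exp2l.
Qed.

(* [loc] assigns to each context variable its cell in array 7; the compiled
   command may use the cells from [m'] on, and the stack from [k] on. *)
Definition dfN lim m (phi : ctxT m -> env -> dyn -> nat) :=
  forall loc m' k, (forall i, i < m -> loc i < m') ->
  exists c T, polyb T /\ forall X (st : env) d e s,
    wf X st -> rep lim st d s -> repc X loc e s ->
    exists t s', [/\ exec (ef st) c s t s', t <= T X, pres m' k s s',
      nmem s' 6 k = phi e st d & phi e st d <= 2 ^ T X].

Definition dfR lim m (phi : ctxT m -> env -> dyn -> R) :=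
  forall loc m' k, (forall i, i < m -> loc i < m') ->
  exists c T, polyb T /\ forall X (st : env) d e s,
    wf X st -> rep lim st d s -> repc X loc e s ->
    exists t s', [/\ exec (ef st) c s t s', t <= T X, pres m' k s s' &
      rmem s' 0 k = phi e st d].

(** State transformers may use the whole stack; enclosing loops rely only on the cells of their own
    variables. *)
Definition presC m (s s' : state) := coins s' = coins s /\
  forall i, i < m -> nmem s' 7 i = nmem s 7 i.

Definition dfC lim m (F : ctxT m -> env -> dyn -> dyn) :=
  forall loc m', (forall i, i < m -> loc i < m') ->
  exists c T, polyb T /\ forall X (st : env) d e s,
    wf X st -> rep lim st d s -> repc X loc e s ->
    exists t s', [/\ exec (ef st) c s t s', t <= T X, presC m' s s' & rep lim st (F e st d) s'].

Definition dfB lim m (phi : ctxT m -> env -> dyn -> bool) :=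
  dfN lim (fun e st d => nat_of_bool (phi e st d)).

Lemma dfN_ext lim m (phi psi : ctxT m -> env -> dyn -> nat) :
  (forall e st d, phi e st d = psi e st d) -> dfN lim phi -> dfN lim psi.
Proof.
move=> E H loc m' k Hl; have [c [T [pT HT]]] := H loc m' k Hl.
exists c, T; split=> // X st d e s w r rc; have [t [s' H']] := HT X st d e s w r rc.
by exists t, s'; rewrite -E.
Qed.

Lemma dfN_wk lim m (phi : ctxT m -> env -> dyn -> nat) :
  dfN lim phi -> @dfN lim m.+1 (fun e st d => phi e.1 st d).
Proof.
move=> H loc m' k Hl; have [|c [T [pT HT]]] := H loc m' k.
  by move=> i im; apply: Hl; lia.
exists c, T; split=> // X st d e s w r rc; apply: HT => // i im.
by have := rc i (ltnW im); rewrite /= ltn_eqF.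
Qed.

Lemma dfR_wk lim m (phi : ctxT m -> env -> dyn -> R) :
  dfR lim phi -> @dfR lim m.+1 (fun e st d => phi e.1 st d).
Proof.
move=> H loc m' k Hl; have [|c [T [pT HT]]] := H loc m' k.
  by move=> i im; apply: Hl; lia.
exists c, T; split=> // X st d e s w r rc; apply: HT => // i im.
by have := rc i (ltnW im); rewrite /= ltn_eqF.
Qed.

Lemma dfN_const lim m v : @dfN lim m (fun _ _ _ => v).
Proof.
move=> loc m' k Hl; exists (CSetN 6 (ANat k) (ANat v)), (fun X => k + v + 5).
split; first by polyb_tac.
move=> X st d e s w r rc; eexists _, _; split; first exact: ExecSetN.
- by rewrite /=; have := bitlen_leS k; have := bitlen_leS v; lia.
- exact: pres_setn6.
- by rewrite /= /upd !eqxx.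
by apply: leq_trans (ltnW (ltn_expl v (ltnSn 1))) _; rewrite leq_exp2l //; lia.
Qed.

Lemma dfN_var lim m : @dfN lim m.+1 (fun e _ _ => e.2).
Proof.
move=> loc m' k Hl.
exists (CSetN 6 (ANat k) (AGet 7 (ANat (loc m)))), (fun X => k + loc m + X + 5).
split; first by polyb_tac.
move=> X st d e s w r rc; have := rc m (leqnn _); rewrite /= eqxx => -[E B].
eexists _, _; split; first exact: ExecSetN.
- rewrite /= E; have := bitlen_leS k; have := bitlen_leS (loc m); have := bitlen_le B; lia.
- exact: pres_setn6.
- by rewrite /= /upd !eqxx.
by apply: leq_trans B _; rewrite leq_exp2l //; lia.
Qed.

Lemma opaE o (s : state) a b : aval s (opa o a b) = opv o (aval s a) (aval s b) /\
  acost s (opa o a b) = bitlen (opv o (aval s a) (aval s b)) + (acost s a + acost s b).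
Proof. by case: o. Qed.

Lemma dfN_op o lim m (phi psi : ctxT m -> env -> dyn -> nat) :
  dfN lim phi -> dfN lim psi -> dfN lim (fun e st d => opv o (phi e st d) (psi e st d)).
Proof.
move=> H1 H2 loc m' k Hl.
have [c1 [T1 [p1 HT1]]] := H1 loc m' k Hl.
have [c2 [T2 [p2 HT2]]] := H2 loc m' k.+1 Hl.
exists (CSeq c1 (CSeq c2 (CSetN 6 (ANat k) (opa o (AGet 6 (ANat k)) (AGet 6 (ANat k.+1)))))).
exists (fun X => 3 * (T1 X + T2 X) + 4 * k + 20); split; first by polyb_tac.
move=> X st d e s w r rc.
have [t1 [s1 [E1 L1 P1 V1 B1]]] := HT1 X st d e s w r rc.
have [t2 [s2 [E2 L2 P2 V2 B2]]] := HT2 X st d e s1 w (rep_pres P1 r) (repc_pres Hl P1 rc).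
have V1' : nmem s2 6 k = phi e st d.
  by case: P2 => _ -> //=; rewrite ltnn.
have Bo := opv_le o B1 B2.
eexists _, _; split.
- apply: ExecSeq E1 _; apply: ExecSeq E2 _; exact: ExecSetN.
- rewrite (opaE _ _ _ _).2 /= V1' V2.
  have := bitlen_leS k; have := bitlen_leS k.+1; have := bitlen_le B1; have := bitlen_le B2.
  have := bitlen_le Bo; lia.
- apply: (@pres_trans m' k m' k m' k _ s1) => //; exact: pres_thenn P2.
- by rewrite /= /upd !eqxx (opaE _ _ _ _).1 /= V1' V2.
by apply: leq_trans Bo _; rewrite leq_exp2l //; lia.
Qed.

Lemma dfN_stat (A : nat) lim m (phi : ctxT m -> env -> dyn -> nat) :
  ~~ scr A -> ~~ dy lim A -> dfN lim phi -> dfN lim (fun e st d => em st A (phi e st d)).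
Proof.
move=> nsA ndA H1 loc m' k Hl; have [c1 [T1 [p1 HT1]]] := H1 loc m' k Hl.
exists (CSeq c1 (CSetN 6 (ANat k) (AGet A (AGet 6 (ANat k))))).
exists (fun X => 3 * T1 X + X + 4 * k + 20); split; first by polyb_tac.
move=> X st d e s w r rc.
have [t1 [s1 [E1 L1 P1 V1 B1]]] := HT1 X st d e s w r rc.
have V : nmem s1 A (phi e st d) = em st A (phi e st d).
  by rewrite (rep_pres P1 r).1 // (negPf ndA).
have BA : em st A (phi e st d) <= 2 ^ X by case: w => _ _ _; apply.
eexists _, _; split.
- apply: ExecSeq E1 _; exact: ExecSetN.
- rewrite /= V1 V; have := bitlen_leS k; have := bitlen_le B1; have := bitlen_le BA; lia.
- exact: pres_thenn P1.
- by rewrite /= /upd !eqxx V1 V.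
by apply: leq_trans BA _; rewrite leq_exp2l //; lia.
Qed.

Lemma dfB_dyn (A : nat) lim m (phi : ctxT m -> env -> dyn -> nat) :
  ~~ scr A -> dy lim A -> dfN lim phi -> dfB lim (fun e st d => dB d A (phi e st d)).
Proof.
move=> nsA ndA H1 loc m' k Hl; have [c1 [T1 [p1 HT1]]] := H1 loc m' k Hl.
exists (CSeq c1 (CSetN 6 (ANat k) (AGet A (AGet 6 (ANat k))))).
exists (fun X => 3 * T1 X + X + 4 * k + 20); split; first by polyb_tac.
move=> X st d e s w r rc.
have [t1 [s1 [E1 L1 P1 V1 B1]]] := HT1 X st d e s w r rc.
have V : nmem s1 A (phi e st d) = dB d A (phi e st d).
  by rewrite (rep_pres P1 r).1 // ndA.
have BA : (dB d A (phi e st d)) <= 2 ^ 0 by case: dB.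
eexists _, _; split.
- apply: ExecSeq E1 _; exact: ExecSetN.
- rewrite /= V1 V; have := bitlen_leS k; have := bitlen_le B1; have := bitlen_le BA; lia.
- exact: pres_thenn P1.
- by rewrite /= /upd !eqxx V1 V.
by apply: leq_trans BA _; rewrite leq_exp2l //; lia.
Qed.

Lemma rep_ba lim X st d s b : 0 < lim -> wf X st -> rep lim st d s ->
  [/\ aval s (ba b) = bv b st, acost s (ba b) <= bT b X & bv b st <= bT b X].
Proof.
move=> lim0 [X0 n1 k1 _] [rn _].
have dy0 : dy lim 0 = false by rewrite /dy /= leqn0 eqn0Ngt lim0.
elim: b => [||c|b1 [A1 C1 V1] b2 [A2 C2 V2]|b1 [A1 C1 V1] b2 [A2 C2 V2]] /=.
- rewrite !rn // dy0; split=> //; last by rewrite /bv; lia.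
  have := bitlen_leS (st 0 0); have := bitlen_leS 0; lia.
- rewrite !rn // dy0; split=> //; last by rewrite /bv; lia.
  have := bitlen_leS (st 0 1); have := bitlen_leS 1; lia.
- by split=> //; rewrite ?addn0 ?bitlen_leS.
- rewrite A1 A2; split=> //; rewrite -/bv; last by rewrite {1}/bv -/bv; lia.
  have := bitlen_leS (bv b1 st + bv b2 st); lia.
- rewrite A1 A2; split=> //; rewrite -/bv; last by rewrite {1}/bv -/bv; nia.
  have := bitlen_leS (bv b1 st * bv b2 st); nia.
Qed.

Definition cfor b m c :=
  CSeq (CSetN 7 (ANat m) (ANat 0))
    (CWhile (BNot (BLeN (ba b) (AGet 7 (ANat m))))
       (CSeq c (CSetN 7 (ANat m) (AAdd (AGet 7 (ANat m)) (ANat 1))))).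

(** The cost rule behind all loops: [Tc] bounds one run of the body, [Tb] one evaluation of the loop
    bound, and the other terms pay for the counter, which the body has to leave unchanged. *)
Lemma exec_for f m b N c s (Inv : nat -> state -> Prop) Tc Tb :
  (forall x s, x <= N -> Inv x s ->
     [/\ nmem s 7 m = x, aval s (ba b) = N & acost s (ba b) <= Tb]) ->
  (forall x s, x < N -> Inv x s -> exists t s1,
     [/\ exec f c s t s1, t <= Tc, nmem s1 7 m = x & Inv x.+1 (setn s1 7 m x.+1)]) ->
  Inv 0 (setn s 7 m 0) ->
  exists t s', [/\ exec f (cfor b m c) s t s', Inv N s' &
    t <= N.+1 * (Tc + Tb + 4 * N + 8 * m + 50)].
Proof.
move=> Hg Hs; set D := Tc + Tb + 4 * N + 6 * m + 40.
suff W x s1 : x <= N -> Inv x s1 -> exists t s',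
    [/\ exec f (CWhile (BNot (BLeN (ba b) (AGet 7 (ANat m))))
       (CSeq c (CSetN 7 (ANat m) (AAdd (AGet 7 (ANat m)) (ANat 1))))) s1 t s', Inv N s' &
       t <= (N - x).+1 * D].
  move=> /W -[//|t [s' [E I L]]]; eexists _, s'; split; [|exact: I|].
    apply: ExecSeq E; exact: ExecSetN.
  rewrite /= subn0 in L *; have := bitlen_leS m; have := bitlen_leS 0; rewrite /D in L *; nia.
move=> xN; move Ek : (N - x) => k; elim: k x s1 xN Ek => [|k IH] x s1 xN Ek Ix.
  have [E1 E2 L] := Hg x s1 xN Ix; eexists _, s1; split.
  - by apply: ExecWhileF; rewrite /= E1 E2 negbK; lia.
  - by have -> : N = x by lia.
  rewrite /= E1; have := bitlen_leS m; have := bitlen_leS x; rewrite /D; lia.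
have xN' : x < N by lia.
have [E1 E2 L] := Hg x s1 xN Ix; have [t [s2 [Ec Lc V2 I2]]] := Hs x s1 xN' Ix.
have [|t2 [s3 [E3 I3 L3]]] := IH x.+1 _ xN' _ I2; first by lia.
have S2 : exec f (CSetN 7 (ANat m) (AAdd (AGet 7 (ANat m)) (ANat 1))) s2
    (1 + acost s2 (ANat m) + acost s2 (AAdd (AGet 7 (ANat m)) (ANat 1))) (setn s2 7 m x.+1).
  have -> : x.+1 = aval s2 (AAdd (AGet 7 (ANat m)) (ANat 1)) by rewrite /= V2 addn1.
  exact: ExecSetN.
eexists _, s3; split; [|exact: I3|].
- apply: ExecWhileT (ExecSeq Ec S2) E3; by rewrite /= E1 E2 -ltnNge.
rewrite /= E1 V2 addn1; have := bitlen_leS m; have := bitlen_leS x; have := bitlen_leS x.+1.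
have := bitlen_leS 1; move: L3; set Y := k.+1 * D => L3; rewrite mulSn -/Y /D; lia.
Qed.

(* The value of a loop variable has fewer bits than [bT b X + X]. *)
Lemma repc_for lim X st d m loc (e : ctxT m) m' s b x k s' :
  0 < lim -> wf X st -> rep lim st d s -> repc X loc e s ->
  (forall i, i < m -> loc i < m') -> x < bv b st ->
  pres m' k s s' -> nmem s' 7 m' = x ->
  @repc (bT b X + X) m.+1 (fun i => if i == m then m' else loc i) (e, x) s'.
Proof.
move=> lim0 w r rc Hl xb P V i im /=; case: eqP => [_|ne].
  split => //; apply: leq_trans (ltnW xb) _; have [_ _ vb] := rep_ba b lim0 w r.
  apply: leq_trans vb _; apply: leq_trans (ltnW (ltn_expl _ (ltnSn 1))) _.
  by rewrite leq_exp2l ?leq_addr.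
have im' : i < m by lia.
have := repc_pres Hl P rc im'; case=> -> B; split=> //; apply: leq_trans B _.
by rewrite leq_exp2l ?leq_addl.
Qed.

(** Each round lengthens the accumulator by at most [T' X + 2] bits, so it stays polynomially long
    over polynomially many rounds, even for products. *)
Lemma dfN_fold o i0 b lim m (phi : ctxT m -> nat -> env -> dyn -> nat) : 0 < lim ->
  @dfN lim m.+1 (fun e st d => phi e.1 e.2 st d) ->
  @dfN lim m (fun e st d =>
    foldl (fun acc x => opv o acc (phi e x st d)) i0 (iota 0 (bv b st))).
Proof.
move=> lim0 H loc m' k Hl; pose loc' i := if i == m then m' else loc i.
have Hl' i : i < m.+1 -> loc' i < m'.+1.
  rewrite /loc'; case: eqP => // ne im; apply: leqW; apply: Hl; lia.
have [c [T [pT HT]]] := H loc' m'.+1 k.+1 Hl'.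
pose T' X := T (bT b X + X); have pT' : polyb T'.
  apply: (@polyb_comp T (fun X => bT b X + X)) => //; last by have pb := polyb_bT b; polyb_tac.
  by move=> X X0; rewrite addn_gt0 X0 orbT.
pose V X := bT b X * (T' X + 2) + i0.
exists (CSeq (CSetN 6 (ANat k) (ANat i0)) (cfor b m'
  (CSeq c (CSetN 6 (ANat k) (opa o (AGet 6 (ANat k)) (AGet 6 (ANat k.+1))))))).
pose Tc X := 3 * T' X + 3 * V X + 4 * k + 30.
exists (fun X => (bT b X).+1 * (Tc X + bT b X + 4 * bT b X + 8 * m' + 50) + 4 * k + i0 + 20 + V X).
split.
  have pb := polyb_bT b.
  have pV : polyb V by rewrite /V; polyb_tac.
  have pS : polyb (fun X => (bT b X).+1).
    by apply: (@polyb_le _ (fun X => bT b X + 1)) => [X _|]; [lia|polyb_tac].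
  by rewrite /Tc; polyb_tac.
move=> X st d e s w r rc.
pose acc x := foldl (fun acc x => opv o acc (phi e x st d)) i0 (iota 0 x).
have accS x : acc x.+1 = opv o (acc x) (phi e x st d).
  by rewrite /acc -addn1 iotaD foldl_cat.
set N := bv b st; have [_ _ NB] := rep_ba b lim0 w r; rewrite -/N in NB.
pose Inv x s1 := [/\ pres m' k s s1, nmem s1 7 m' = x, nmem s1 6 k = acc x &
   acc x <= 2 ^ (x * (T' X + 2) + i0)].
have [x s1 xN [P1 V1 A1 _]|||t1 [s1 [E1 [P1 V1 A1 B1] L1]]] :=
  @exec_for (ef st) m' b N (CSeq c (CSetN 6 (ANat k) (opa o (AGet 6 (ANat k)) (AGet 6 (ANat k.+1)))))
   (setn s 6 k i0) Inv (Tc X) (bT b X).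
- by have [-> L _] := rep_ba b lim0 w (rep_pres P1 r).
- move=> x s1 xN [P1 V1 A1 B1].
  have w' : wf (bT b X + X) st by apply: wf_mono w; lia.
  have rc' := repc_for lim0 w r rc Hl xN P1 V1.
  have [t [s2 [E2 L2 P2 V2 B2]]] := HT _ st d (e, x) s1 w' (rep_pres P1 r) rc'.
  rewrite -/(T' X) /= in L2 V2 B2.
  have V1' : nmem s2 6 k = acc x by case: P2 => _ -> //=; rewrite ltnn.
  have V1'' : nmem s2 7 m' = x by case: P2 => _ -> //=; rewrite ltnn.
  have BB := opv_le o B1 B2; rewrite -accS in BB.
  have BB' : acc x.+1 <= 2 ^ (x.+1 * (T' X + 2) + i0).
    apply: leq_trans BB _; rewrite leq_exp2l //; lia.
  have xT : x.+1 * (T' X + 2) + i0 <= V X.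
    by rewrite /V leq_add2r leq_mul //; lia.
  have xT' : x * (T' X + 2) + i0 <= V X by move: xT; lia.
  eexists _, _; split; [apply: ExecSeq E2 _; exact: ExecSetN| | |].
  + rewrite (opaE _ _ _ _).2 /= V1' V2 -accS.
    have := bitlen_leS k; have := bitlen_leS k.+1; have := bitlen_le B1; have := bitlen_le B2.
    have := bitlen_le BB'; rewrite /Tc; lia.
  + by rewrite /= /upd /=.
  split => //.
  + apply: (pres_trans (leqnn _) (leqnn _) (leqnn _) (leqnn _) P1).
    apply: (@pres_trans m' k m'.+1 k.+1 m' k _ s2) => //.
    apply: (@pres_trans m' k m' k m' k _ (setn s2 6 k (acc x.+1))) => //.
      exact: pres_setn6.
    set s3 := State _ _ _.
    have -> : s3 = setn s2 6 k (acc x.+1) by rewrite /s3 (opaE _ _ _ _).1 /= V1' V2 -accS.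
    exact: pres_setn7.
  + by rewrite /= /upd !eqxx.
  by rewrite /= /upd /= !eqxx (opaE _ _ _ _).1 /= V1' V2 -accS.
- split => //.
  + apply: (@pres_trans m' k m' k m' k _ (setn s 6 k i0)) => //.
      exact: pres_setn6.
    exact: pres_setn7.
  + by rewrite /= /upd !eqxx.
  + by rewrite /= /upd /= !eqxx.
  by rewrite /acc /= ltnW // ltn_expl.
have VV : N * (T' X + 2) + i0 <= V X by rewrite /V leq_add2r leq_mul.
eexists _, s1; split; [| |exact: P1|exact: A1|].
- apply: ExecSeq E1; exact: ExecSetN.
- rewrite /=; have := bitlen_leS k; have := bitlen_leS i0 => b1 b2.
  have : t1 <= (bT b X).+1 * (Tc X + bT b X + 4 * bT b X + 8 * m' + 50).
    by apply: leq_trans L1 _; rewrite leq_mul //; lia.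
  lia.
apply: leq_trans B1 _; rewrite leq_exp2l //; lia.
Qed.

Lemma dfN_sum b lim m (phi : ctxT m -> nat -> env -> dyn -> nat) : 0 < lim ->
  @dfN lim m.+1 (fun e st d => phi e.1 e.2 st d) ->
  @dfN lim m (fun e st d => sumN (bv b st) (fun x => phi e x st d)).
Proof.
move=> l0 H; apply: dfN_ext (dfN_fold OAdd 0 b l0 H) => e st d.
rewrite /sumN -(big_mkord xpredT (fun x => phi e x st d)) /index_iota subn0.
by elim/last_ind: (iota _ _) => [|s x IH]; rewrite ?big_nil // foldl_rcons IH big_rcons /= addnC.
Qed.

Lemma dfN_prod b lim m (phi : ctxT m -> nat -> env -> dyn -> nat) : 0 < lim ->
  @dfN lim m.+1 (fun e st d => phi e.1 e.2 st d) ->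
  @dfN lim m (fun e st d => prodN (bv b st) (fun x => phi e x st d)).
Proof.
move=> l0 H; apply: dfN_ext (dfN_fold OMul 1 b l0 H) => e st d.
rewrite /prodN -(big_mkord xpredT (fun x => phi e x st d)) /index_iota subn0.
by elim/last_ind: (iota _ _) => [|s x IH]; rewrite ?big_nil // foldl_rcons IH big_rcons /= mulnC.
Qed.

(** Both branches are evaluated and combined with factors 0 and 1; evaluation changes only scratch
    cells, so this is harmless. *)
Lemma dfN_if lim m (p : ctxT m -> env -> dyn -> bool) phi psi :
  dfB lim p -> dfN lim phi -> dfN lim psi ->
  dfN lim (fun e st d => if p e st d then phi e st d else psi e st d).
Proof.
move=> Hp H1 H2.
have := dfN_op OAdd (dfN_op OMul Hp H1) (dfN_op OMul (dfN_op OSub (@dfN_const lim m 1) Hp) H2).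
by apply: dfN_ext => e st d /=; case: (p e st d); rewrite /= ?mul1n ?mul0n ?addn0.
Qed.

Lemma dfB_and lim m (p q : ctxT m -> env -> dyn -> bool) :
  dfB lim p -> dfB lim q -> dfB lim (fun e st d => p e st d && q e st d).
Proof. by move=> Hp Hq; apply: dfN_ext (dfN_op OMul Hp Hq) => e st d /=; case: (p e st d); case: (q e st d). Qed.

Lemma dfB_neg lim m (p : ctxT m -> env -> dyn -> bool) :
  dfB lim p -> dfB lim (fun e st d => ~~ p e st d).
Proof. by move=> Hp; apply: dfN_ext (dfN_op OSub (@dfN_const lim m 1) Hp) => e st d /=; case: (p e st d). Qed.

Lemma dfB_ext lim m (p q : ctxT m -> env -> dyn -> bool) :
  (forall e st d, p e st d = q e st d) -> dfB lim p -> dfB lim q.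
Proof. by move=> E; apply: dfN_ext => e st d; rewrite E. Qed.

Lemma dfB_or lim m (p q : ctxT m -> env -> dyn -> bool) :
  dfB lim p -> dfB lim q -> dfB lim (fun e st d => p e st d || q e st d).
Proof.
move=> Hp Hq; apply: dfB_ext (dfB_neg (dfB_and (dfB_neg Hp) (dfB_neg Hq))) => e st d.
by rewrite negb_and !negbK.
Qed.

Lemma dfB_imp lim m (p q : ctxT m -> env -> dyn -> bool) :
  dfB lim p -> dfB lim q -> dfB lim (fun e st d => p e st d ==> q e st d).
Proof.
by move=> Hp Hq; apply: dfB_ext (dfB_or (dfB_neg Hp) Hq) => e st d; rewrite implybE.
Qed.

Lemma dfB_if lim m (p q r : ctxT m -> env -> dyn -> bool) :
  dfB lim p -> dfB lim q -> dfB lim r ->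
  dfB lim (fun e st d => if p e st d then q e st d else r e st d).
Proof. by move=> Hp Hq Hr; apply: dfN_ext (dfN_if Hp Hq Hr) => e st d; case: ifP. Qed.

Lemma dfB_le lim m (phi psi : ctxT m -> env -> dyn -> nat) :
  dfN lim phi -> dfN lim psi -> dfB lim (fun e st d => phi e st d <= psi e st d).
Proof.
move=> H1 H2; apply: dfN_ext (dfN_op OSub (@dfN_const lim m 1) (dfN_op OSub H1 H2)) => e st d /=.
by case: leqP => /= ?; lia.
Qed.

Lemma dfB_eq lim m (phi psi : ctxT m -> env -> dyn -> nat) :
  dfN lim phi -> dfN lim psi -> dfB lim (fun e st d => phi e st d == psi e st d).
Proof.
by move=> H1 H2; apply: dfB_ext (dfB_and (dfB_le H1 H2) (dfB_le H2 H1)) => e st d; rewrite eqn_leq.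
Qed.

Lemma dfB_eqb lim m (p q : ctxT m -> env -> dyn -> bool) :
  dfB lim p -> dfB lim q -> dfB lim (fun e st d => p e st d == q e st d).
Proof. by move=> H1 H2; apply: dfB_ext (dfB_eq H1 H2) => e st d; case: (p e st d); case: (q e st d). Qed.

Lemma sumN_gt0 n (F : nat -> nat) : (0 < sumN n F) = hasN n (fun x => 0 < F x).
Proof.
rewrite /sumN lt0n sum_nat_eq0; apply/idP/hasNP => [|[x xn Fx]].
  by rewrite negb_forall => /existsP[x]; rewrite -lt0n; exists x.
by rewrite negb_forall; apply/existsP; exists (Ordinal xn); rewrite -lt0n.
Qed.

Lemma dfB_has b lim m (phi : ctxT m -> nat -> env -> dyn -> bool) : 0 < lim ->
  @dfB lim m.+1 (fun e st d => phi e.1 e.2 st d) ->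
  @dfB lim m (fun e st d => hasN (bv b st) (fun x => phi e x st d)).
Proof.
move=> l0 H; have := dfB_le (@dfN_const lim m 1) (@dfN_sum b lim m (fun e x st d => nat_of_bool (phi e x st d)) l0 H).
apply: dfB_ext => e st d; rewrite sumN_gt0; by apply: eq_has => x; case: (phi e x st d).
Qed.

Lemma dfB_all b lim m (phi : ctxT m -> nat -> env -> dyn -> bool) : 0 < lim ->
  @dfB lim m.+1 (fun e st d => phi e.1 e.2 st d) ->
  @dfB lim m (fun e st d => allN (bv b st) (fun x => phi e x st d)).
Proof.
move=> l0 H; have := dfB_neg (@dfB_has b lim m (fun e x st d => ~~ phi e x st d) l0 (dfB_neg H)).
by apply: dfB_ext => e st d; rewrite /hasN has_predC negbK.
Qed.

Lemma dfR_get (A : nat) lim m (phi : ctxT m -> env -> dyn -> nat) :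
  1 < A -> dfN lim phi -> dfR lim (fun e st d => dR d A (phi e st d)).
Proof.
move=> A1 H1 loc m' k Hl; have [c1 [T1 [p1 HT1]]] := H1 loc m' k Hl.
exists (CSeq c1 (CSetR 0 (ANat k) (RGet A (AGet 6 (ANat k))))).
exists (fun X => 3 * T1 X + 4 * k + 20); split; first by polyb_tac.
move=> X st d e s w r rc.
have [t1 [s1 [E1 L1 P1 V1 B1]]] := HT1 X st d e s w r rc.
eexists _, _; split.
- apply: ExecSeq E1 _; exact: ExecSetR.
- rewrite /= V1; have := bitlen_leS k; have := bitlen_le B1; lia.
- exact: pres_thenr P1.
by rewrite /= /upd !eqxx V1 (rep_pres P1 r).2.
Qed.

Lemma dfR_oracle lim m (phi : ctxT m -> env -> dyn -> nat) :
  dfN lim phi -> dfR lim (fun e st d => ef st (phi e st d)).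
Proof.
move=> H1 loc m' k Hl; have [c1 [T1 [p1 HT1]]] := H1 loc m' k Hl.
exists (CSeq c1 (CSetR 0 (ANat k) (ROracle (AGet 6 (ANat k))))).
exists (fun X => 3 * T1 X + 4 * k + 20); split; first by polyb_tac.
move=> X st d e s w r rc.
have [t1 [s1 [E1 L1 P1 V1 B1]]] := HT1 X st d e s w r rc.
eexists _, _; split.
- apply: ExecSeq E1 _; exact: ExecSetR.
- rewrite /= V1; have := bitlen_leS k; have := bitlen_le B1; lia.
- exact: pres_thenr P1.
by rewrite /= /upd !eqxx V1.
Qed.

Lemma dfR_add lim m (phi psi : ctxT m -> env -> dyn -> R) :
  dfR lim phi -> dfR lim psi -> dfR lim (fun e st d => phi e st d + psi e st d)%R.
Proof.
move=> H1 H2 loc m' k Hl.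
have [c1 [T1 [p1 HT1]]] := H1 loc m' k Hl.
have [c2 [T2 [p2 HT2]]] := H2 loc m' k.+1 Hl.
exists (CSeq c1 (CSeq c2 (CSetR 0 (ANat k) (RAdd (RGet 0 (ANat k)) (RGet 0 (ANat k.+1)))))).
exists (fun X => 3 * (T1 X + T2 X) + 4 * k + 20); split; first by polyb_tac.
move=> X st d e s w r rc.
have [t1 [s1 [E1 L1 P1 V1]]] := HT1 X st d e s w r rc.
have [t2 [s2 [E2 L2 P2 V2]]] := HT2 X st d e s1 w (rep_pres P1 r) (repc_pres Hl P1 rc).
have V1' : rmem s2 0 k = phi e st d by case: P2 => _ _ -> //=; rewrite ltnn.
eexists _, _; split.
- apply: ExecSeq E1 _; apply: ExecSeq E2 _; exact: ExecSetR.
- by rewrite /=; have := bitlen_leS k; have := bitlen_leS k.+1; lia.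
- apply: (@pres_trans m' k m' k m' k _ s1) => //; exact: pres_thenr P2.
by rewrite /= /upd !eqxx /= V1' V2.
Qed.

Lemma dfR_scale lim m (phi : ctxT m -> env -> dyn -> nat)
    (psi : ctxT m -> env -> dyn -> R) :
  dfN lim phi -> dfR lim psi -> dfR lim (fun e st d => (phi e st d)%:R * psi e st d)%R.
Proof.
move=> H1 H2 loc m' k Hl.
have [c1 [T1 [p1 HT1]]] := H1 loc m' k Hl.
have [c2 [T2 [p2 HT2]]] := H2 loc m' k.+1 Hl.
exists (CSeq c1 (CSeq c2 (CSetR 0 (ANat k) (RScale (AGet 6 (ANat k)) (RGet 0 (ANat k.+1)))))).
exists (fun X => 3 * (T1 X + T2 X) + 4 * k + 20); split; first by polyb_tac.
move=> X st d e s w r rc.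
have [t1 [s1 [E1 L1 P1 V1 B1]]] := HT1 X st d e s w r rc.
have [t2 [s2 [E2 L2 P2 V2]]] := HT2 X st d e s1 w (rep_pres P1 r) (repc_pres Hl P1 rc).
have V1' : nmem s2 6 k = phi e st d by case: P2 => _ -> //=; rewrite ltnn.
eexists _, _; split.
- apply: ExecSeq E1 _; apply: ExecSeq E2 _; exact: ExecSetR.
- rewrite /= V1'; have := bitlen_leS k; have := bitlen_leS k.+1; have := bitlen_le B1; lia.
- apply: (@pres_trans m' k m' k m' k _ s1) => //; exact: pres_thenr P2.
by rewrite /= /upd !eqxx /= V1' V2.
Qed.

Lemma dfB_leR lim m (phi psi : ctxT m -> env -> dyn -> R) :
  dfR lim phi -> dfR lim psi -> dfB lim (fun e st d => phi e st d <= psi e st d)%R.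
Proof.
move=> H1 H2 loc m' k Hl.
have [c1 [T1 [p1 HT1]]] := H1 loc m' k Hl.
have [c2 [T2 [p2 HT2]]] := H2 loc m' k.+1 Hl.
exists (CSeq c1 (CSeq c2 (CIf (BLeR (RGet 0 (ANat k)) (RGet 0 (ANat k.+1)))
  (CSetN 6 (ANat k) (ANat 1)) (CSetN 6 (ANat k) (ANat 0))))).
exists (fun X => 3 * (T1 X + T2 X) + 6 * k + 40); split; first by polyb_tac.
move=> X st d e s w r rc.
have [t1 [s1 [E1 L1 P1 V1]]] := HT1 X st d e s w r rc.
have [t2 [s2 [E2 L2 P2 V2]]] := HT2 X st d e s1 w (rep_pres P1 r) (repc_pres Hl P1 rc).
have V1' : rmem s2 0 k = phi e st d by case: P2 => _ _ -> //=; rewrite ltnn.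
pose v := nat_of_bool (phi e st d <= psi e st d)%R.
exists (1 + t1 + (1 + t2 + (1 + bcost s2 (BLeR (RGet 0 (ANat k)) (RGet 0 (ANat k.+1))) +
   (1 + acost s2 (ANat k) + acost s2 (ANat v))))), (setn s2 6 k v); split.
- apply: ExecSeq E1 _; apply: ExecSeq E2 _; apply: ExecIf.
  have -> : bval (ef st) s2 (BLeR (RGet 0 (ANat k)) (RGet 0 (ANat k.+1))) = (phi e st d <= psi e st d)%R.
    by rewrite /= V1' V2.
  by rewrite /v; case: (_ <= _)%R; exact: ExecSetN.
- rewrite /=; have := bitlen_leS k; have := bitlen_leS k.+1; have := bitlen_leS v.
  have : v <= 1 by rewrite /v; case: (_ <= _)%R.
  lia.
- apply: (@pres_trans m' k m' k m' k _ s1) => //; exact: pres_thenn P2.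
- by rewrite /= /upd !eqxx.
rewrite -/v; apply: (@leq_trans 1); first by rewrite /v; case: (_ <= _)%R.
by rewrite expn_gt0.
Qed.

Lemma dfR_sum b lim m (phi : ctxT m -> nat -> env -> dyn -> R) : 0 < lim ->
  @dfR lim m.+1 (fun e st d => phi e.1 e.2 st d) ->
  @dfR lim m (fun e st d => sumR (bv b st) (fun x => phi e x st d)).
Proof.
move=> lim0 H loc m' k Hl; pose loc' i := if i == m then m' else loc i.
have Hl' i : i < m.+1 -> loc' i < m'.+1.
  rewrite /loc'; case: eqP => // ne im; apply: leqW; apply: Hl; lia.
have [c [T [pT HT]]] := H loc' m'.+1 k.+1 Hl'.
pose T' X := T (bT b X + X); have pT' : polyb T'.
  apply: (@polyb_comp T (fun X => bT b X + X)) => //; last by have pb := polyb_bT b; polyb_tac.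
  by move=> X X0; rewrite addn_gt0 X0 orbT.
pose body := CSeq c (CSetR 0 (ANat k) (RAdd (RGet 0 (ANat k)) (RGet 0 (ANat k.+1)))).
(* There are no real literals: zero is produced by subtracting a cell from itself. *)
exists (CSeq (CSetR 0 (ANat k) (RSub (RGet 0 (ANat k)) (RGet 0 (ANat k)))) (cfor b m' body)).
pose Tc X := T' X + 4 * k + 30.
exists (fun X => (bT b X + 1) * (Tc X + bT b X + 4 * bT b X + 8 * m' + 50) + 4 * k + 20).
split; first by rewrite /Tc; have pb := polyb_bT b; polyb_tac.
move=> X st d e s w r rc.
pose acc x := sumR x (fun x => phi e x st d).
have accS x : acc x.+1 = (acc x + phi e x st d)%R by rewrite /acc /sumR big_ord_recr.
set N := bv b st; have [_ _ NB] := rep_ba b lim0 w r; rewrite -/N in NB.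
pose Inv x s1 := [/\ pres m' k s s1, nmem s1 7 m' = x & rmem s1 0 k = acc x].
have [x s1 xN [P1 V1 A1]|||t1 [s1 [E1 [P1 V1 A1] L1]]] :=
  @exec_for (ef st) m' b N body (setr s 0 k 0%R) Inv (Tc X) (bT b X).
- by have [-> L _] := rep_ba b lim0 w (rep_pres P1 r).
- move=> x s1 xN [P1 V1 A1].
  have w' : wf (bT b X + X) st by apply: wf_mono w; lia.
  have rc' := repc_for lim0 w r rc Hl xN P1 V1.
  have [t [s2 [E2 L2 P2 V2]]] := HT _ st d (e, x) s1 w' (rep_pres P1 r) rc'.
  rewrite -/(T' X) /= in L2 V2.
  have V1' : rmem s2 0 k = acc x by case: P2 => _ _ -> //=; rewrite ltnn.
  have V1'' : nmem s2 7 m' = x by case: P2 => _ -> //=; rewrite ltnn.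
  eexists _, (setr s2 0 k (acc x.+1)); split.
  + rewrite /body accS -V1' -V2; apply: ExecSeq E2 _; exact: ExecSetR.
  + by rewrite /=; have := bitlen_leS k; have := bitlen_leS k.+1; rewrite /Tc; lia.
  + by [].
  split.
  + apply: (@pres_trans m' k m' k m' k _ s1) => //.
    apply: (@pres_trans m' k m'.+1 k.+1 m' k _ s2) => //.
    apply: (@pres_trans m' k m' k m' k _ (setr s2 0 k (acc x.+1))) => //.
      exact: pres_setr.
    exact: pres_setn7.
  + by rewrite /= /upd !eqxx.
  by rewrite /= /upd !eqxx.
- split => //.
  + apply: (@pres_trans m' k m' k m' k _ (setr s 0 k 0%R)) => //.
      exact: pres_setr.
    exact: pres_setn7.
  + by rewrite /= /upd !eqxx.
  by rewrite /= /upd !eqxx /acc /sumR big_ord0.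
eexists _, s1; split; [| |exact: P1|exact: A1].
- apply: ExecSeq _ E1; rewrite -(subrr (rmem s 0 k)); exact: ExecSetR.
- rewrite /=; have := bitlen_leS k => b2.
  have : t1 <= (bT b X + 1) * (Tc X + bT b X + 4 * bT b X + 8 * m' + 50).
    by apply: leq_trans L1 _; rewrite addn1 leq_mul //; lia.
  lia.
Qed.

(** * Table updates and loops as definable state transformers *)

Definition setB d A g := Dyn (fun A' j => if A' == A then g j else dB d A' j) (dR d).
Definition setRR d A g := Dyn (dB d) (fun A' j => if A' == A then g j else dR d A' j).

Definition tabB A N (phi : nat -> dyn -> bool) d :=
  setB d A (fun j => if j < N then phi j d else dB d A j).
Definition tabR A N (phi : nat -> dyn -> R) d :=
  setRR d A (fun j => if j < N then phi j d else dR d A j).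
Definition forD N (F : nat -> dyn -> dyn) d := foldl (fun d x => F x d) d (iota 0 N).

Lemma forDS N F d : forD N.+1 F d = F N (forD N F d).
Proof. by rewrite /forD -addn1 iotaD foldl_cat. Qed.

Lemma dfC_seq lim m (F G : ctxT m -> env -> dyn -> dyn) :
  dfC lim F -> dfC lim G -> dfC lim (fun e st d => G e st (F e st d)).
Proof.
move=> H1 H2 loc m' Hl.
have [c1 [T1 [p1 HT1]]] := H1 loc m' Hl; have [c2 [T2 [p2 HT2]]] := H2 loc m' Hl.
exists (CSeq c1 c2), (fun X => 1 + T1 X + T2 X); split; first by polyb_tac.
move=> X st d e s w r rc.
have [t1 [s1 [E1 L1 [P1 Q1] r1]]] := HT1 X st d e s w r rc.
have rc1 : repc X loc e s1 by move=> i im; rewrite Q1 ?Hl //; exact: rc.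
have [t2 [s2 [E2 L2 [P2 Q2] r2]]] := HT2 X st _ e s1 w r1 rc1.
exists (1 + t1 + t2), s2; split=> //; [exact: ExecSeq E2|lia|split; first by rewrite P2].
by move=> i im; rewrite Q2 ?Q1.
Qed.

Lemma dfC_for b lim m (F : ctxT m -> nat -> env -> dyn -> dyn) : 0 < lim ->
  @dfC lim m.+1 (fun e st d => F e.1 e.2 st d) ->
  @dfC lim m (fun e st d => forD (bv b st) (fun x => F e x st) d).
Proof.
move=> lim0 H loc m' Hl; pose loc' i := if i == m then m' else loc i.
have Hl' i : i < m.+1 -> loc' i < m'.+1.
  rewrite /loc'; case: eqP => // ne im; apply: leqW; apply: Hl; lia.
have [c [T [pT HT]]] := H loc' m'.+1 Hl'.
pose T' X := T (bT b X + X); have pT' : polyb T'.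
  apply: (@polyb_comp T (fun X => bT b X + X)) => //; last by have pb := polyb_bT b; polyb_tac.
  by move=> X X0; rewrite addn_gt0 X0 orbT.
exists (cfor b m' c).
exists (fun X => (bT b X + 1) * (T' X + bT b X + 4 * bT b X + 8 * m' + 50)).
split; first by have pb := polyb_bT b; polyb_tac.
move=> X st d e s w r rc.
set N := bv b st; have [_ _ NB] := rep_ba b lim0 w r; rewrite -/N in NB.
pose D x := forD x (fun x => F e x st) d.
pose Inv x s1 := [/\ presC m' s s1, nmem s1 7 m' = x & rep lim st (D x) s1].
have rep7 d1 s1 v : rep lim st d1 s1 -> rep lim st d1 (setn s1 7 m' v).
  by move=> [rn rr]; split=> // A j H1; rewrite /= /upd; case: (A =P 7) H1 => [->//|_ H1]; exact: rn.
have [x s1 xN [P1 V1 r1]|||t1 [s1 [E1 [P1 V1 r1] L1]]] :=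
  @exec_for (ef st) m' b N c s Inv (T' X) (bT b X).
- by have [-> L _] := rep_ba b lim0 w r1.
- move=> x s1 xN [[P1 Q1] V1 r1].
  have w' : wf (bT b X + X) st by apply: wf_mono w; lia.
  have rc1 : repc X loc e s1 by move=> i im; rewrite Q1 ?Hl //; exact: rc.
  have rc' := repc_for lim0 w r1 rc1 Hl xN (pres_refl _ 0 _) V1.
  have [t [s2 [E2 L2 [P2 Q2] r2]]] := HT _ st _ (e, x) s1 w' r1 rc'.
  exists t, s2; split=> //; first by rewrite Q2.
  split; [split|by rewrite /= /upd !eqxx|].
  + by rewrite /= P2.
  + by move=> i im; rewrite /= /upd (ltn_eqF im) andbF Q2 ?Q1 // ltnW.
  by apply: rep7; rewrite /D forDS.
- split; [split=> // i im|by rewrite /= /upd !eqxx|exact: rep7].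
  by rewrite /= /upd (ltn_eqF im) andbF.
exists t1, s1; split=> //.
by apply: leq_trans L1 _; rewrite addn1 leq_mul //; lia.
Qed.

(* The new values are first collected in scratch array 9, so that all of them
   are computed from the old table. *)
Lemma dfC_tabB A b lim m (phi : ctxT m -> nat -> env -> dyn -> bool) :
  0 < lim -> ~~ scr A -> dy lim A ->
  @dfB lim m.+1 (fun e st d => phi e.1 e.2 st d) ->
  @dfC lim m (fun e st d => tabB A (bv b st) (fun x => phi e x st) d).
Proof.
move=> lim0 nsA dyA H loc m' Hl; pose loc' i := if i == m then m' else loc i.
have Hl' i : i < m.+1 -> loc' i < m'.+1.
  rewrite /loc'; case: eqP => // ne im; apply: leqW; apply: Hl; lia.
have [c [T [pT HT]]] := H loc' m'.+1 0 Hl'.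
pose T' X := T (bT b X + X); have pT' : polyb T'.
  apply: (@polyb_comp T (fun X => bT b X + X)) => //; last by have pb := polyb_bT b; polyb_tac.
  by move=> X X0; rewrite addn_gt0 X0 orbT.
pose body1 := CSeq c (CSetN 9 (AGet 7 (ANat m')) (AGet 6 (ANat 0))).
pose body2 := CSetN A (AGet 7 (ANat m')) (AGet 9 (AGet 7 (ANat m'))).
exists (CSeq (cfor b m' body1) (cfor b m' body2)).
pose Tc X := T' X + 4 * bT b X + 4 * m' + 50.
exists (fun X => 2 * ((bT b X + 1) * (Tc X + bT b X + 4 * bT b X + 8 * m' + 50)) + 1).
split; first by rewrite /Tc; have pb := polyb_bT b; polyb_tac.
move=> X st d e s w r rc.
set N := bv b st; have [_ _ NB] := rep_ba b lim0 w r; rewrite -/N in NB.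
have repS (B i v : nat) d1 s1 : scr B -> rep lim st d1 s1 -> rep lim st d1 (setn s1 B i v).
  move=> sB [rn rr]; split=> // A' j H1; rewrite /= /upd.
  case: (A' =P B) H1 => [->|_ H1]; last exact: rn.
  by rewrite sB.
pose Inv1 x s1 := [/\ presC m' s s1, nmem s1 7 m' = x, rep lim st d s1 &
   forall j, j < x -> nmem s1 9 j = phi e j st d].
have [x s1 xN [P1 V1 r1 _]|||t1 [s1 [E1 [P1 V1 r1 G1] L1]]] :=
  @exec_for (ef st) m' b N body1 s Inv1 (Tc X) (bT b X).
- by have [-> L _] := rep_ba b lim0 w r1.
- move=> x s1 xN [[P1 Q1] V1 r1 G1].
  have w' : wf (bT b X + X) st by apply: wf_mono w; lia.
  have rc1 : repc X loc e s1 by move=> i im; rewrite Q1 ?Hl //; exact: rc.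
  have rc' := repc_for lim0 w r1 rc1 Hl xN (pres_refl _ 0 _) V1.
  have [t [s2 [E2 L2 P2 V2 B2]]] := HT _ st _ (e, x) s1 w' r1 rc'.
  rewrite -/(T' X) /= in L2 V2.
  have V7 i : i <= m' -> nmem s2 7 i = nmem s1 7 i by move=> im; case: P2 => _ -> //=; rewrite ltnNge im.
  have V9 i : nmem s2 9 i = nmem s1 9 i by case: P2 => _ ->.
  eexists _, (setn s2 9 x (phi e x st d)); split.
  + rewrite /body1 -V2 -[in setn _ _ x _]V1 -V7 //; apply: ExecSeq E2 _; exact: ExecSetN.
  + rewrite /= V7 // V1 V2; have := bitlen_leS m'; have := bitlen_leS x; have := bitlen_leS 0.
    have := bitlen_leS (phi e x st d); have : phi e x st d <= 1 by case: (phi e x st d).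
    rewrite /Tc; lia.
  + by rewrite /= /upd V7.
  split; [split|by rewrite /= /upd !eqxx| |].
  + by case: P2 => /= ->.
  + by move=> i im; rewrite /= /upd /= (ltn_eqF im) V7 ?Q1 // ltnW.
  + by apply: (repS 7) => //; apply: (repS 9) => //; exact: rep_pres P2 r1.
  move=> j; rewrite ltnS leq_eqVlt /= /upd /= => /predU1P[->|jx]; first by rewrite eqxx.
  by rewrite (ltn_eqF jx) V9 G1.
- split => //; [split=> // i im|by rewrite /= /upd !eqxx|exact: repS].
  by rewrite /= /upd (ltn_eqF im) andbF.
pose D x := setB d A (fun j => if j < x then phi e j st d else dB d A j).
pose Inv2 x s2 := [/\ presC m' s s2, nmem s2 7 m' = x, rep lim st (D x) s2 &
   forall j, j < N -> nmem s2 9 j = phi e j st d].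
have A7 : (A == 7) = false by move: nsA; rewrite /scr; case: (A =P 7) => // ->.
have A9 : (A == 9) = false by move: nsA; rewrite /scr; case: (A =P 9) => // ->.
have [x s2 xN [P2 V2 r2 _]|||t2 [s2 [E2 [P2 V2 r2 G2] L2]]] :=
  @exec_for (ef st) m' b N body2 s1 Inv2 (Tc X) (bT b X).
- by have [-> L _] := rep_ba b lim0 w r2.
- move=> x s2 xN [[P2 Q2] V2 r2 G2].
  eexists _, (setn s2 A x (phi e x st d)); split.
  + rewrite /body2 -(G2 _ xN) -[x]V2; exact: ExecSetN.
  + rewrite /= V2 (G2 _ xN); have := bitlen_leS m'; have := bitlen_leS x.
    have := bitlen_leS (phi e x st d); have : phi e x st d <= 1 by case: (phi e x st d).
    rewrite /Tc; lia.
  + by rewrite /= /upd eq_sym A7.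
  split; [split|by rewrite /= /upd !eqxx| |].
  + by [].
  + by move=> i im; rewrite /= /upd /= (ltn_eqF im) eq_sym A7 /= Q2.
  + apply: repS => //; case: r2 => rn rr; split=> // A' j H1; rewrite /= /upd /=.
    case: (A' =P A) => [->|nA] /=; last first.
      by rewrite rn // /D /=; case: eqP.
    rewrite dyA ltnS leq_eqVlt; case: (j =P x) => [->//|_] /=.
    by rewrite rn // dyA /D /= eqxx.
  by move=> j jN; rewrite /= /upd /= [9 == A]eq_sym A9 /= G2.
- split=> //; first split.
  + by case: P1.
  + by move=> i im; case: P1 => _ Q1; rewrite /= /upd (ltn_eqF im) andbF Q1.
  + by rewrite /= /upd !eqxx.
  apply: repS => //; case: r1 => rn rr; split=> // A' j H1.
  by rewrite rn // /D /=; case: (A' =P A) => [->|].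
exists (1 + t1 + t2), s2; split=> //; first exact: ExecSeq E2.
have le t : t <= N.+1 * (Tc X + bT b X + 4 * N + 8 * m' + 50) ->
   t <= (bT b X + 1) * (Tc X + bT b X + 4 * bT b X + 8 * m' + 50).
  by move=> L; apply: leq_trans L _; rewrite addn1 leq_mul //; lia.
by have := le _ L1; have := le _ L2; lia.
Qed.

(** As for Boolean tables, with real array 1 as the buffer that separates new values from old
    ones. *)
Lemma dfC_tabR A b lim m (phi : ctxT m -> nat -> env -> dyn -> R) :
  0 < lim -> 1 < A ->
  @dfR lim m.+1 (fun e st d => phi e.1 e.2 st d) ->
  @dfC lim m (fun e st d => tabR A (bv b st) (fun x => phi e x st) d).
Proof.
move=> lim0 A1 H loc m' Hl; pose loc' i := if i == m then m' else loc i.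
have Hl' i : i < m.+1 -> loc' i < m'.+1.
  rewrite /loc'; case: eqP => // ne im; apply: leqW; apply: Hl; lia.
have [c [T [pT HT]]] := H loc' m'.+1 0 Hl'.
pose T' X := T (bT b X + X); have pT' : polyb T'.
  apply: (@polyb_comp T (fun X => bT b X + X)) => //; last by have pb := polyb_bT b; polyb_tac.
  by move=> X X0; rewrite addn_gt0 X0 orbT.
pose body1 := CSeq c (CSetR 1 (AGet 7 (ANat m')) (RGet 0 (ANat 0))).
pose body2 := CSetR A (AGet 7 (ANat m')) (RGet 1 (AGet 7 (ANat m'))).
exists (CSeq (cfor b m' body1) (cfor b m' body2)).
pose Tc X := T' X + 4 * bT b X + 4 * m' + 50.
exists (fun X => 2 * ((bT b X + 1) * (Tc X + bT b X + 4 * bT b X + 8 * m' + 50)) + 1).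
split; first by rewrite /Tc; have pb := polyb_bT b; polyb_tac.
move=> X st d e s w r rc.
set N := bv b st; have [_ _ NB] := rep_ba b lim0 w r; rewrite -/N in NB.
have repS i v d1 s1 : rep lim st d1 s1 -> rep lim st d1 (setn s1 7 i v).
  move=> [rn rr]; split=> // A' j H1; rewrite /= /upd.
  by case: (A' =P 7) H1 => [->//|_ H1]; exact: rn.
have repR i v d1 s1 : rep lim st d1 s1 -> rep lim st d1 (setr s1 1 i v).
  move=> [rn rr]; split=> // A' j H1; rewrite /= /upd.
  by case: (A' =P 1) H1 => [->//|_ H1]; exact: rr.
pose Inv1 x s1 := [/\ presC m' s s1, nmem s1 7 m' = x, rep lim st d s1 &
   forall j, j < x -> rmem s1 1 j = phi e j st d].
have [x s1 xN [P1 V1 r1 _]|||t1 [s1 [E1 [P1 V1 r1 G1] L1]]] :=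
  @exec_for (ef st) m' b N body1 s Inv1 (Tc X) (bT b X).
- by have [-> L _] := rep_ba b lim0 w r1.
- move=> x s1 xN [[P1 Q1] V1 r1 G1].
  have w' : wf (bT b X + X) st by apply: wf_mono w; lia.
  have rc1 : repc X loc e s1 by move=> i im; rewrite Q1 ?Hl //; exact: rc.
  have rc' := repc_for lim0 w r1 rc1 Hl xN (pres_refl _ 0 _) V1.
  have [t [s2 [E2 L2 P2 V2]]] := HT _ st _ (e, x) s1 w' r1 rc'.
  rewrite -/(T' X) /= in L2 V2.
  have V7 i : i <= m' -> nmem s2 7 i = nmem s1 7 i by move=> im; case: P2 => _ -> //=; rewrite ltnNge im.
  have V9 i : rmem s2 1 i = rmem s1 1 i by case: P2 => _ _ ->.
  eexists _, (setr s2 1 x (phi e x st d)); split.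
  + rewrite /body1 -V2 -[in setr _ _ x _]V1 -V7 //; apply: ExecSeq E2 _; exact: ExecSetR.
  + rewrite /= V7 // V1; have := bitlen_leS m'; have := bitlen_leS x; have := bitlen_leS 0.
    rewrite /Tc; lia.
  + by rewrite /= V7.
  split; [split|by rewrite /= /upd !eqxx| |].
  + by case: P2 => /= ->.
  + by move=> i im; rewrite /= /upd /= (ltn_eqF im) V7 ?Q1 // ltnW.
  + by apply: repS; apply: repR; exact: rep_pres P2 r1.
  move=> j; rewrite ltnS leq_eqVlt /= /upd /= => /predU1P[->|jx]; first by rewrite eqxx.
  by rewrite (ltn_eqF jx) V9 G1.
- split => //; [split=> // i im|by rewrite /= /upd !eqxx|exact: repS].
  by rewrite /= /upd (ltn_eqF im) andbF.
pose D x := setRR d A (fun j => if j < x then phi e j st d else dR d A j).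
pose Inv2 x s2 := [/\ presC m' s s2, nmem s2 7 m' = x, rep lim st (D x) s2 &
   forall j, j < N -> rmem s2 1 j = phi e j st d].
have A1' : (A == 1) = false by move: A1; case: (A =P 1) => // ->.
have [x s2 xN [P2 V2 r2 _]|||t2 [s2 [E2 [P2 V2 r2 G2] L2]]] :=
  @exec_for (ef st) m' b N body2 s1 Inv2 (Tc X) (bT b X).
- by have [-> L _] := rep_ba b lim0 w r2.
- move=> x s2 xN [[P2 Q2] V2 r2 G2].
  eexists _, (setr s2 A x (phi e x st d)); split.
  + rewrite /body2 -(G2 _ xN) -[x]V2; exact: ExecSetR.
  + rewrite /= V2; have := bitlen_leS m'; have := bitlen_leS x.
    rewrite /Tc; lia.
  + by [].
  split; [split|by rewrite /= /upd !eqxx| |].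
  + by [].
  + by move=> i im; rewrite /= /upd /= (ltn_eqF im) Q2.
  + apply: repS => //; case: r2 => rn rr; split=> // A' j H1; rewrite /= /upd /=.
    case: (A' =P A) => [->|nA] /=; last first.
      by rewrite rr // /D /=; case: eqP.
    rewrite ltnS leq_eqVlt; case: (j =P x) => [->//|_] /=.
    by rewrite rr // /D /= eqxx.
  by move=> j jN; rewrite /= /upd /= [1 == A]eq_sym A1' /= G2.
- split=> //; first split.
  + by case: P1.
  + by move=> i im; case: P1 => _ Q1; rewrite /= /upd (ltn_eqF im) andbF Q1.
  + by rewrite /= /upd !eqxx.
  apply: repS => //; case: r1 => rn rr; split=> // A' j H1.
  by rewrite rr // /D /=; case: (A' =P A) => [->|].
exists (1 + t1 + t2), s2; split=> //; first exact: ExecSeq E2.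
have le t : t <= N.+1 * (Tc X + bT b X + 4 * N + 8 * m' + 50) ->
   t <= (bT b X + 1) * (Tc X + bT b X + 4 * bT b X + 8 * m' + 50).
  by move=> L; apply: leq_trans L _; rewrite addn1 leq_mul //; lia.
by have := le _ L1; have := le _ L2; lia.
Qed.

End Language.

(** * The algorithm *)

Section Program.
Variables (R : realType) (f : nat -> R).
Implicit Types (st : memory nat) (d : dyn R).
Local Notation nn st := (bv Bn st).
Local Notation kk st := (bv Bk st).

(** Row [t] of array 10 marks the vertices within distance [t] of vertex 0, so the number of rows
    missing [v] is its depth. *)
Definition depS st v := sumN (nn st) (fun t => st 10 (t * nn st + v) == 0).

Definition prlS st v w :=
  [&& v < nn st, w < nn st, st 1 (v * nn st + w) != 0 & depS st w < depS st v].

Definition ancS st v w := [&& v < nn st, w < nn st & st 11 (v * nn st + w) != 0].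

Definition inPS st i v :=
  hasN (nn st) (fun w => prlS st v w && (st 2 ((i * nn st + v) * nn st + w) != 0)).

Definition coinS st v := st 8 v != 0.

Definition pwS st b l := pw (nn st) b l.
Definition szS st v := sz (nn st) (ancS st) v.
Definition mkS st q v := mk (nn st) (ancS st) (prlS st) q v.
Definition US st b l v := ~~ mkS st (pwS st b l.+1) v.
Definition MS st b l v := mkS st (pwS st b l) v.
Definition lamS st := lam (nn st).
Definition connS st b l v w := conn (nn st) (ancS st) (US st b l) v w.
Definition hasS st b l v := hasm (nn st) (ancS st) (US st b l) (MS st b l) v.
Definition MhS st b l v := Mh (nn st) (ancS st) (prlS st) (US st b l) (MS st b l) v.
Definition zrS st b l v z := zr (nn st) (ancS st) (prlS st) (US st b l) (MS st b l) v z.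
Definition topS st b l c := top (nn st) (prlS st) (US st b l) c.
Definition idxS st b l c z := idx (nn st) (ancS st) (prlS st) (US st b l) (MS st b l) c z.
Definition sameS st b l v w := same (nn st) (ancS st) (prlS st) (US st b l) (MS st b l) v w.
Definition dgtS st b l c g z := dgt (nn st) (ancS st) (prlS st) (US st b l) (MS st b l) c g z.
Definition xzS st b l c g z := xz (nn st) (ancS st) (prlS st) (US st b l) (MS st b l) c g z.
Definition NAS st b l v := NA (nn st) (ancS st) (prlS st) (US st b l) (MS st b l) (coinS st) v.
Definition PrAS st b l v p :=
  PrA (nn st) (ancS st) (prlS st) (US st b l) (MS st b l) (coinS st) v p.
Definition ChAS st b l v w :=
  ChA (nn st) (ancS st) (prlS st) (US st b l) (MS st b l) (coinS st) v w.
Definition RwAS st b l i v j :=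
  RwA (nn st) (ancS st) (prlS st) (US st b l) (MS st b l) (coinS st) (inPS st) (st 3) i v j.
Definition NKS st b l c g v :=
  NK (nn st) (ancS st) (prlS st) (US st b l) (MS st b l) (xzS st b l c g) c v.
Definition chKS st kap v w := chK (ancS st) kap v w.
Definition PrKS st kap b l c g v p :=
  PrK (nn st) (ancS st) (prlS st) (US st b l) (MS st b l) (xzS st b l c g) c kap v p.
Definition ChKS st kap b l c g v w :=
  ChK (nn st) (ancS st) (prlS st) (US st b l) (MS st b l) (xzS st b l c g) c kap v w.
Definition CapKS st b l c g v j :=
  CapK (nn st) (ancS st) (prlS st) (US st b l) (MS st b l) (xzS st b l c g) v j.
Definition GoodKS st kap b l c g i v :=
  GoodK (nn st) (ancS st) (prlS st) (US st b l) (MS st b l) (xzS st b l c g) c kap (inPS st) i v.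
Definition XKS st b l c g i v :=
  XK (nn st) (ancS st) (prlS st) (US st b l) (MS st b l) (xzS st b l c g) c (inPS st) i v.
Definition RwKS st kap b l c g i v j :=
  RwK (nn st) (ancS st) (prlS st) (US st b l) (MS st b l) (xzS st b l c g) c kap (inPS st) (st 3) i v j.
Definition FMS st b l c g v :=
  FM (nn st) (ancS st) (prlS st) (US st b l) (MS st b l) (xzS st b l c g) c v.

Definition cntS st (F : nat -> bool) i := sumN (nn st) (fun v => inPS st i v && F v).

Definition revS st (F : nat -> bool) : R := sumR (kk st) (fun i =>
  (((cntS st F i <= st 3 i) * st 4 i)%:R * f (cntS st F i))%R).

(** The nonemptiness of the path makes the component unique; an empty path would belong to all of
    them. *)
Definition inCS st b l c i := allN (nn st) (fun v => inPS st i v ==> connS st b l c v) &&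
  hasN (nn st) (fun v => inPS st i v).

Definition objS st b l c (F : nat -> bool) : R := sumR (kk st) (fun i =>
  ((inCS st b l c i *
    ((cntS st F i <= st 3 i) * st 4 i))%:R * f (cntS st F i))%R).

(** The decision at [v] when [j] nodes of its chain before [v] are chosen: [v] is added if the
    capacity allows it and the table value does not decrease. *)
Definition incS st (Cap : nat -> nat -> bool) v j d :=
  [&& Cap v j.+1, j < nn st & (dR d 2 (v * (nn st + 1) + j) <= dR d 2 (v * (nn st + 1) + j.+1))%R].

Definition bestS st Cap v j d : R :=
  ((incS st Cap v j d)%:R * dR d 2 (v * (nn st + 1) + j.+1) +
   (~~ incS st Cap v j d)%:R * dR d 2 (v * (nn st + 1) + j))%R.

Definition leafS st (Rw : nat -> nat -> nat -> bool) v j : R :=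
  sumR (kk st) (fun i => ((Rw i v j * st 4 i)%:R * f j)%R).

(** Entry [(v, j)] is the value of the subforest at [v], provided that [j] nodes are chosen on the
    chain of [v] with [v] included; [bestS] decides at each successor. *)
Definition stepG st (Pr : nat -> nat -> bool) Cap Rw :=
  tabR 2 (bv (Bmul Bn (Badd Bn (Bc 1))) st) (fun q d =>
    (leafS st Rw (q %/ (nn st + 1))%N (q %% (nn st + 1))%N +
     sumR (nn st) (fun c => (Pr c (q %/ (nn st + 1))%N)%:R *
        bestS st Cap c (q %% (nn st + 1))%N d))%R).

(** Recovers the solution from the roots outwards: the number of choices made before [v] on its
    chain determines the decision at [v]. *)
Definition stepF st (N : nat -> bool) (Ch : nat -> nat -> bool) Cap :=
  tabB 20 (nn st) (fun v d =>
    N v && incS st Cap v (sumN (nn st) (fun w => Ch v w && dB d 20 w)) d).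

(* The recursions of the dynamic program are run by iterating the defining
   equations until they are stable. *)
Definition solve st N Pr Ch Cap Rw d :=
  forD (nn st) (fun _ => stepF st N Ch Cap) (forD (nn st) (fun _ => stepG st Pr Cap Rw) d).

Definition solveA st b l :=
  solve st (NAS st b l) (PrAS st b l) (ChAS st b l) (fun _ _ => true) (RwAS st b l).

Definition solveK st kap b l c g :=
  solve st (NKS st b l c g) (PrKS st kap b l c g) (ChKS st kap b l c g) (CapKS st b l c g)
    (RwKS st kap b l c g).

(* Array 20 holds the current candidate; [keep A obj] replaces the contents of
   array [A] by it if that does not decrease [obj]. *)
Definition keep st A (obj : (nat -> bool) -> R) d :=
  tabB A (nn st) (fun v d => if dB d 24 0 then dB d 20 v else dB d A v)
    (tabB 24 (bv (Bc 1) st) (fun _ d => obj (dB d A) <= obj (dB d 20))%R d).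

Definition codeStep st b l c g d :=
  keep st 21 (objS st b l c) (tabB 20 (nn st) (fun v _ => FMS st b l c g v)
    (keep st 21 (objS st b l c) (solveK st 1 b l c g
      (keep st 21 (objS st b l c) (solveK st 0 b l c g d))))).

Definition compStep st b l c d :=
  tabB 22 (nn st) (fun v d => if topS st b l c && connS st b l c v then dB d 21 v else dB d 22 v)
    (forD (bv (Bmul (Bc 64) (Bmul Bn Bn)) st) (fun g => codeStep st b l c g)
      (tabB 21 (nn st) (fun _ _ => false) d)).

Definition levelStep st b l d :=
  keep st 23 (revS st) (tabB 20 (nn st) (fun v d => dB d 22 v)
    (forD (nn st) (fun c => compStep st b l c)
      (tabB 22 (nn st) (fun _ _ => false)
        (keep st 23 (revS st) (solveA st b l d))))).

(** The branching parameter is not computed; all values below [n + 8] and all levels are tried,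
    which includes those of the analysis. In the output each chosen vertex becomes the edge to its
    parent. *)
Definition mainS st d :=
  tabB 5 (bv (Bmul Bn Bn) st) (fun j d => prlS st (j %/ nn st) (j %% nn st) && dB d 23 (j %/ nn st))
    (forD (bv (Badd Bn (Bc 8)) st) (fun b => forD (nn st) (fun l => levelStep st b l))
      (tabB 23 (nn st) (fun _ _ => false) d)).

Definition bfsS st d : dyn R := forD (nn st) (fun _ => tabB 10 (bv (Bmul Bn Bn) st) (fun j d =>
  if j %/ nn st == 0 then j %% nn st == 0 else
    dB d 10 ((j %/ nn st - 1) * nn st + j %% nn st) ||
    hasN (nn st) (fun w => (st 1 (w * nn st + j %% nn st) != 0) &&
       dB d 10 ((j %/ nn st - 1) * nn st + w)))) d.

Definition ancestS st d : dyn R := forD (nn st) (fun _ => tabB 11 (bv (Bmul Bn Bn) st) (fun j d =>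
  (j %/ nn st == j %% nn st) ||
  hasN (nn st) (fun p => prlS st (j %% nn st) p && dB d 11 ((j %/ nn st) * nn st + p)))) d.

End Program.

(** * Definability of the algorithm *)

Section Definability.
Variable R : realType.

Lemma dfN_add lim m (a b : ctxT m -> env R -> dyn R -> nat) :
  dfN lim a -> dfN lim b -> dfN lim (fun e st d => a e st d + b e st d).
Proof. exact: (dfN_op OAdd). Qed.
Lemma dfN_sub lim m (a b : ctxT m -> env R -> dyn R -> nat) :
  dfN lim a -> dfN lim b -> dfN lim (fun e st d => a e st d - b e st d).
Proof. exact: (dfN_op OSub). Qed.
Lemma dfN_mul lim m (a b : ctxT m -> env R -> dyn R -> nat) :
  dfN lim a -> dfN lim b -> dfN lim (fun e st d => a e st d * b e st d).
Proof. exact: (dfN_op OMul). Qed.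
Lemma dfN_div lim m (a b : ctxT m -> env R -> dyn R -> nat) :
  dfN lim a -> dfN lim b -> dfN lim (fun e st d => a e st d %/ b e st d).
Proof. exact: (dfN_op ODiv). Qed.
Lemma dfN_mod lim m (a b : ctxT m -> env R -> dyn R -> nat) :
  dfN lim a -> dfN lim b -> dfN lim (fun e st d => a e st d %% b e st d).
Proof. exact: (dfN_op OMod). Qed.
Lemma dfN_succ lim m (a : ctxT m -> env R -> dyn R -> nat) :
  dfN lim a -> dfN lim (fun e st d => (a e st d).+1).
Proof.
move=> H; apply: dfN_ext (dfN_add H (@dfN_const _ lim m 1)) => e st d; exact: addn1.
Qed.

Lemma dfN_bv lim m b : 5 < lim -> @dfN R lim m (fun _ st _ => bv b st).
Proof.
move=> l5; have d0 : ~~ dy lim 0 by rewrite /dy /= -ltnNge; lia.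
elim: b => [||c|b1 IH1 b2 IH2|b1 IH1 b2 IH2].
- exact: (@dfN_stat _ 0 lim m (fun _ _ _ => 0)) (@dfN_const _ _ _ _).
- exact: (@dfN_stat _ 0 lim m (fun _ _ _ => 1)) (@dfN_const _ _ _ _).
- exact: dfN_const.
- exact: dfN_add IH1 IH2.
- exact: dfN_mul IH1 IH2.
Qed.

End Definability.

(** A hook, redefined after each group of definability lemmas, so that notions already treated are
    closed by their lemma instead of being unfolded again. *)
Ltac df_call := fail.

Ltac df_side := first [assumption | by [] | (rewrite /dy /=; lia)].

(** Drops the innermost context variable where it does not occur, so that hypotheses about the outer
    context apply under a binder. *)
Ltac df_weak :=
  lazymatch goal with
  | |- @dfN ?R ?lim (S ?m) ?F =>
    let H := constr:(fun (q : ctxT m) (x : nat) (st : env R) (d : dyn R) => F (q, x) st d) in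
    let H' := eval cbn [fst snd] in H in
    lazymatch H' with (fun q x st d => @?P q st d) => refine (@dfN_wk R lim m P _) end
  end.

Ltac df_step :=
  lazymatch goal with
  | |- dfN _ (fun _ _ _ => addn _ _) => apply: dfN_add
  | |- dfN _ (fun _ _ _ => subn _ _) => apply: dfN_sub
  | |- dfN _ (fun _ _ _ => muln _ _) => apply: dfN_mul
  | |- dfN _ (fun _ _ _ => divn _ _) => apply: dfN_div
  | |- dfN _ (fun _ _ _ => modn _ _) => apply: dfN_mod
  | |- dfN _ (fun _ _ _ => nat_of_bool _) => refine (_ : dfB _ _)
  | |- dfN _ (fun _ st _ => bv _ (em st)) => apply: dfN_bv; df_side
  | |- dfN _ (fun _ st _ => sumN (bv _ (em st)) _) => apply: dfN_sum; [df_side|]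
  | |- dfN _ (fun _ st _ => prodN (bv _ (em st)) _) => apply: dfN_prod; [df_side|]
  | |- dfN _ (fun _ _ _ => if _ then _ else _) => apply: dfN_if
  | |- dfN _ (fun _ _ _ => ?c) => exact: dfN_const
  | |- dfN _ (fun _ _ _ => S _) => apply: dfN_succ
  | |- dfN _ (fun e _ _ => snd e) => exact: dfN_var
  | |- dfN _ (fun _ st _ => em st ?A _) => apply: (dfN_stat (A := A)); [by []|df_side|]
  | |- dfB _ (fun _ _ _ => andb _ _) => apply: dfB_and
  | |- dfB _ (fun _ _ _ => orb _ _) => apply: dfB_or
  | |- dfB _ (fun _ _ _ => negb _) => apply: dfB_neg
  | |- dfB _ (fun _ _ _ => implb _ _) => apply: dfB_imp
  | |- dfB _ (fun _ _ _ => leq _ _) => apply: dfB_le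
  | |- dfB _ (fun _ _ _ => if _ then _ else _) => apply: dfB_if
  | |- dfB _ (fun _ _ _ => eq_op _ _) => first [apply: dfB_eq | apply: dfB_eqb]
  | |- dfB _ (fun _ st _ => hasN (bv _ (em st)) _) => apply: dfB_has; [df_side|]
  | |- dfB _ (fun _ st _ => allN (bv _ (em st)) _) => apply: dfB_all; [df_side|]
  | |- dfB _ (fun _ _ d => dB d ?A _) => apply: (dfB_dyn (A := A)); [by []|df_side|]
  | |- dfB _ (fun _ _ _ => Order.le _ _) => apply: dfB_leR
  | |- dfB ?lim (fun _ _ _ => true) => exact: (@dfN_const _ lim _ 1)
  | |- dfB ?lim (fun _ _ _ => false) => exact: (@dfN_const _ lim _ 0)
  | |- dfR _ (fun _ _ _ => GRing.add _ _) => apply: dfR_add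
  | |- dfR _ (fun _ _ _ => GRing.mul (GRing.natmul _ _) _) => apply: dfR_scale
  | |- dfR _ (fun _ st _ => sumR (bv _ (em st)) _) => apply: dfR_sum; [df_side|]
  | |- dfR _ (fun _ _ d => dR d ?A _) => apply: (dfR_get (A := A)); [by []|]
  | |- dfC _ (fun _ st d => tabB ?A (bv _ (em st)) _ d) => apply: (dfC_tabB (A := A)); [df_side|by []|df_side|]
  | |- dfC _ (fun _ st d => tabR ?A (bv _ (em st)) _ d) => apply: (dfC_tabR (A := A)); [df_side|by []|]
  | |- dfC _ (fun _ st d => forD (bv _ (em st)) _ d) => apply: dfC_for; [df_side|]
  | |- @dfC ?R ?lim ?m (fun e st d => tabB ?A (bv ?b (em st)) (@?phi e st) (@?X e st d)) =>
      refine (@dfC_seq R lim m X (fun e st d => tabB A (bv b (em st)) (phi e st) d) _ _)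
  | |- @dfC ?R ?lim ?m (fun e st d => forD (bv ?b (em st)) (@?phi e st) (@?X e st d)) =>
      refine (@dfC_seq R lim m X (fun e st d => forD (bv b (em st)) (phi e st) d) _ _)
  | |- dfR _ (fun _ st _ => ef st _) => apply: dfR_oracle
  end.

Ltac df := repeat (cbv beta; first [assumption | df_call | df_step | (df_weak; cbv beta)]).

Section Definability2.
Variable R : realType.

Lemma df_prlS lim m (v w : ctxT m -> env R -> dyn R -> nat) : 10 < lim ->
  dfN lim v -> dfN lim w -> dfB lim (fun e st d => prlS st (v e st d) (w e st d)).
Proof. by move=> l10 *; rewrite /prlS /depS; df. Qed.

Ltac df_call0 := lazymatch goal with
  | |- dfB _ (fun _ _ _ => prlS _ _ _) => (apply: df_prlS; [df_side| |])
  end.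
Ltac df_call ::= df_call0.

Lemma df_ancS m (v w : ctxT m -> env R -> dyn R -> nat) : dfN 12 v -> dfN 12 w ->
  @dfB R 12 m (fun e st d => ancS st (v e st d) (w e st d)).
Proof. by move=> *; rewrite /ancS; df. Qed.

Lemma df_coinS m (v : ctxT m -> env R -> dyn R -> nat) : dfN 12 v ->
  @dfB R 12 m (fun e st d => coinS st (v e st d)).
Proof. by move=> *; rewrite /coinS; df. Qed.

Lemma df_pwS m (b l : ctxT m -> env R -> dyn R -> nat) : dfN 12 b -> dfN 12 l ->
  @dfN R 12 m (fun e st d => pwS st (b e st d) (l e st d)).
Proof. by move=> *; rewrite /pwS /pw; df. Qed.

Lemma df_lamS m :
  @dfN R 12 m (fun e st d => lamS st ).
Proof. by rewrite /lamS /lam /pw; df. Qed.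

Ltac df_call1 := lazymatch goal with
  | |- dfB _ (fun _ _ _ => ancS _ _ _) => apply: df_ancS
  | |- dfB _ (fun _ _ _ => coinS _ _) => apply: df_coinS
  | |- dfN _ (fun _ _ _ => pwS _ _ _) => apply: df_pwS
  | |- dfN _ (fun _ _ _ => pw _ _ _) => apply: df_pwS
  | |- dfN _ (fun _ _ _ => lamS _) => apply: df_lamS
  | |- dfN _ (fun _ _ _ => lam _) => apply: df_lamS
  | _ => df_call0
  end.
Ltac df_call ::= df_call1.

Lemma df_inPS m (i v : ctxT m -> env R -> dyn R -> nat) : dfN 12 i -> dfN 12 v ->
  @dfB R 12 m (fun e st d => inPS st (i e st d) (v e st d)).
Proof. by move=> *; rewrite /inPS; df. Qed.

Lemma df_szS m (v : ctxT m -> env R -> dyn R -> nat) : dfN 12 v ->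
  @dfN R 12 m (fun e st d => szS st (v e st d)).
Proof. by move=> *; rewrite /szS /sz; df. Qed.

Ltac df_call2 := lazymatch goal with
  | |- dfB _ (fun _ _ _ => inPS _ _ _) => apply: df_inPS
  | |- dfN _ (fun _ _ _ => szS _ _) => apply: df_szS
  | |- dfN _ (fun _ _ _ => sz _ _ _) => apply: df_szS
  | _ => df_call1
  end.
Ltac df_call ::= df_call2.

Lemma df_mkS m (q v : ctxT m -> env R -> dyn R -> nat) : dfN 12 q -> dfN 12 v ->
  @dfB R 12 m (fun e st d => mkS st (q e st d) (v e st d)).
Proof. by move=> *; rewrite /mkS /mk; df. Qed.

Ltac df_call3 := lazymatch goal with
  | |- dfB _ (fun _ _ _ => mkS _ _ _) => apply: df_mkS
  | |- dfB _ (fun _ _ _ => mk _ _ _ _ _) => apply: df_mkS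
  | _ => df_call2
  end.
Ltac df_call ::= df_call3.

Lemma df_US m (b l v : ctxT m -> env R -> dyn R -> nat) : dfN 12 b -> dfN 12 l -> dfN 12 v ->
  @dfB R 12 m (fun e st d => US st (b e st d) (l e st d) (v e st d)).
Proof. by move=> *; rewrite /US; df. Qed.

Lemma df_MS m (b l v : ctxT m -> env R -> dyn R -> nat) : dfN 12 b -> dfN 12 l -> dfN 12 v ->
  @dfB R 12 m (fun e st d => MS st (b e st d) (l e st d) (v e st d)).
Proof. by move=> *; rewrite /MS; df. Qed.

Ltac df_call4 := lazymatch goal with
  | |- dfB _ (fun _ _ _ => US _ _ _ _) => apply: df_US
  | |- dfB _ (fun _ _ _ => MS _ _ _ _) => apply: df_MS
  | _ => df_call3
  end.
Ltac df_call ::= df_call4.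

Lemma df_connS m (b l v w : ctxT m -> env R -> dyn R -> nat) : dfN 12 b -> dfN 12 l -> dfN 12 v -> dfN 12 w ->
  @dfB R 12 m (fun e st d => connS st (b e st d) (l e st d) (v e st d) (w e st d)).
Proof. by move=> *; rewrite /connS /conn; df. Qed.

Lemma df_topS m (b l c : ctxT m -> env R -> dyn R -> nat) : dfN 12 b -> dfN 12 l -> dfN 12 c ->
  @dfB R 12 m (fun e st d => topS st (b e st d) (l e st d) (c e st d)).
Proof. by move=> *; rewrite /topS /top; df. Qed.

Ltac df_call5 := lazymatch goal with
  | |- dfB _ (fun _ _ _ => connS _ _ _ _ _) => apply: df_connS
  | |- dfB _ (fun _ _ _ => conn _ _ _ _ _) => apply: df_connS
  | |- dfB _ (fun _ _ _ => topS _ _ _ _) => apply: df_topS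
  | |- dfB _ (fun _ _ _ => top _ _ _ _) => apply: df_topS
  | _ => df_call4
  end.
Ltac df_call ::= df_call5.

Lemma df_hasS m (b l v : ctxT m -> env R -> dyn R -> nat) : dfN 12 b -> dfN 12 l -> dfN 12 v ->
  @dfB R 12 m (fun e st d => hasS st (b e st d) (l e st d) (v e st d)).
Proof. by move=> *; rewrite /hasS /hasm; df. Qed.

Ltac df_call6 := lazymatch goal with
  | |- dfB _ (fun _ _ _ => hasS _ _ _ _) => apply: df_hasS
  | |- dfB _ (fun _ _ _ => hasm _ _ _ _ _) => apply: df_hasS
  | _ => df_call5
  end.
Ltac df_call ::= df_call6.

Lemma df_MhS m (b l v : ctxT m -> env R -> dyn R -> nat) : dfN 12 b -> dfN 12 l -> dfN 12 v ->
  @dfB R 12 m (fun e st d => MhS st (b e st d) (l e st d) (v e st d)).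
Proof. by move=> *; rewrite /MhS /Mh; df. Qed.

Ltac df_call7 := lazymatch goal with
  | |- dfB _ (fun _ _ _ => MhS _ _ _ _) => apply: df_MhS
  | |- dfB _ (fun _ _ _ => Mh _ _ _ _ _ _) => apply: df_MhS
  | _ => df_call6
  end.
Ltac df_call ::= df_call7.

Lemma df_zrS m (b l v z : ctxT m -> env R -> dyn R -> nat) : dfN 12 b -> dfN 12 l -> dfN 12 v -> dfN 12 z ->
  @dfB R 12 m (fun e st d => zrS st (b e st d) (l e st d) (v e st d) (z e st d)).
Proof. by move=> *; rewrite /zrS /zr; df. Qed.

Lemma df_idxS m (b l c z : ctxT m -> env R -> dyn R -> nat) : dfN 12 b -> dfN 12 l -> dfN 12 c -> dfN 12 z ->
  @dfN R 12 m (fun e st d => idxS st (b e st d) (l e st d) (c e st d) (z e st d)).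
Proof. by move=> *; rewrite /idxS /idx; df. Qed.

Lemma df_NAS m (b l v : ctxT m -> env R -> dyn R -> nat) : dfN 12 b -> dfN 12 l -> dfN 12 v ->
  @dfB R 12 m (fun e st d => NAS st (b e st d) (l e st d) (v e st d)).
Proof. by move=> *; rewrite /NAS /NA; df. Qed.

Ltac df_call8 := lazymatch goal with
  | |- dfB _ (fun _ _ _ => zrS _ _ _ _ _) => apply: df_zrS
  | |- dfB _ (fun _ _ _ => zr _ _ _ _ _ _ _) => apply: df_zrS
  | |- dfN _ (fun _ _ _ => idxS _ _ _ _ _) => apply: df_idxS
  | |- dfN _ (fun _ _ _ => idx _ _ _ _ _ _ _) => apply: df_idxS
  | |- dfB _ (fun _ _ _ => NAS _ _ _ _) => apply: df_NAS
  | |- dfB _ (fun _ _ _ => NA _ _ _ _ _ _ _) => apply: df_NAS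
  | _ => df_call7
  end.
Ltac df_call ::= df_call8.

Lemma df_sameS m (b l v w : ctxT m -> env R -> dyn R -> nat) : dfN 12 b -> dfN 12 l -> dfN 12 v -> dfN 12 w ->
  @dfB R 12 m (fun e st d => sameS st (b e st d) (l e st d) (v e st d) (w e st d)).
Proof. by move=> *; rewrite /sameS /same; df. Qed.

Lemma df_dgtS m (b l c g z : ctxT m -> env R -> dyn R -> nat) : dfN 12 b -> dfN 12 l -> dfN 12 c -> dfN 12 g -> dfN 12 z ->
  @dfN R 12 m (fun e st d => dgtS st (b e st d) (l e st d) (c e st d) (g e st d) (z e st d)).
Proof. by move=> *; rewrite /dgtS /dgt; df. Qed.

Lemma df_PrAS m (b l v p : ctxT m -> env R -> dyn R -> nat) : dfN 12 b -> dfN 12 l -> dfN 12 v -> dfN 12 p ->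
  @dfB R 12 m (fun e st d => PrAS st (b e st d) (l e st d) (v e st d) (p e st d)).
Proof. by move=> *; rewrite /PrAS /PrA; df. Qed.

Lemma df_ChAS m (b l v w : ctxT m -> env R -> dyn R -> nat) : dfN 12 b -> dfN 12 l -> dfN 12 v -> dfN 12 w ->
  @dfB R 12 m (fun e st d => ChAS st (b e st d) (l e st d) (v e st d) (w e st d)).
Proof. by move=> *; rewrite /ChAS /ChA; df. Qed.

Lemma df_RwAS m (b l i v j : ctxT m -> env R -> dyn R -> nat) : dfN 12 b -> dfN 12 l -> dfN 12 i -> dfN 12 v -> dfN 12 j ->
  @dfB R 12 m (fun e st d => RwAS st (b e st d) (l e st d) (i e st d) (v e st d) (j e st d)).
Proof. by move=> *; rewrite /RwAS /RwA; df. Qed.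

Lemma df_chKS m (kap v w : ctxT m -> env R -> dyn R -> nat) : dfN 12 kap -> dfN 12 v -> dfN 12 w ->
  @dfB R 12 m (fun e st d => chKS st (kap e st d) (v e st d) (w e st d)).
Proof. by move=> *; rewrite /chKS /chK; df. Qed.

Ltac df_call9 := lazymatch goal with
  | |- dfB _ (fun _ _ _ => sameS _ _ _ _ _) => apply: df_sameS
  | |- dfB _ (fun _ _ _ => same _ _ _ _ _ _ _) => apply: df_sameS
  | |- dfN _ (fun _ _ _ => dgtS _ _ _ _ _ _) => apply: df_dgtS
  | |- dfN _ (fun _ _ _ => dgt _ _ _ _ _ _ _ _) => apply: df_dgtS
  | |- dfB _ (fun _ _ _ => PrAS _ _ _ _ _) => apply: df_PrAS
  | |- dfB _ (fun _ _ _ => ChAS _ _ _ _ _) => apply: df_ChAS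
  | |- dfB _ (fun _ _ _ => RwAS _ _ _ _ _ _) => apply: df_RwAS
  | |- dfB _ (fun _ _ _ => chKS _ _ _ _) => apply: df_chKS
  | |- dfB _ (fun _ _ _ => chK _ _ _ _) => apply: df_chKS
  | _ => df_call8
  end.
Ltac df_call ::= df_call9.

Lemma df_xzS m (b l c g z : ctxT m -> env R -> dyn R -> nat) : dfN 12 b -> dfN 12 l -> dfN 12 c -> dfN 12 g -> dfN 12 z ->
  @dfN R 12 m (fun e st d => xzS st (b e st d) (l e st d) (c e st d) (g e st d) (z e st d)).
Proof. by move=> *; rewrite /xzS /xz; df. Qed.

Ltac df_call10 := lazymatch goal with
  | |- dfN _ (fun _ _ _ => xzS _ _ _ _ _ _) => apply: df_xzS
  | |- dfN _ (fun _ _ _ => xz _ _ _ _ _ _ _ _) => apply: df_xzS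
  | _ => df_call9
  end.
Ltac df_call ::= df_call10.

Lemma df_NKS m (b l c g v : ctxT m -> env R -> dyn R -> nat) : dfN 12 b -> dfN 12 l -> dfN 12 c -> dfN 12 g -> dfN 12 v ->
  @dfB R 12 m (fun e st d => NKS st (b e st d) (l e st d) (c e st d) (g e st d) (v e st d)).
Proof. by move=> *; rewrite /NKS /NK; df. Qed.

Lemma df_CapKS m (b l c g v j : ctxT m -> env R -> dyn R -> nat) : dfN 12 b -> dfN 12 l -> dfN 12 c -> dfN 12 g -> dfN 12 v -> dfN 12 j ->
  @dfB R 12 m (fun e st d => CapKS st (b e st d) (l e st d) (c e st d) (g e st d) (v e st d) (j e st d)).
Proof. by move=> *; rewrite /CapKS /CapK; df. Qed.

Lemma df_XKS m (b l c g i v : ctxT m -> env R -> dyn R -> nat) : dfN 12 b -> dfN 12 l -> dfN 12 c -> dfN 12 g -> dfN 12 i -> dfN 12 v ->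
  @dfN R 12 m (fun e st d => XKS st (b e st d) (l e st d) (c e st d) (g e st d) (i e st d) (v e st d)).
Proof. by move=> *; rewrite /XKS /XK; df. Qed.

Lemma df_FMS m (b l c g v : ctxT m -> env R -> dyn R -> nat) : dfN 12 b -> dfN 12 l -> dfN 12 c -> dfN 12 g -> dfN 12 v ->
  @dfB R 12 m (fun e st d => FMS st (b e st d) (l e st d) (c e st d) (g e st d) (v e st d)).
Proof. by move=> *; rewrite /FMS /FM; df. Qed.

Ltac df_call11 := lazymatch goal with
  | |- dfB _ (fun _ _ _ => NKS _ _ _ _ _ _) => apply: df_NKS
  | |- dfB _ (fun _ _ _ => NK _ _ _ _ _ _ _ _) => apply: df_NKS
  | |- dfB _ (fun _ _ _ => CapKS _ _ _ _ _ _ _) => apply: df_CapKS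
  | |- dfN _ (fun _ _ _ => XKS _ _ _ _ _ _ _) => apply: df_XKS
  | |- dfN _ (fun _ _ _ => XK _ _ _ _ _ _ _ _ _ _) => apply: df_XKS
  | |- dfB _ (fun _ _ _ => FMS _ _ _ _ _ _) => apply: df_FMS
  | _ => df_call10
  end.
Ltac df_call ::= df_call11.

Lemma df_PrKS m (kap b l c g v p : ctxT m -> env R -> dyn R -> nat) : dfN 12 kap -> dfN 12 b -> dfN 12 l -> dfN 12 c -> dfN 12 g -> dfN 12 v -> dfN 12 p ->
  @dfB R 12 m (fun e st d => PrKS st (kap e st d) (b e st d) (l e st d) (c e st d) (g e st d) (v e st d) (p e st d)).
Proof. by move=> *; rewrite /PrKS /PrK; df. Qed.

Lemma df_ChKS m (kap b l c g v w : ctxT m -> env R -> dyn R -> nat) : dfN 12 kap -> dfN 12 b -> dfN 12 l -> dfN 12 c -> dfN 12 g -> dfN 12 v -> dfN 12 w ->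
  @dfB R 12 m (fun e st d => ChKS st (kap e st d) (b e st d) (l e st d) (c e st d) (g e st d) (v e st d) (w e st d)).
Proof. by move=> *; rewrite /ChKS /ChK; df. Qed.

Lemma df_GoodKS m (kap b l c g i v : ctxT m -> env R -> dyn R -> nat) : dfN 12 kap -> dfN 12 b -> dfN 12 l -> dfN 12 c -> dfN 12 g -> dfN 12 i -> dfN 12 v ->
  @dfB R 12 m (fun e st d => GoodKS st (kap e st d) (b e st d) (l e st d) (c e st d) (g e st d) (i e st d) (v e st d)).
Proof. by move=> *; rewrite /GoodKS /GoodK; df. Qed.

Ltac df_call12 := lazymatch goal with
  | |- dfB _ (fun _ _ _ => PrKS _ _ _ _ _ _ _ _) => apply: df_PrKS
  | |- dfB _ (fun _ _ _ => ChKS _ _ _ _ _ _ _ _) => apply: df_ChKS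
  | |- dfB _ (fun _ _ _ => GoodKS _ _ _ _ _ _ _ _) => apply: df_GoodKS
  | |- dfB _ (fun _ _ _ => GoodK _ _ _ _ _ _ _ _ _ _ _) => apply: df_GoodKS
  | _ => df_call11
  end.
Ltac df_call ::= df_call12.

Lemma df_RwKS m (kap b l c g i v j : ctxT m -> env R -> dyn R -> nat) : dfN 12 kap -> dfN 12 b -> dfN 12 l -> dfN 12 c -> dfN 12 g -> dfN 12 i -> dfN 12 v -> dfN 12 j ->
  @dfB R 12 m (fun e st d => RwKS st (kap e st d) (b e st d) (l e st d) (c e st d) (g e st d) (i e st d) (v e st d) (j e st d)).
Proof. by move=> *; rewrite /RwKS /RwK; df. Qed.

Ltac df_call13 := lazymatch goal with
  | |- dfB _ (fun _ _ _ => RwKS _ _ _ _ _ _ _ _ _) => apply: df_RwKS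
  | _ => df_call12
  end.
Ltac df_call ::= df_call13.

Lemma df_cntS A m (i : ctxT m -> env R -> dyn R -> nat) : ~~ scr A -> dy 12 A ->
  dfN 12 i -> @dfN R 12 m (fun e st d => cntS st (dB d A) (i e st d)).
Proof. by move=> *; rewrite /cntS; df. Qed.

Lemma df_revS A m : ~~ scr A -> dy 12 A -> @dfR R 12 m (fun e st d => revS (ef st) st (dB d A)).
Proof.
move=> nA dA; rewrite /revS; df_step => //; df_step; last by apply: dfR_oracle; apply: df_cntS; df.
by df_step; [df_step; df_step; [apply: df_cntS; df|df]|df].
Qed.

Lemma df_objS A m (b l c : ctxT m -> env R -> dyn R -> nat) : ~~ scr A -> dy 12 A ->
  dfN 12 b -> dfN 12 l -> dfN 12 c ->
  @dfR R 12 m (fun e st d => objS (ef st) st (b e st d) (l e st d) (c e st d) (dB d A)).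
Proof.
move=> nA dA *; rewrite /objS /inCS; df_step => //; df_step; last by apply: dfR_oracle; apply: df_cntS; df.
df_step; first by df.
by df_step; [df_step; df_step; [apply: df_cntS; df|df]|df].
Qed.

Lemma df_keep A m (obj : ctxT m -> env R -> (nat -> bool) -> R) :
  ~~ scr A -> dy 12 A ->
  (forall B, ~~ scr B -> dy 12 B -> @dfR R 12 _ (fun e st d => obj e st (dB d B))) ->
  @dfC R 12 _ (fun e st d => keep st A (obj e st) d).
Proof.
move=> nA dA H; rewrite /keep; df_step; last by df.
df_step; df_step; apply: (@dfR_wk _ 12 m (fun e st d => obj e st (dB d _))); exact: H.
Qed.

Lemma df_solveA m (b l : ctxT m -> nat) :
  @dfN R 12 m (fun e _ _ => b e) -> @dfN R 12 m (fun e _ _ => l e) ->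
  @dfC R 12 _ (fun e st d => solveA (ef st) st (b e) (l e) d).
Proof.
move=> *; rewrite /solveA /solve /stepF /stepG /leafS /bestS /incS; df.
Qed.

Lemma df_solveK m (kap b l c g : ctxT m -> nat) :
  @dfN R 12 m (fun e _ _ => kap e) -> @dfN R 12 m (fun e _ _ => b e) ->
  @dfN R 12 m (fun e _ _ => l e) -> @dfN R 12 m (fun e _ _ => c e) ->
  @dfN R 12 m (fun e _ _ => g e) ->
  @dfC R 12 _ (fun e st d => solveK (ef st) st (kap e) (b e) (l e) (c e) (g e) d).
Proof.
move=> *; rewrite /solveK /solve /stepF /stepG /leafS /bestS /incS; df.
Qed.

Lemma df_objS_all m (b l c : ctxT m -> nat) B :
  @dfN R 12 m (fun e _ _ => b e) -> @dfN R 12 m (fun e _ _ => l e) ->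
  @dfN R 12 m (fun e _ _ => c e) -> ~~ scr B -> dy 12 B ->
  @dfR R 12 _ (fun e st d => objS (ef st) st (b e) (l e) (c e) (dB d B)).
Proof. by move=> *; apply: df_objS. Qed.

Lemma df_codeStep m (b l c g : ctxT m -> nat) :
  @dfN R 12 m (fun e _ _ => b e) -> @dfN R 12 m (fun e _ _ => l e) ->
  @dfN R 12 m (fun e _ _ => c e) -> @dfN R 12 m (fun e _ _ => g e) ->
  @dfC R 12 _ (fun e st d => codeStep (ef st) st (b e) (l e) (c e) (g e) d).
Proof.
move=> Hb Hl Hc Hg.
have K : @dfC R 12 _ (fun e st d => keep st 21 (objS (ef st) st (b e) (l e) (c e)) d).
  by apply: df_keep => // B *; exact: df_objS_all.
have S kap : @dfC R 12 _ (fun e st d => solveK (ef st) st kap (b e) (l e) (c e) (g e) d).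
  by apply: df_solveK => //; df.
have T : @dfC R 12 _ (fun e st d => tabB 20 (bv Bn st) (fun v _ => FMS st (b e) (l e) (c e) (g e) v) d).
  by df.
exact: (dfC_seq (dfC_seq (dfC_seq (dfC_seq (dfC_seq (S 0) K) (S 1)) K) T) K).
Qed.

Lemma df_compStep m (b l c : ctxT m -> nat) :
  @dfN R 12 m (fun e _ _ => b e) -> @dfN R 12 m (fun e _ _ => l e) ->
  @dfN R 12 m (fun e _ _ => c e) ->
  @dfC R 12 _ (fun e st d => compStep (ef st) st (b e) (l e) (c e) d).
Proof.
move=> Hb Hl Hc.
have S : @dfC R 12 _ (fun e st d => forD (bv (Bmul (Bc 64) (Bmul Bn Bn)) st)
    (fun g => codeStep (ef st) st (b e) (l e) (c e) g) d).
  by apply: dfC_for => //; apply: df_codeStep; df.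
have T1 : @dfC R 12 _ (fun (e : ctxT m) st d => tabB 21 (bv Bn st) (fun _ _ => false) d) by df.
have T2 : @dfC R 12 _ (fun e st d => tabB 22 (bv Bn st) (fun v d =>
    if topS st (b e) (l e) (c e) && connS st (b e) (l e) (c e) v then dB d 21 v else dB d 22 v) d).
  by df.
exact: (dfC_seq (dfC_seq T1 S) T2).
Qed.

Lemma df_levelStep m (b l : ctxT m -> nat) :
  @dfN R 12 m (fun e _ _ => b e) -> @dfN R 12 m (fun e _ _ => l e) ->
  @dfC R 12 _ (fun e st d => levelStep (ef st) st (b e) (l e) d).
Proof.
move=> Hb Hl.
have K : @dfC R 12 _ (fun (e : ctxT m) st d => keep st 23 (revS (ef st) st) d).
  by apply: df_keep => // B *; exact: df_revS.
have S : @dfC R 12 _ (fun e st d => forD (bv Bn st) (fun c => compStep (ef st) st (b e) (l e) c) d).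
  by apply: dfC_for => //; apply: df_compStep; df.
have T1 : @dfC R 12 _ (fun (e : ctxT m) st d => tabB 22 (bv Bn st) (fun _ _ => false) d) by df.
have T2 : @dfC R 12 _ (fun (e : ctxT m) st d => tabB 20 (bv Bn st) (fun v d => dB d 22 v) d) by df.
exact: (dfC_seq (dfC_seq (dfC_seq (dfC_seq (dfC_seq (df_solveA Hb Hl) K) T1) S) T2) K).
Qed.

Lemma df_mainS : @dfC R 12 0 (fun _ st d => mainS (ef st) st d).
Proof.
have S : @dfC R 12 0 (fun _ st d => forD (bv (Badd Bn (Bc 8)) st)
    (fun b => forD (bv Bn st) (fun l => levelStep (ef st) st b l)) d).
  by apply: dfC_for => //; apply: dfC_for => //; apply: df_levelStep; df.
have T1 : @dfC R 12 0 (fun _ st d => tabB 23 (bv Bn st) (fun _ _ => false) d) by df.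
have T2 : @dfC R 12 0 (fun _ st d => tabB 5 (bv (Bmul Bn Bn) st) (fun j d =>
    prlS st (j %/ bv Bn st) (j %% bv Bn st) && dB d 23 (j %/ bv Bn st)) d) by df.
exact: (dfC_seq (dfC_seq T1 S) T2).
Qed.

(** The parameter [lim] separates the stages: array 10 is writable here and read-only for
    [lim = 11], and array 11 follows one stage later. *)
Lemma df_bfsS : @dfC R 10 0 (fun _ st d => bfsS st d).
Proof. by rewrite /bfsS; df. Qed.

Lemma df_ancestS : @dfC R 11 0 (fun _ st d => ancestS st d).
Proof. by rewrite /ancestS; df. Qed.

End Definability2.

(** * Correctness of the dynamic program *)

Section Solve.
Variables (R : realType) (f : nat -> R) (st : memory nat).
Local Notation n := (bv Bn st).
Variables (N : nat -> bool) (Pr Ch Cap : nat -> nat -> bool) (Rw : nat -> nat -> nat -> bool).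

(** [rho] is a rank below [n] that decreases along [Pr]; it bounds the number of rounds after which
    the iterated equations are stable. *)
Record forest (rho : nat -> nat) : Prop := Forest {
  fr_lt : forall c v, Pr c v -> c < n /\ v < n;
  fr_N : forall c v, Pr c v -> N c /\ N v;
  fr_uniq : forall c v v', Pr c v -> Pr c v' -> v = v';
  fr_rho : forall c v, Pr c v -> rho v < rho c;
  fr_rhon : forall v, v < n -> rho v < n;
  fr_ch : forall v w, Ch v w <-> exists2 p, Pr v p & w = p \/ Ch p w }.

Variables (rho : nat -> nat).
Hypothesis FR : forest rho.

Lemma Ch_rho v w : Ch v w -> rho w < rho v /\ w < n.
Proof.
move Ek : (rho v) => k; elim/ltn_ind: k v Ek => k IH v Ek /(fr_ch FR)[p pv [->|cpw]].
  by rewrite -Ek (fr_rho FR pv) (fr_lt FR pv).2.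
have lt := fr_rho FR pv; rewrite Ek in lt.
by have [h1 h2] := IH _ lt p erefl cpw; split=> //; exact: ltn_trans lt.
Qed.

Definition csum (F : nat -> bool) v := sumN n (fun w => Ch v w && F w).

Lemma csum_par F v p : Pr v p -> csum F v = csum F p + F p.
Proof.
move=> pv; rewrite /csum addnC.
have -> : (F p : nat) = sumN n (fun w => (w == p) && F w).
  rewrite (@sumN_pick _ _ p) ?eqxx //; first by case: (fr_lt FR pv).
  by move=> i _ /negPf ->.
rewrite -sumND; apply: eq_sumN => w _.
have [->|ne] := eqVneq w p.
  have -> : Ch v p by apply/(fr_ch FR); exists p => //; left.
  by case cp: (Ch p p); rewrite ?addn0 //; have [] := Ch_rho cp; rewrite ltnn.
rewrite add0n; congr (nat_of_bool (_ && _)); apply/idP/idP => [/(fr_ch FR)[p' pv' H]|cpw].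
  rewrite (fr_uniq FR pv' pv) in H; case: H => // E; by rewrite E eqxx in ne.
by apply/(fr_ch FR); exists p => //; right.
Qed.

Lemma csum_root F v : (forall p, ~~ Pr v p) -> csum F v = 0.
Proof.
move=> nr; apply: sumN0 => w _; case cv: (Ch v w) => //.
by have /(fr_ch FR)[p pv _] := cv; have := nr p; rewrite pv.
Qed.

Lemma csum_le F v : csum F v <= n.
Proof.
rewrite /csum /sumN; apply: (@leq_trans (\sum_(i < n) 1)); last by rewrite sum1_card card_ord.
by apply: leq_sum => i _; case: (_ && _).
Qed.

(** * The stable tables and their optimality *)

Section Run.
Variable d : dyn R.
Let dG := forD n (fun _ => stepG f st Pr Cap Rw) d.
Let dF := solve f st N Pr Ch Cap Rw d.
Let G v j : R := dR dG 2 (v * (n + 1) + j).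
Let leaf := leafS f st Rw.

Lemma dR_stepF t (d1 : dyn R) : dR (forD t (fun _ => stepF st N Ch Cap) d1) = dR d1.
Proof. by elim: t => // t IH; rewrite forDS /= IH. Qed.

Lemma solve_frame A : A != 20 -> dB dF A = dB d A.
Proof.
move=> ne; have E1 t : dB (forD t (fun _ => stepG f st Pr Cap Rw) d) = dB d.
  by elim: t => // t IH; rewrite forDS /= IH.
have E2 t d1 : dB (forD t (fun _ => stepF st N Ch Cap) d1) A = dB d1 A.
  by elim: t => // t IH; rewrite forDS /= (negPf ne) IH.
by rewrite /dF /solve E2 E1.
Qed.

Lemma incS_ext v j (d1 d2 : dyn R) : dR d1 = dR d2 -> incS st Cap v j d1 = incS st Cap v j d2.
Proof. by move=> E; rewrite /incS E. Qed.

Local Notation inc v j := (incS st Cap v j dG).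
Local Notation best v j := (bestS st Cap v j dG).

Lemma idx_lt v j : v < n -> j <= n -> v * (n + 1) + j < bv (Bmul Bn (Badd Bn (Bc 1))) st.
Proof.
move=> vn jn; have -> : bv (Bmul Bn (Badd Bn (Bc 1))) st = n * (n + 1) by [].
by apply: (@leq_trans (v.+1 * (n + 1))); [rewrite mulSn; lia|rewrite leq_mul].
Qed.

Lemma idx_div v j : j <= n -> (v * (n + 1) + j) %/ (n + 1) = v.
Proof. by move=> jn; rewrite divnMDl ?addn1 // divn_small ?addn0. Qed.

Lemma idx_mod v j : j <= n -> (v * (n + 1) + j) %% (n + 1) = j.
Proof. by move=> jn; rewrite modnMDl modn_small ?addn1. Qed.

Lemma G_fix v j : v < n -> j <= n ->
  G v j = (leaf v j + \sum_(c < n) (Pr c v)%:R * best c j)%R.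
Proof.
move=> vn jn; pose D t := forD t (fun _ => stepG f st Pr Cap Rw) d.
have DS t w i : w < n -> i <= n -> dR (D t.+1) 2 (w * (n + 1) + i) =
    (leaf w i + \sum_(c < n) (Pr c w)%:R * bestS st Cap c i (D t))%R.
  move=> wn lin; rewrite /D forDS /= idx_lt // idx_div // idx_mod //.
(* Values flow from large ranks to small ones: after [t] rounds the entries of rank at least [n - t]
   are final. *)
have stab t : forall w i, w < n -> i <= n -> n <= rho w + t ->
    dR (D t.+1) 2 (w * (n + 1) + i) = dR (D t) 2 (w * (n + 1) + i).
  elim: t => [|t IH] w i wn lin le; first by have := fr_rhon FR wn; lia.
  rewrite (DS t.+1) // (DS t) //; congr (_ + _)%R; apply: eq_bigr => c _.
  case pc: (Pr c w); last by rewrite !mul0r.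
  have lt := fr_rho FR pc; have le' : n <= rho c + t by lia.
  have cn := ltn_ord c.
  rewrite /bestS /incS; case: (ltnP i n) => lt'; rewrite ?andbF ?andFb /=.
    by rewrite !IH.
  by rewrite !mul0r !add0r !mul1r IH.
rewrite /G -[dG]/(D n) -(stab n) //; last exact: leq_addl.
exact: DS.
Qed.

Let F := dB dF 20.

Lemma F_fix v : v < n -> F v = N v && inc v (csum F v).
Proof.
move=> vn; pose D t := forD t (fun _ => stepF st N Ch Cap) dG.
have DS t w : w < n -> dB (D t.+1) 20 w = N w && inc w (csum (dB (D t) 20) w).
  move=> wn; rewrite /D forDS /= wn; congr (_ && _); apply: incS_ext; exact: dR_stepF.
(* Decisions flow the other way: after [t] rounds those of rank below [t] are final. *)
have stab t : forall w, w < n -> rho w < t -> dB (D t.+1) 20 w = dB (D t) 20 w.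
  elim: t => [|t IH] w wn le //.
  rewrite (DS t.+1) // (DS t) //; congr (_ && incS _ _ _ _ _); apply: eq_sumN => y _.
  case cy: (Ch w y) => //=; have [lt yn] := Ch_rho cy; rewrite IH //; lia.
have E : F = dB (D n) 20 by [].
rewrite E -DS // stab //; exact: (fr_rhon FR).
Qed.

Definition hgt v := csum F v + F v.

Lemma F_N v : v < n -> F v -> N v.
Proof. by move=> vn; rewrite F_fix // => /andP[]. Qed.

Lemma F_Cap v : v < n -> F v -> Cap v (hgt v).
Proof.
move=> vn Fv; move: (Fv); rewrite F_fix // => /andP[_ /and3P[C _ _]].
have -> : hgt v = (csum F v).+1 by rewrite /hgt Fv addn1.
exact: C.
 Qed.

Definition nopar v := [forall p : 'I_n, ~~ Pr v p].

Lemma noparP v : reflect (forall p, ~~ Pr v p) (nopar v).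
Proof.
apply: (iffP forallP) => H p; last exact: H.
by apply/negP => pv; have := H (Ordinal (fr_lt FR pv).2); rewrite /= pv.
Qed.

(* [gp v] is the height of the parent of [v]; every solution telescopes to its
   value at the roots. *)
Lemma telescope (g gp : nat -> nat) : (forall v, g v <= n) ->
  (forall v p, Pr v p -> gp v = g p) ->
  (\sum_(v < n | N v) leaf v (g v) =
   \sum_(v < n | N v) (G v (g v) - (~~ nopar v)%:R * best v (gp v)))%R.
Proof.
move=> gn Hgp; rewrite big_split /= sumrN.
under [X in (X - _)%R]eq_bigr => v _ do rewrite G_fix //.
rewrite big_split /= -addrA; apply/esym/eqP; rewrite -subr_eq0 addrAC subrr add0r subr_eq0.
apply/eqP; rewrite exchange_big /= [RHS]big_mkcond /=; apply: eq_bigr => c _.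
case: (noparP c) => [np|hp] /=.
  rewrite big1 => [|v _]; first by rewrite mul0r; case: ifP.
  by rewrite (negPf (np v)) mul0r.
have [p pc] : exists p, Pr c p.
  by apply: contrapT => H; apply: hp => p; apply/negP => pc; apply: H; exists p.
have [cn pn] := fr_lt FR pc; have [Nc Np] := fr_N FR pc.
rewrite Nc (bigD1 (Ordinal pn)) //= pc !mul1r (Hgp _ _ pc) big1 ?addr0 // => v /andP[_ ne].
case pc': (Pr c v); last by rewrite mul0r.
by case/eqP: ne; apply: val_inj; exact: (fr_uniq FR pc' pc).
Qed.

Lemma G_best v gp g : v < n -> g <= n -> g = gp \/ g = gp.+1 /\ Cap v g ->
  (G v g <= best v gp)%R.
Proof.
move=> vn gn H; rewrite /bestS -/(G v gp) -/(G v gp.+1).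
case: (boolP (inc v gp)) => [i|ni] /=; rewrite !(mul0r, mul1r, add0r, addr0).
  by case: H => [->|[-> _] //]; case/and3P: i.
case: H => [->//|[E C]]; move: ni; rewrite /incS -E C /= -/(G v gp) E.
have -> /= : gp < n by rewrite -E.
by rewrite -ltNge => /ltW.
Qed.

Lemma hgt_best v : v < n -> N v -> G v (hgt v) = best v (csum F v).
Proof.
move=> vn Nv; rewrite /hgt F_fix // Nv /= /bestS.
case: (inc v (csum F v)).
  have -> : csum F v + true = (csum F v).+1 by rewrite addn1.
  by rewrite mul1r mul0r addr0.
by rewrite mul0r mul1r add0r /G addn0.
Qed.

Lemma hgt_le v : v < n -> hgt v <= n.
Proof.
move=> vn; rewrite /hgt; case Fv: (F v); last by rewrite addn0 csum_le.
by move: (Fv); rewrite F_fix // => /andP[_ /and3P[_ lt _]]; rewrite addn1.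
Qed.

(** The comparison set [F'] may violate the capacities; its heights are cut at [X] instead. Since
    [X] is constant along [Pr], cut heights still stay or rise by one at each node, which is all
    that the table recursion sees. Both sides then telescope and are compared term by term. *)
Lemma solve_opt (X : nat -> nat) (F' : nat -> bool) :
  (forall v p, Pr v p -> X v = X p) ->
  (forall v j, v < n -> N v -> j <= X v -> Cap v j) ->
  (\sum_(v < n | N v) leaf v (minn (X v) (csum F' v + F' v)) <=
   \sum_(v < n | N v) leaf v (hgt v))%R.
Proof.
move=> HX HC; pose g v := if v < n then minn n (minn (X v) (csum F' v + F' v)) else 0.
pose gp v := minn (X v) (csum F' v).
have gE v : v < n -> N v -> g v = gp v \/ g v = (gp v).+1 /\ Cap v (g v).
  move=> vn Nv; rewrite /g vn /gp.
  have le1 := csum_le F' v.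
  case: (F' v); last by left; rewrite addn0; lia.
  case: (leqP (X v) (csum F' v)) => le; first by left; lia.
  case: (leqP n (csum F' v)) => le2; first by left; lia.
  right; split; first by lia.
  by apply: HC => //; lia.
have g_le v : g v <= n by rewrite /g; case: ifP => // _; lia.
have gpE v p : Pr v p -> gp v = g p.
  move=> pv; have [vn pn] := fr_lt FR pv.
  rewrite /g pn /gp (HX _ _ pv) (csum_par _ pv).
  by have := csum_le F' v; rewrite (csum_par _ pv); lia.
have E1 : (\sum_(v < n | N v) leaf v (minn (X v) (csum F' v + F' v)) =
    \sum_(v < n | N v) leaf v (g v))%R.
  apply: eq_bigr => v Nv; congr leaf; rewrite /g ltn_ord.
  (* a chain together with its bottom node has at most [n] elements *)
  suff : csum F' v + F' v <= n by lia.
  case Fv: (F' v); last by rewrite addn0 csum_le.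
  have : csum F' v < n.
    rewrite /csum /sumN; apply: (@leq_ltn_trans (\sum_(i < n) (i != v))).
      apply: leq_sum => i _; case cv: (Ch v i) => //=; case: (F' i) => //.
      by rewrite lt0b; apply/eqP => E; have := Ch_rho cv; rewrite E ltnn => -[].
    have -> : \sum_(i < n) (i != v) = #|predC1 v|.
      by rewrite -sum1_card [RHS]big_mkcond /=; apply: eq_bigr => i _; rewrite inE; case: eqP.
    by rewrite cardC1 card_ord; have := ltn_ord v; lia.
  by rewrite /= addn1.
rewrite E1 (telescope g_le gpE).
pose h v := if v < n then hgt v else 0.
have h_le v : h v <= n by rewrite /h; case: ifP => // vn; exact: hgt_le.
have hpE v p : Pr v p -> csum F v = h p.
  by move=> pv; have [vn pn] := fr_lt FR pv; rewrite /h pn (csum_par _ pv).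
have E2 : (\sum_(v < n | N v) leaf v (hgt v) = \sum_(v < n | N v) leaf v (h v))%R.
  by apply: eq_bigr => v _; rewrite /h ltn_ord.
rewrite E2 (telescope h_le hpE); apply: ler_sum => v Nv.
have vn := ltn_ord v.
have -> : h v = hgt v by rewrite /h vn.
rewrite hgt_best //; case: (noparP v) => [np|hp] /=; rewrite ?mul0r ?mul1r ?subr0.
  by rewrite (csum_root _ np); have := G_best vn (g_le v) (gE v vn Nv); rewrite /gp csum_root ?minn0.
by rewrite subrr subr_le0; exact: G_best (gE v vn Nv).
Qed.

End Run.
End Solve.

(** * The search loops *)

Section Search.
Variables (R : realType) (f : nat -> R) (st : memory nat).
Hypothesis f_ge0 : forall j, (0 <= f j)%R.
Local Notation n := (bv Bn st).
Local Notation k := (bv Bk st).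

Definition revi (F : nat -> bool) i : R :=
  (((cntS st F i <= st 3 i) * st 4 i)%:R * f (cntS st F i))%R.

Lemma revi_ge0 F i : (0 <= revi F i)%R.
Proof. by apply: mulr_ge0. Qed.

Lemma revSE F : revS f st F = (\sum_(i < k) revi F i)%R. Proof. by []. Qed.

Lemma objSE b l c F : objS f st b l c F = (\sum_(i < k) (inCS st b l c i)%:R * revi F i)%R.
Proof. by apply: eq_bigr => i _; rewrite natrM -mulrA. Qed.

Lemma cntS_ext F F' i : (forall v, v < n -> inPS st i v -> F v = F' v) -> cntS st F i = cntS st F' i.
Proof. by move=> E; apply: eq_sumN => v vn; case iv: (inPS st i v) => //=; rewrite E. Qed.

Lemma revi_ext F F' i : (forall v, v < n -> inPS st i v -> F v = F' v) -> revi F i = revi F' i.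
Proof. by move=> E; rewrite /revi (cntS_ext E). Qed.

Definition ext (obj : (nat -> bool) -> R) :=
  forall F F', (forall v, v < n -> F v = F' v) -> obj F = obj F'.

Lemma ext_rev : ext (revS f st).
Proof. by move=> F F' E; rewrite !revSE; apply: eq_bigr => i _; apply: revi_ext => v vn _; exact: E. Qed.

Lemma ext_obj b l c : ext (objS f st b l c).
Proof.
by move=> F F' E; rewrite !objSE; apply: eq_bigr => i _; congr (_ * _)%R; apply: revi_ext => v vn _; exact: E.
Qed.

Lemma keepP A obj (d : dyn R) : A != 24 -> A != 20 -> ext obj ->
  [/\ (obj (dB d A) <= obj (dB (keep st A obj d) A))%R,
      (obj (dB d 20) <= obj (dB (keep st A obj d) A))%R &
      forall B, B != A -> B != 24 -> dB (keep st A obj d) B = dB d B].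
Proof.
move=> A24 A20 E; set d' := keep st A obj d.
have EA v : v < n -> dB d' A v = if (obj (dB d A) <= obj (dB d 20))%R then dB d 20 v else dB d A v.
  by move=> vn; rewrite /d' /keep /= eqxx vn (negPf A24).
case: (lerP (obj (dB d A)) (obj (dB d 20))) => [le|lt].
  have -> : obj (dB d' A) = obj (dB d 20) by apply: E => v vn; rewrite EA // le.
  by split=> // B BA B24; rewrite /d' /keep /= (negPf BA) (negPf B24).
have -> : obj (dB d' A) = obj (dB d A) by apply: E => v vn; rewrite EA // leNgt lt.
split=> //; first exact: ltW.
by move=> B BA B24; rewrite /d' /keep /= (negPf BA) (negPf B24).
Qed.

Lemma forD_inv (Q : dyn R -> Prop) N F d :
  (forall x d, x < N -> Q d -> Q (F x d)) -> Q d -> Q (forD N F d).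
Proof.
elim: N => // N IH H Qd; rewrite forDS; apply: (H) => //; apply: IH => // x d1 xN.
by apply: H; exact: ltnW.
Qed.

Lemma forD_reach (Q : dyn R -> Prop) N F d x0 : x0 < N ->
  (forall d, Q (F x0 d)) -> (forall x d, Q d -> Q (F x d)) -> Q (forD N F d).
Proof.
move=> lt H0 H; elim: N lt => // N IH; rewrite ltnS leq_eqVlt forDS => /predU1P[<-//|lt].
by apply: H; exact: IH.
Qed.

(** At most one term survives: a commodity is charged only to the vertex that serves it, or only to
    the component that contains it. *)
Lemma sum_uniq_le (I : finType) (p q : pred I) (G : I -> R) (B : R) : (0 <= B)%R ->
  (forall c, p c -> q c -> G c <= B)%R ->
  (forall c c', p c -> p c' -> q c -> q c' -> c = c') ->
  (\sum_(c | p c) (q c)%:R * G c <= B)%R.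
Proof.
move=> B0 H U; case: (boolP [exists c, p c && q c]) => [/existsP[c /andP[pc qc]]|no].
  rewrite (bigD1 c) //= qc mul1r big1 ?addr0 ?H // => c' /andP[pc' ne].
  case qc': (q c'); last by rewrite mul0r.
  by case/eqP: ne; exact: U.
rewrite big1 // => c pc; case qc: (q c); last by rewrite mul0r.
by case/negP: no; apply/existsP; exists c; rewrite pc.
Qed.

Section Level.
Variables b l : nat.
Local Notation obj c := (objS f st b l c).

Lemma solveK_frame kap c g d A : A != 20 -> dB (solveK f st kap b l c g d) A = dB d A.
Proof. exact: solve_frame. Qed.

(** The start state of each dynamic program stays existential because optimality holds from
    arbitrary table contents. *)
Lemma codeStep_spec c g d : let d' := codeStep f st b l c g d in
 [/\ (obj c (dB d 21) <= obj c (dB d' 21))%R,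
     (forall kap, (kap < 2)%N -> exists d1,
        obj c (dB (solveK f st kap b l c g d1) 20) <= obj c (dB d' 21))%R,
     (obj c (FMS st b l c g) <= obj c (dB d' 21))%R &
     forall B, 21 < B -> B != 24 -> dB d' B = dB d B].
Proof.
move=> d'; rewrite /d' /codeStep.
set d1 := solveK f st 0 b l c g d; set d2 := keep st 21 _ d1.
set d3 := solveK f st 1 b l c g d2; set d4 := keep st 21 _ d3.
set d5 := tabB 20 _ _ d4; set d6 := keep st 21 _ d5.
have E := ext_obj b l c.
have [a1 b1 f1] := @keepP 21 _ d1 isT isT E; rewrite -/d2 in a1 b1 f1.
have [a2 b2 f2] := @keepP 21 _ d3 isT isT E; rewrite -/d4 in a2 b2 f2.
have [a3 b3 f3] := @keepP 21 _ d5 isT isT E; rewrite -/d6 in a3 b3 f3.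
have e1 : dB d1 21 = dB d 21 by exact: solveK_frame.
have e3 : dB d3 21 = dB d2 21 by exact: solveK_frame.
have e5 : dB d5 21 = dB d4 21 by [].
rewrite e1 in a1; rewrite e3 in a2; rewrite e5 in a3.
have h4 := le_trans a2 a3; have h2 := le_trans a1 h4.
split; first exact: h2.
- case=> [|[|//]] _; first by exists d; exact: le_trans b1 h4.
  by exists d2; exact: le_trans b2 a3.
- apply: le_trans b3; have -> : obj c (FMS st b l c g) = obj c (dB d5 20).
    by apply: E => v vn; rewrite /d5 /= vn.
  exact: lexx.
move=> B B21 B24; have B21' : B != 21 by rewrite neq_ltn B21 orbT.
have B20 : B != 20 by rewrite neq_ltn (ltn_trans _ B21) ?orbT.
have e5' : dB d5 B = dB d4 B by rewrite /d5 /= (negPf B20).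
by rewrite (f3 _ B21' B24) e5' (f2 _ B21' B24) /d3 (solveK_frame _ _ _ _ B20) (f1 _ B21' B24) /d1 (solveK_frame _ _ _ _ B20).
Qed.

Definition FBof c d := dB (forD (bv (Bmul (Bc 64) (Bmul Bn Bn)) st)
  (fun g => codeStep f st b l c g) (tabB 21 n (fun _ _ => false) d)) 21.

Lemma FBof_spec c d g : g < 64 * (n * n) ->
  (forall kap, (kap < 2)%N -> exists d1,
     obj c (dB (solveK f st kap b l c g d1) 20) <= obj c (FBof c d))%R /\
  (obj c (FMS st b l c g) <= obj c (FBof c d))%R.
Proof.
move=> gN; rewrite /FBof; set d0 := tabB 21 _ _ d.
apply: (@forD_reach (fun d' =>
  (forall kap, (kap < 2)%N -> exists d1,
     obj c (dB (solveK f st kap b l c g d1) 20) <= obj c (dB d' 21))%R /\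
  (obj c (FMS st b l c g) <= obj c (dB d' 21))%R) _ _ _ g) => // [d1|g' d1 [h1 h2]].
  by have [] := codeStep_spec c g d1.
have [m _ _ _] := codeStep_spec c g' d1; split; last exact: le_trans m.
by move=> kap /h1[d2 le]; exists d2; exact: le_trans m.
Qed.

Lemma compStep_22 c d v : v < n -> dB (compStep f st b l c d) 22 v =
  if topS st b l c && connS st b l c v then FBof c d v else dB d 22 v.
Proof.
move=> vn; rewrite /compStep /= vn; case: ifP => // _.
set D := forD _ _ _.
have -> : dB D 22 = dB d 22.
  apply: (@forD_inv (fun d' => dB d' 22 = dB d 22)) => // g d1 _ E.
  by have [_ _ _ ->] := codeStep_spec c g d1.
by [].
Qed.

Lemma compStep_23 c d : dB (compStep f st b l c d) 23 = dB d 23.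
Proof.
rewrite /compStep /=; set D := forD _ _ _.
apply: (@forD_inv (fun d' => dB d' 23 = dB d 23)) => // g d1 _ E.
by have [_ _ _ ->] := codeStep_spec c g d1.
Qed.

Hypothesis top_uniq : forall c c' v, topS st b l c -> topS st b l c' ->
  connS st b l c v -> connS st b l c' v -> c = c'.

(** Components are disjoint, so later rounds leave alone what was written for [c]. *)
Lemma comps_22 d N c v : c < N -> v < n -> topS st b l c -> connS st b l c v ->
  dB (forD N (fun c => compStep f st b l c) d) 22 v =
  FBof c (forD c (fun c => compStep f st b l c) d) v.
Proof.
move=> cN vn tc cv; elim: N cN => // N IH; rewrite ltnS leq_eqVlt forDS compStep_22 //.
case/predU1P=> [<-|cN]; first by rewrite tc cv.
case: ifP => [/andP[tN Nv]|_]; last exact: IH.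
by move: cN; rewrite (top_uniq tc tN cv Nv) ltnn.
Qed.

Lemma levelStep_spec d : let d' := levelStep f st b l d in
  [/\ (revS f st (dB d 23) <= revS f st (dB d' 23))%R,
      exists d1, (revS f st (dB (solveA f st b l d1) 20) <= revS f st (dB d' 23))%R &
      exists FB : nat -> nat -> bool,
        (\sum_(c < n | topS st b l c) obj c (FB c) <= revS f st (dB d' 23))%R /\
        forall c g, c < n -> g < 64 * (n * n) ->
          (forall kap, (kap < 2)%N -> exists d1,
             obj c (dB (solveK f st kap b l c g d1) 20) <= obj c (FB c))%R /\
          (obj c (FMS st b l c g) <= obj c (FB c))%R].
Proof.
move=> d'; rewrite /d' /levelStep.
set d1 := solveA f st b l d; set d2 := keep st 23 _ d1.
set d3 := tabB 22 _ _ d2; set d4 := forD _ _ d3; set d5 := tabB 20 _ _ d4.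
set d6 := keep st 23 _ d5.
have [a1 b1 f1] := @keepP 23 _ d1 isT isT ext_rev; rewrite -/d2 in a1 b1 f1.
have [a2 b2 f2] := @keepP 23 _ d5 isT isT ext_rev; rewrite -/d6 in a2 b2 f2.
have e1 : dB d1 23 = dB d 23 by exact: solve_frame.
have e5 : dB d5 23 = dB d2 23.
  have e54 : dB d5 23 = dB d4 23 by [].
  have e32 : dB d3 23 = dB d2 23 by [].
  rewrite e54 -e32; apply: (@forD_inv (fun dd => dB dd 23 = dB d3 23)) => [c dd _ E|]; last by [].
  by rewrite compStep_23.
rewrite e1 in a1; rewrite e5 in a2; split.
- exact: le_trans a1 a2.
- by exists d; exact: le_trans b1 a2.
exists (fun c => FBof c (forD c (fun c => compStep f st b l c) d3)); split; last first.
  by move=> c g cn gN; exact: FBof_spec.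
apply: le_trans b2; rewrite revSE.
under eq_bigr => c tc do rewrite objSE.
rewrite exchange_big /=; apply: ler_sum => i _.
(* A commodity inside component [c] sees only vertices of [c], where the combined set agrees with
   the candidate kept for [c]. *)
have same_rev (c : 'I_n) : topS st b l c -> inCS st b l c i ->
   revi (FBof c (forD c (fun c => compStep f st b l c) d3)) i = revi (dB d5 20) i.
  move=> tc /andP[/allNP H _]; apply: revi_ext => v vn iv.
  by rewrite /d5 /= vn; apply/esym; apply: comps_22 => //; have := H v vn; rewrite iv.
apply: sum_uniq_le => [|c tc ic|c c' tc tc' ic ic']; first exact: revi_ge0.
  by rewrite (same_rev c tc ic).
case/andP: ic => /allNP H /hasNP[v vn iv]; case/andP: ic' => /allNP H' _.
have := H v vn; have := H' v vn; rewrite iv /= => h' h.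
by apply: val_inj; apply: top_uniq tc tc' h h'.
Qed.

End Level.

Definition bestF d := dB (forD (bv (Badd Bn (Bc 8)) st)
  (fun b => forD n (fun l => levelStep f st b l)) (tabB 23 n (fun _ _ => false) d)) 23.

Hypothesis top_uniq : forall b l c c' v, topS st b l c -> topS st b l c' ->
  connS st b l c v -> connS st b l c' v -> c = c'.

Lemma bestF_spec d b l : b < n + 8 -> l < n ->
  (exists d1, (revS f st (dB (solveA f st b l d1) 20) <= revS f st (bestF d))%R) /\
  exists FB : nat -> nat -> bool,
    (\sum_(c < n | topS st b l c) objS f st b l c (FB c) <= revS f st (bestF d))%R /\
    forall c g, c < n -> g < 64 * (n * n) ->
      (forall kap, (kap < 2)%N -> exists d1,
         objS f st b l c (dB (solveK f st kap b l c g d1) 20) <= objS f st b l c (FB c))%R /\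
      (objS f st b l c (FMS st b l c g) <= objS f st b l c (FB c))%R.
Proof.
move=> bn ln; rewrite /bestF.
pose Q (d' : dyn R) :=
  (exists d1, (revS f st (dB (solveA f st b l d1) 20) <= revS f st (dB d' 23))%R) /\
  exists FB : nat -> nat -> bool,
    (\sum_(c < n | topS st b l c) objS f st b l c (FB c) <= revS f st (dB d' 23))%R /\
    forall c g, c < n -> g < 64 * (n * n) ->
      (forall kap, (kap < 2)%N -> exists d1,
         objS f st b l c (dB (solveK f st kap b l c g d1) 20) <= objS f st b l c (FB c))%R /\
      (objS f st b l c (FMS st b l c g) <= objS f st b l c (FB c))%R.
have Qmono b' l' d' : Q d' -> Q (levelStep f st b' l' d').
  case=> [[d1 h1] [FB [h2 h3]]].
  have [m _ _] := levelStep_spec (@top_uniq b' l') d'.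
  split; first by exists d1; exact: le_trans m.
  by exists FB; split=> //; exact: le_trans m.
apply: (@forD_reach Q _ _ _ b) => // [d1|b' d1 Qd].
  apply: (@forD_reach Q _ _ _ l) => // [d2|l' d2]; last exact: Qmono.
  by have [_ h1 h2] := levelStep_spec (@top_uniq b l) d2.
by apply: (@forD_inv Q) => // l' d2 _; exact: Qmono.
Qed.

Lemma mainS_5 d v w : v < n -> w < n ->
  dB (mainS f st d) 5 (v * n + w) = prlS st v w && bestF d v.
Proof.
move=> vn wn; rewrite /mainS /=.
have n0 : 0 < n by exact: leq_ltn_trans vn.
have -> : v * n + w < bv (Bmul Bn Bn) st.
  apply: (@leq_trans (v.+1 * n)); first by rewrite mulSn; lia.
  by rewrite /bv -/bv leq_mul.
by rewrite divnMDl // modnMDl divn_small // modn_small // addn0.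
Qed.

End Search.

(** * What the candidates earn *)

Lemma pwE n b l : l <= n -> pw n b l = b ^ l.
Proof.
move=> ln; rewrite /pw /prodN -(big_mkord xpredT (fun x => if x < l then b else 1)).
rewrite (big_cat_nat (n := l)) //= [X in _ * X]big_nat_cond [X in _ * X]big1 ?muln1; last first.
  by move=> i /andP[/andP[li _] _]; rewrite ltnNge li.
rewrite big_nat_cond (eq_bigr (fun=> b)); last by move=> i /andP[/andP[_ ->]].
by rewrite -big_nat_cond prod_nat_const_nat subn0.
Qed.

Lemma lamE n : 0 < n -> lam n = trunc_log 2 n.
Proof.
move=> n0; have ln : trunc_log 2 n < n.
  by apply: leq_trans (ltn_expl _ (ltnSn 1)) _; exact: trunc_logP.
rewrite /lam (@eq_sumN _ _ (fun y => y < trunc_log 2 n)); last first.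
  by move=> y yn; rewrite pwE //; congr nat_of_bool; apply/idP/idP => h; [exact: trunc_log_max|apply: leq_trans (trunc_logP (ltnSn 1) n0); rewrite leq_exp2l].
rewrite /sumN -big_mkcond /= -(big_ord_widen n (fun=> 1) (ltnW ln)).
by rewrite sum1_card card_ord.
Qed.

Lemma digits_ex K (e : nat -> nat) m : 0 < K -> (forall j, e j < K) ->
  exists2 g, g < K ^ m & forall j, j < m -> (g %/ K ^ j) %% K = e j.
Proof.
move=> K0; elim: m e => [|m IH] e He; first by exists 0.
have [g gK Hg] := IH (fun j => e j.+1) (fun j => He _).
exists (g * K + e 0).
  rewrite expnS; apply: (@leq_trans (g.+1 * K)); first by rewrite mulSn addnC ltn_add2r He.
  by rewrite mulnC leq_mul.
case=> [|j] jm; first by rewrite divn1 modnMDl modn_small.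
by rewrite expnS divnMA divnMDl // [e 0 %/ K]divn_small ?He // addn0 Hg.
Qed.

(** The interface between memory and combinatorics: the memory encodes a rooted tree, and each
    commodity consists of the two vertical paths from [pa i] down to [ps i] and to [pt i]. *)
Record gst (st : memory nat) (par dep pa ps pt : nat -> nat) : Prop := GSt {
  g_tree : rtree (bv Bn st) par dep;
  g_prl : prlS st = prlM (bv Bn st) par;
  g_anc : ancS st = ancM (bv Bn st) par dep;
  g_s : forall i, i < bv Bk st -> ancM (bv Bn st) par dep (pa i) (ps i);
  g_t : forall i, i < bv Bk st -> ancM (bv Bn st) par dep (pa i) (pt i);
  g_lca : forall i v, i < bv Bk st -> ancM (bv Bn st) par dep v (ps i) ->
    ancM (bv Bn st) par dep v (pt i) -> ancM (bv Bn st) par dep v (pa i);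
  g_in : forall i v, i < bv Bk st -> v < bv Bn st ->
    inPS st i v = pathP (ancM (bv Bn st) par dep) (pa i) (ps i) (pt i) v }.

Section LowerBounds.
Variables (R : realType) (f : nat -> R).
Hypothesis f_ge0 : forall j, (0 <= f j)%R.
Hypothesis f_mono : forall i j, i <= j -> (f i <= f j)%R.
Hypothesis f_sub : forall i j, (f (i + j) <= f i + f j)%R.
Variables (st : memory nat) (par dep pa ps pt : nat -> nat).
Hypothesis GS : gst st par dep pa ps pt.
Variable Fs : nat -> bool.
Local Notation n := (bv Bn st).
Local Notation k := (bv Bk st).
Local Notation anc := (ancM n par dep).
Local Notation prl := (prlM n par).
Let T := g_tree GS.

Section Level.
Variables b l : nat.
Local Notation U := (US st b l).
Local Notation M := (MS st b l).
Local Notation coin := (coinS st).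
Local Notation cn := (conn n anc U).
Local Notation Mh := (Mh n anc prl U M).
Local Notation zr := (zr n anc prl U M).

Lemma connSE v w : connS st b l v w = cn v w.
Proof. by rewrite /connS (g_anc GS). Qed.

Lemma topSP c : reflect (U c /\ forall p, prl c p -> ~~ U p) (topS st b l c).
Proof.
rewrite /topS /top (g_prl GS); apply: (iffP andP) => -[Uc H]; split=> //.
  by move=> p pc; apply: contra H => Up; apply/hasNP; exists p; rewrite ?pc //; exact: (prl_ltr T pc).
by apply/negP => /hasNP[p _ /andP[pc Up]]; have := H p pc; rewrite Up.
Qed.

Lemma topS_uniq c c' v : topS st b l c -> topS st b l c' ->
  connS st b l c v -> connS st b l c' v -> c = c'.
Proof.
suff H x x' : topS st b l x' -> cn x v -> anc x x' -> anc x' v -> x = x'.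
  rewrite !connSE => tc tc' cv cv'.
  case/orP: (anc_total (conn_anc cv) (conn_anc cv')) => h.
    exact: (H c c') tc' cv h (conn_anc cv').
  by apply/esym; exact: (H c' c) tc cv' h (conn_anc cv).
move=> /topSP[_ tx'] xv xx' x'v; apply/eqP; apply: contraT => ne.
have x'n := anc_ltr xx'.
have pp : prl x' (par x').
  rewrite /prlM x'n eqxx lt0n -(dep_eq0 T) // -lt0n.
  by rewrite (leq_ltn_trans _ (anc_ltdep xx' ne)).
have [cx _] := conn_split T xv xx' x'v.
have [cxp _] := conn_split T cx (anc_to_par T xx' ne) (anc_par T x'n).
by have := tx' _ pp; rewrite (conn_U cxp).2.
Qed.

End Level.

Section Level.
Variables b l : nat.
Local Notation U := (US st b l).
Local Notation M := (MS st b l).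
Local Notation coin := (coinS st).
Local Notation cn := (conn n anc U).
Local Notation Mh := (Mh n anc prl U M).
Local Notation zr := (zr n anc prl U M).

Lemma topS_ex v : v < n -> U v -> exists2 c, topS st b l c & cn c v.
Proof.
move Ek : (dep v) => m; elim: m v Ek => [|m IH] v Ek vn Uv.
  exists v; last exact: conn_refl.
  apply/topSP; split=> // p pv; have := prl_dep T pv; lia.
have v0 : 0 < v by rewrite lt0n -(dep_eq0 T) // Ek.
have pv : prl v (par v) by rewrite /prlM vn v0 eqxx.
case: (boolP (U (par v))) => [Up|nUp].
  have [||c tc cp] := IH (par v) _ _ Up; first by rewrite (dep_par T) // Ek.
    exact: (rt_par T).
  by exists c => //; exact: (conn_trans T cp (conn_prl T Uv Up pv)).
exists v; last exact: conn_refl.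
by apply/topSP; split=> // p pv'; rewrite -(prlE pv').
Qed.

Lemma forestA : forest st (NAS st b l) (PrAS st b l) (ChAS st b l) dep.
Proof.
rewrite /NAS /PrAS /ChAS (g_anc GS) (g_prl GS); split.
- by move=> c v /and3P[_ _ p]; split; [exact: prl_ltl p|exact: (prl_ltr T p)].
- by move=> c v /and3P[].
- by move=> c v v' /and3P[_ _ p] /and3P[_ _ p']; rewrite -(prlE p) -(prlE p').
- by move=> c v /and3P[_ _ p]; rewrite (prl_dep T p).
- exact: rt_depn T.
- exact: ChA_step.
Qed.

Definition csA v := csum st (ChAS st b l) Fs v + Fs v.

Definition rA i : R :=
  (\sum_(v < n | NAS st b l v) (RwAS st b l i v (csA v) * st 4 i)%:R * f (csA v))%R.

Lemma rA_ge0 i : (0 <= rA i)%R.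
Proof. by apply: sumr_ge0 => v _; exact: mulr_ge0. Qed.

Lemma solveA_lb d : (\sum_(i < k) rA i <= revS f st (dB (solveA f st b l d) 20))%R.
Proof.
(* Sides carry no capacity; the cut [n.+1] lies at or above every height and changes nothing. *)
have := @solve_opt R f st (NAS st b l) (PrAS st b l) (ChAS st b l) (fun _ _ => true)
  (RwAS st b l) dep forestA d (fun=> n.+1) Fs (fun _ _ _ => erefl) (fun _ _ _ _ _ => isT).
rewrite -/(solveA f st b l d); set h := hgt _ _ _ _ _ _ _ _.
have -> : (\sum_(v < n | NAS st b l v)
    leafS f st (RwAS st b l) v (minn n.+1 (csum st (ChAS st b l) Fs v + Fs v)) = \sum_(i < k) rA i)%R.
  rewrite exchange_big /=; apply: eq_bigr => i _; apply: eq_bigr => v _.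
  have -> // : minn n.+1 (csum st (ChAS st b l) Fs v + Fs v) = csA v.
  by rewrite /csA; have := csum_le st (ChAS st b l) Fs v; case: (Fs v) => /=; lia.
move=> le; apply: le_trans le _; rewrite /leafS /sumR exchange_big /= revSE.
apply: ler_sum => i _.
under eq_bigr => v _ do rewrite natrM -mulrA.
apply: sum_uniq_le => [|v Nv|v v' _ _ r r']; first exact: revi_ge0.
  move=> r; set F := dB _ 20.
  have FN w : w < n -> F w -> NAS st b l w by move=> wn; exact: (F_N forestA).
  move: (r); rewrite /RwAS (g_anc GS) (g_prl GS) => r1.
  have E : cntS st F i = h v.
    have FN' w : w < n -> F w -> NA n anc prl U M coin w.
      by move=> wn Fw; have := FN w wn Fw; rewrite /NAS (g_anc GS) (g_prl GS).
    rewrite /cntS (RwA_count T r1 FN') /h /hgt -/(solveA f st b l d) -/F; congr (_ + _); apply: eq_sumN => w _.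
    by congr (nat_of_bool (_ && _)); rewrite /ChAS (g_anc GS) (g_prl GS).
  by rewrite /revi E; case/and3P: r1 => _ _ ->; rewrite mul1n.
move: r r'; rewrite /RwAS (g_anc GS) (g_prl GS) => r r'; apply: val_inj; exact: (RwA_uniq T r r').
Qed.

Section Code.
Variables (c g kap : nat).
Local Notation x := (xzS st b l c g).
Local Notation NKc := (NKS st b l c g).

Lemma forestK : forest st NKc (PrKS st kap b l c g) (ChKS st kap b l c g)
  (fun v => if kap == 0 then dep v else n.-1 - dep v).
Proof.
rewrite /NKS /PrKS /ChKS (g_anc GS) (g_prl GS); split.
- by move=> v p /PrK_P[/(NK_lt) vn /(NK_lt) pn _ _].
- by move=> v p /PrK_P[].
- by move=> v p p'; exact: PrK_uniq.
- by move=> v p; exact: PrK_rho.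
- move=> v vn; have := rt_depn T vn; case: ifP => _; lia.
- exact: ChK_step.
Qed.

Definition csK v := minn (xcap n par dep U M x v) (csum st (ChKS st kap b l c g) Fs v + Fs v).

(** The part of the comparison value in [solve_opt] that belongs to commodity [i], with the heights
    of [Fs] cut to the budgets. *)
Definition rK i : R :=
  (\sum_(v < n | NKc v) (RwKS st kap b l c g i v (csK v) * st 4 i)%:R * f (csK v))%R.

Lemma rK_ge0 i : (0 <= rK i)%R.
Proof. by apply: sumr_ge0 => v _; exact: mulr_ge0. Qed.

Lemma solveK_lb d :
  (\sum_(i < k) rK i <= objS f st b l c (dB (solveK f st kap b l c g d) 20))%R.
Proof.
have HX v p : PrKS st kap b l c g v p -> xcap n par dep U M x v = xcap n par dep U M x p.
  rewrite /PrKS (g_anc GS) (g_prl GS) => /PrK_P[_ _ /sameP[z h1 h2] _].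
  by rewrite (xcapE T _ h1) (xcapE T _ h2).
have HC v j : v < n -> NKc v -> j <= xcap n par dep U M x v -> CapKS st b l c g v j.
  by rewrite /NKS /CapKS (g_anc GS) (g_prl GS) => _; exact: CapK_xcap.
have := @solve_opt R f st NKc (PrKS st kap b l c g) (ChKS st kap b l c g) (CapKS st b l c g)
  (RwKS st kap b l c g) _ forestK d (xcap n par dep U M x) Fs HX HC.
rewrite -/(solveK f st kap b l c g d); set h := hgt _ _ _ _ _ _ _ _.
move=> le; apply: le_trans; last first.
  apply: (le_trans le); rewrite /leafS /sumR exchange_big /= objSE.
  apply: ler_sum => i _.
  under eq_bigr => v _ do rewrite natrM -mulrA.
  set F := dB _ 20.
  have FN w : w < n -> F w -> NKc w by move=> wn; exact: (F_N forestK).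
  have FC w : w < n -> F w -> CapKS st b l c g w (h w) by move=> wn; exact: (F_Cap forestK).
  have hE w : h w = sumN n (fun y => ChK n anc prl U M x c kap w y && F y) + F w.
    rewrite /h /hgt -/(solveK f st kap b l c g d) -/F; congr (_ + _); apply: eq_sumN => y _.
    by congr (nat_of_bool (_ && _)); rewrite /ChKS (g_anc GS) (g_prl GS).
  have {}FN w : w < n -> F w -> NK n anc prl U M x c w.
    by move=> wn Fw; have := FN w wn Fw; rewrite /NKS (g_anc GS) (g_prl GS).
  have FC' w : w < n -> F w -> CapK n anc prl U M x w
      (sumN n (fun y => ChK n anc prl U M x c kap w y && F y) + F w).
    by move=> wn Fw; rewrite -hE; have := FC w wn Fw; rewrite /CapKS (g_anc GS) (g_prl GS).
  apply: sum_uniq_le => [|v Nv|v v' _ _]; first by apply: mulr_ge0 => //; exact: revi_ge0.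
    rewrite /RwKS (g_anc GS) (g_prl GS) => /and3P[ic gd le'].
    have /andP[c1 c2] := Good_count T FN FC' gd; rewrite -hE in c1 c2.
    have iC : inCS st b l c i.
      apply/andP; split.
        by apply/allNP => w wn; move/allNP: ic => /(_ w wn); rewrite connSE.
      apply/hasNP; have /and3P[Nv' _ _] := gd; exists v => //.
      have /(NK_P)[_ [z hz _]] := Nv'.
      by rewrite (Good_in gd Nv' (zr_same hz hz)) chK_refl.
    rewrite iC mul1r /revi (leq_trans c2 le') mul1n ler_wpM2l //; exact: f_mono.
  rewrite /RwKS (g_anc GS) (g_prl GS) => /and3P[_ gd _] /and3P[_ gd' _].
  by apply: val_inj; exact: (Good_uniq T gd gd').
by rewrite /rK exchange_big /leafS /sumR.
Qed.

End Code.

(** * One commodity at the level of its path *)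

Section OnePath.
Variable i : nat.
Variables a s t : nat.
Hypothesis P : lpath n par dep U M a s t.
Hypothesis inE : forall v, v < n -> inPS st i v = pathP anc a s t v.
Hypothesis cu : cntS st Fs i <= st 3 i.

Lemma cnt_pathc : cntS st Fs i = pathc n par dep a s t Fs.
Proof. by apply: eq_sumN => v vn; rewrite inE. Qed.

Lemma rA_ge y : keyr n par dep U M s y -> coin y ->
  (forall y', keyr n par dep U M t y' -> ~~ coin y') ->
  ((st 4 i)%:R * f (side n par dep U M a Fs s) <= rA i)%R.
Proof.
move=> ky cy nt; have sn := anc_ltr (lp_s P).
have ns : ~~ hasm n anc U M s.
  by have /(keyrP T)[k1 k2 _] := ky; apply: contra k2; exact: has_up.
have [Ns css] : NA n anc prl U M coin s /\ cn s s.
  have h : [&& anc a s, anc s s & ~~ hasm n anc U M s] by rewrite (lp_s P) (anc_refl _ _ sn).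
  by have /andP[] := side_NA T P ky cy h.
have G := side_good T P nt.
have csE : csA s = side n par dep U M a Fs s.
  rewrite /csA /csum /side.
  have -> : (Fs s : nat) = sumN n (fun w => (w == s) && Fs w).
    by rewrite (@sumN_pick _ _ s) ?eqxx // => j _ /negPf ->.
  rewrite -sumND; apply: eq_sumN => w wn; case: (Fs w); last by rewrite !andbF.
  rewrite !andbT /ChAS (g_anc GS) (g_prl GS) /ChA Ns /=.
  have -> : [&& anc a w, anc w s & ~~ hasm n anc U M w] = NA n anc prl U M coin w && cn w s.
    apply/idP/idP => [h|/andP[Nw cws]]; first exact: (side_NA T P ky cy h).
    have := G w Nw; rewrite cws => /and3P[-> _ _]; rewrite (conn_anc cws).
    by case/(NA_P T): Nw.
  case: (eqVneq w s) => [->|ne] /=; first by rewrite !andbF css Ns.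
  by rewrite andbT addn0.
have Rs : RwAS st b l i s (csA s).
  rewrite /RwAS (g_anc GS) (g_prl GS); apply/and3P; split=> //.
    by apply/allNP => w wn; apply/implyP => Nw; rewrite inE // G.
  by rewrite csE; apply: leq_trans cu; rewrite cnt_pathc; exact: side_le.
rewrite /rA (bigD1 (Ordinal sn)) /=; last by rewrite /NAS (g_anc GS) (g_prl GS).
rewrite Rs mul1n csE lerDl; apply: sumr_ge0 => v _; exact: mulr_ge0.
Qed.

(** The budget that a right guess should assign to the segment; [code_ex] provides a code that does
    so. *)
Definition xv z := if coin z && (0 < segc n par dep U M Fs z)
  then 2 ^ trunc_log 2 (segc n par dep U M Fs z) else 0.

Definition midc := sumN n (fun z =>
  [&& Mh z, ~~ part n par dep U M a s t z & pathP anc a s t z] * xv z).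

Lemma xv_le z : xv z <= segc n par dep U M Fs z.
Proof. by rewrite /xv; case: ifP => // /andP[_ s0]; exact: trunc_logP. Qed.

Variables (c g : nat).
Hypothesis cca : cn c a.
Hypothesis xE : forall z, cn c z -> Mh z -> xzS st b l c g z = xv z.

Lemma path_conn w : pathP anc a s t w -> cn c w.
Proof. by case/and3P=> aw _ wst; exact: (conn_trans T cca (lp_conn T P aw wst)). Qed.

Lemma part_conn z : part n par dep U M a s t z -> cn c z /\ Mh z.
Proof.
move=> /(partP)[[w h iw] _]; split; last exact: zr_Mh h.
exact: (conn_trans T (path_conn iw) (zr_conn h)).
Qed.

Lemma f_half m p : p <= 2 * m -> (f p <= 2 * f m)%R.
Proof.
move=> le; apply: le_trans (f_mono le) _; rewrite mul2n -addnn.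
by apply: le_trans (f_sub _ _) _; rewrite mulr_natl mulr2n.
Qed.

(** The rounded budget exceeds half of the segment count, so cutting the piece to it keeps at least
    half of it and costs a factor two by [f_half]. The bound holds because the budgets elsewhere
    stay within the full segments, and these together with the piece stay within the count of the
    optimum. *)
Lemma rK_ge kap z v : kap < 2 -> part n par dep U M a s t z ->
  piece n par dep U M a s t kap z v -> 0 < piecec n par dep U M a s t Fs z ->
  coin z -> (forall z', z' != z -> part n par dep U M a s t z' -> ~~ coin z') ->
  ((st 4 i)%:R * f (piecec n par dep U M a s t Fs z) <= 2 * rK c g kap i)%R.
Proof.
move=> k2 pz pc p0 cz off; have [hv Hv _] := pc; have vn := anc_ltl (zr_anc hv).
set p := piecec n par dep U M a s t Fs z.
have ps_le : p <= segc n par dep U M Fs z.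
  by apply: leq_sumN => w _; case: (zr _ _) => //=; case: pathP.
have [ccz mz] := part_conn pz.
have xzE : xzS st b l c g z = 2 ^ trunc_log 2 (segc n par dep U M Fs z).
  by rewrite xE // /xv cz (leq_trans p0 ps_le).
have xlt : segc n par dep U M Fs z < 2 * xzS st b l c g z.
  by rewrite xzE -expnS; exact: trunc_log_ltn.
have x0 : 0 < xzS st b l c g z by rewrite xzE expn_gt0.
have off' z' : z' != z -> part n par dep U M a s t z' -> xzS st b l c g z' = 0.
  move=> ne pz'; have [cz' mz'] := part_conn pz'.
  by rewrite xE // /xv (negPf (off _ ne pz')).
have gd := Good_complete T P inE cca x0 pc off'.
have iv : pathP anc a s t v by rewrite Hv // chK_refl.
have Nv : NK n anc prl U M (xzS st b l c g) c v by case/and3P: gd.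
have csE : csK c g kap v = minn (xzS st b l c g z) p.
  rewrite /csK (xcapE T _ hv); congr minn; rewrite /csum /p /piecec.
  have -> : (Fs v : nat) = sumN n (fun w => (w == v) && Fs w).
    by rewrite (@sumN_pick _ _ v) ?eqxx // => j _ /negPf ->.
  rewrite -sumND; apply: eq_sumN => w wn; case: (Fs w); last by rewrite !andbF.
  rewrite !andbT /ChKS (g_anc GS) (g_prl GS).
  case: (eqVneq w v) => [->|ne]; first by rewrite hv iv /ChK eqxx /= !andbF.
  rewrite addn0; congr nat_of_bool; apply/(ChK_P n par dep U M (xzS st b l c g) c kap v w)/andP.
    case=> _ _ sm ch _; have hw := same_zr T sm hv.
    by rewrite hw Hv.
  case=> hw iw; split=> //; first exact: (NK_seg T Nv hv hw (path_conn iw)).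
    exact: (zr_same hv hw).
  by rewrite -Hv.
have Rv : RwKS st kap b l c g i v (csK c g kap v).
  rewrite /RwKS (g_anc GS) (g_prl GS); apply/and3P; split=> //.
    by apply/allNP => w wn; apply/implyP; rewrite inE //; exact: path_conn.
  have XX : XK n anc prl U M (xzS st b l c g) c (inPS st) i v <= fullc n par dep U M a s t Fs.
    apply: (XK_full P inE hv off') => z' cz' mz'; rewrite xE //; exact: xv_le.
  have := full_piece_le T Fs pz; have := cu; rewrite cnt_pathc.
  rewrite csE -/p; have := geq_minr (xzS st b l c g z) p; move: XX; lia.
apply: (@le_trans _ _ (2 * ((st 4 i)%:R * f (csK c g kap v)))%R).
  rewrite mulrCA ler_wpM2l // csE; apply: f_half; rewrite -/p; lia.
rewrite ler_wpM2l // /rK (bigD1 (Ordinal vn)) /=; last by rewrite /NKS (g_anc GS) (g_prl GS).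
rewrite Rv mul1n lerDl; apply: sumr_ge0 => w _; exact: mulr_ge0.
Qed.

Lemma rM_ge : hasN n (fun v => inPS st i v) ->
  (forall z, part n par dep U M a s t z -> ~~ coin z) ->
  ((st 4 i)%:R * f midc <= (inCS st b l c i)%:R * revi f st (FMS st b l c g) i)%R.
Proof.
move=> ne off.
have iC : inCS st b l c i.
  by rewrite /inCS ne andbT; apply/allNP => w wn; apply/implyP; rewrite inE // connSE; exact: path_conn.
have off' z' : part n par dep U M a s t z' -> xzS st b l c g z' = 0.
  by move=> pz'; have [cz' mz'] := part_conn pz'; rewrite xE // /xv (negPf (off _ pz')).
have xle z : cn c z -> Mh z -> xzS st b l c g z <= segc n par dep U M Fs z.
  by move=> cz mz; rewrite xE //; exact: xv_le.
have := Mid_count T P inE cca off' xle.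
rewrite (@eq_sumN _ (fun z => _ * xzS st b l c g z) (fun z =>
   [&& Mh z, ~~ part n par dep U M a s t z & pathP anc a s t z] * xv z)); last first.
  by move=> z zn; case: (boolP [&& _, _ & _]) => // /and3P[mz _ iz]; rewrite xE //; exact: path_conn.
rewrite -/midc => E; set X := midc in E *.
have cE : cntS st (FMS st b l c g) i = X.
  by rewrite -E; apply: eq_sumN => w _; rewrite /FMS (g_anc GS) (g_prl GS).
have Xu : X <= st 3 i.
  apply: leq_trans cu; rewrite cnt_pathc; apply: leq_trans (full_le T U M a s t Fs).
  by apply: leq_sumN => z _; rewrite leq_mul // xv_le.
by rewrite iC mul1r /revi cE Xu mul1n.
Qed.

End OnePath.

Hypothesis (b2 : 1 < b) (ln : l < n) (bn : b < n + 8).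
Hypothesis codes : (lam n + 2) ^ (2 * b) <= 64 * (n * n).

(** Fewer than [b] marks in a component leave fewer than [2 * b] segments. Numbered by [idx], their
    digits form a number below [(lam n + 2) ^ (2 * b)]: digit 0 stands for budget 0 and digit [d.+1]
    for [2 ^ d]. *)
Lemma code_ex c : c < n -> exists2 g, g < 64 * (n * n) &
  forall z, cn c z -> Mh z -> xzS st b l c g z = xv z.
Proof.
move=> cn'; have n0 : 0 < n by exact: leq_ltn_trans cn'.
have bpos : 0 < b by exact: ltnW.
have cnt : sumN n (fun w => cn c w * Mh w) < 2 * b.
  have le1 := Mh_count T U M cn'.
  have := marks_lt T bpos (_ : 0 < b ^ l) cn'; rewrite expn_gt0 bpos => /(_ isT) lt.
  suff E : sumN n (fun w => cn c w * M w) < b by lia.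
  apply: leq_ltn_trans lt; rewrite leq_eqVlt; apply/orP; left; apply/eqP.
  apply: eq_sumN => w _; rewrite /MS /mkS /pwS pwE 1?ltnW // (g_anc GS) (g_prl GS); congr (_ * _).
  rewrite /conn; congr (nat_of_bool (_ && _)); apply: eq_in_all => y _; congr (_ ==> _).
  by rewrite /US /mkS /pwS pwE // expnS (g_anc GS) (g_prl GS).
pose K := lam n + 2; have K0 : 0 < K by rewrite addn_gt0 orbT.
pose dl z := if coin z && (0 < segc n par dep U M Fs z)
  then (trunc_log 2 (segc n par dep U M Fs z)).+1 else 0.
have segle z := segc_le n par dep U M Fs z.
have dlK z : dl z < K.
  rewrite /dl /K lamE //; case: ifP => [_|_]; last by rewrite addn2.
  by rewrite addn2 !ltnS; exact: leq_trunc_log.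
pose ix := idx n anc prl U M c.
have ix_lt z : cn c z -> Mh z -> ix z < 2 * b.
  move=> cz mz; have zn := anc_ltr (conn_anc cz); apply: leq_trans (ltnW cnt).
  have E1 : (1 : nat) = sumN n (fun w => w == z).
    by rewrite (@sumN_pick _ _ z) ?eqxx // => j _ /negPf ->.
  rewrite /ix /idx -addn1 E1 -sumND; apply: leq_sumN => w _.
  case: (ltngtP w z) => [_|_|->] /=; rewrite ?addn0 ?cz ?mz //.
  by case: (cn c w); case: (Mh w).
have ix_mono z z' : cn c z -> Mh z -> z < z' -> ix z < ix z'.
  move=> cz mz zz'; have zn := anc_ltr (conn_anc cz).
  have E1 : (1 : nat) = sumN n (fun w => w == z).
    by rewrite (@sumN_pick _ _ z) ?eqxx // => j _ /negPf ->.
  rewrite /ix /idx -addn1 E1 -sumND; apply: leq_sumN => w _.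
  case: (ltngtP w z) => [lt|lt|->] /=; rewrite ?addn0 ?cz ?mz ?zz' //.
  by rewrite (ltn_trans lt zz').
have ix_inj z z' : cn c z -> Mh z -> cn c z' -> Mh z' -> ix z = ix z' -> z = z'.
  move=> cz mz cz' mz' E; case: (ltngtP z z') => // lt.
    by have := ix_mono _ _ cz mz lt; rewrite E ltnn.
  by have := ix_mono _ _ cz' mz' lt; rewrite E ltnn.
(* At the index of a segment the sum has a single term, already below [K]; the reduction provides
   the digit bound for all [j] uniformly. *)
pose e j := (sumN n (fun z => [&& cn c z, Mh z & ix z == j] * dl z)) %% K.
have eK j : e j < K by exact: ltn_pmod.
have eE z : cn c z -> Mh z -> e (ix z) = dl z.
  move=> cz mz; have zn := anc_ltr (conn_anc cz); rewrite /e (@sumN_pick _ _ z) //.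
    by rewrite cz mz eqxx mul1n modn_small.
  move=> z' _ ne; case: (boolP [&& _, _ & _]) => // /and3P[cz' mz' /eqP E].
  by rewrite (ix_inj _ _ cz' mz' cz mz E) eqxx in ne.
have [g gK Hg] := digits_ex (2 * b) K0 eK.
exists g; first exact: leq_trans gK codes.
move=> z cz mz; have zn := anc_ltr (conn_anc cz); rewrite /xzS (g_anc GS) (g_prl GS) /xz.
have -> : dgt n anc prl U M c g z = dl z.
  rewrite /dgt pwE ?Hg ?ix_lt ?eE //.
  rewrite /idx /sumN; apply: (@leq_trans (\sum_(j < n) 1)); last by rewrite sum1_card card_ord.
  by apply: leq_sum => j _; case: [&& _, _ & _].
rewrite /dl /xv; case: (_ && _) => //=; rewrite subn1 /= pwE //.
apply: leq_trans (leq_trunc_log 2 (segle z)) _; rewrite ltnW //.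
by apply: leq_trans (ltn_expl _ (ltnSn 1)) _; exact: trunc_logP.
Qed.

(** Everything refers to one fixed tape, against the solution kept on it. The factor 2 for [rK']
    comes from adding up the two chain directions. *)
Lemma level_bounds d : exists rA' rK' rM' : nat -> R, let y := revS f st (bestF f st d) in
  [/\ (\sum_(i < k) rA' i <= y)%R, (\sum_(i < k) rK' i <= 2 * y)%R, (\sum_(i < k) rM' i <= y)%R,
     (forall i, [/\ 0 <= rA' i, 0 <= rK' i & 0 <= rM' i])%R &
     forall i a s t, lpath n par dep U M a s t ->
       (forall v, v < n -> inPS st i v = pathP anc a s t v) ->
       cntS st Fs i <= st 3 i -> hasN n (fun v => inPS st i v) ->
     [/\ forall y, keyr n par dep U M s y -> coin y ->
           (forall y', keyr n par dep U M t y' -> ~~ coin y') ->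
           ((st 4 i)%:R * f (side n par dep U M a Fs s) <= rA' i)%R,
         forall z, part n par dep U M a s t z -> 0 < piecec n par dep U M a s t Fs z ->
           coin z -> (forall z', z' != z -> part n par dep U M a s t z' -> ~~ coin z') ->
           ((st 4 i)%:R * f (piecec n par dep U M a s t Fs z) <= 2 * rK' i)%R &
         (forall z, part n par dep U M a s t z -> ~~ coin z) ->
           ((st 4 i)%:R * f (midc a s t) <= rM' i)%R]].
Proof.
have [[d1 hA] [FB [hB hFB]]] := bestF_spec f_ge0 topS_uniq d bn ln.
have [gg Hgg] : exists gg : nat -> nat, forall c, c < n -> gg c < 64 * (n * n) /\
    forall z, cn c z -> Mh z -> xzS st b l c (gg c) z = xv z.
  have H c : exists g, c < n -> g < 64 * (n * n) /\
      forall z, cn c z -> Mh z -> xzS st b l c g z = xv z.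
    case: (ltnP c n) => [lt|]; last by exists 0.
    by have [g h1 h2] := code_ex lt; exists g.
  by have [gg] := choice H; exists gg.
pose rM c i : R := ((inCS st b l c i)%:R * revi f st (FMS st b l c (gg c)) i)%R.
have rM0 c i : (0 <= rM c i)%R by apply: mulr_ge0 => //; exact: revi_ge0.
exists rA, (fun i => \sum_(c < n | topS st b l c) (rK c (gg c) 0 i + rK c (gg c) 1 i))%R,
  (fun i => \sum_(c < n | topS st b l c) rM c i)%R => y.
have obj0 kap (c : 'I_n) : kap < 2 ->
    (\sum_(i < k) rK c (gg c) kap i <= objS f st b l c (FB c))%R.
  move=> k2; have [g1 _] := Hgg c (ltn_ord c).
  have [/(_ kap k2)[d2 h] _] := hFB c (gg c) (ltn_ord c) g1.
  by apply: le_trans h; exact: solveK_lb.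
have rK_0 (c : 'I_n) i : (0 <= rK c (gg c) 0 i + rK c (gg c) 1 i)%R by rewrite addr_ge0 ?rK_ge0.
split.
- by apply: le_trans hA; exact: solveA_lb.
- rewrite exchange_big /=; apply: le_trans (_ : 2 * \sum_(c < n | topS st b l c) objS f st b l c (FB c) <= _)%R; last first.
    by rewrite ler_pM2l.
  rewrite mulr_sumr; apply: ler_sum => c _; rewrite big_split /= mulr_natl mulr2n lerD ?obj0 //.
- rewrite exchange_big /=; apply: le_trans hB; apply: ler_sum => c _; rewrite -objSE.
  have [g1 _] := Hgg c (ltn_ord c).
  by have [_] := hFB c (gg c) (ltn_ord c) g1.
- by move=> i; split; [exact: rA_ge0|apply: sumr_ge0|apply: sumr_ge0].
move=> i a s t P inE cu ne.
have Ua : U a /\ a < n.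
  have cs := lp_conns T P; split; last exact: (anc_ltl (conn_anc cs)).
  by have [] := conn_U cs.
have [c tc cca] := topS_ex Ua.2 Ua.1.
have cn' := anc_ltl (conn_anc cca).
have [g1 xE] := Hgg c cn'.
split.
- by move=> v; exact: rA_ge.
- move=> z pz p0 cz off.
  have [_ [kap [v [k2 pc]]]] := part_cases T P pz.
  have H := rK_ge P inE cu cca xE k2 pz pc p0 cz off; apply: (le_trans H); rewrite ler_pM2l //.
  rewrite (bigD1 (Ordinal cn')) //= ler_wpDr ?sumr_ge0 //.
  by case: kap k2 {pc H} => [|[|//]] _; rewrite ?lerDl ?lerDr rK_ge0.
move=> off; apply: le_trans (rM_ge P inE cu cca xE ne off) _.
by rewrite (bigD1 (Ordinal cn')) //= ler_wpDr ?sumr_ge0.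
Qed.

End Level.
End LowerBounds.

(** * Averaging over the coins *)

Section Coins.
Variables (R : realType) (T : nat).
Local Notation O := (T.-tuple bool).
Local Notation co r z := (nth false (r : seq bool) z).

Definition xor_coins (h : pred nat) (r : O) : O := [tuple co r i (+) h i | i < T].
Arguments xor_coins : simpl never.

Lemma nth_xor h r z : z < T -> co (xor_coins h r) z = co r z (+) h z.
Proof. by move=> zT; rewrite (nth_mktuple _ _ (Ordinal zT)). Qed.

Lemma xor_coinsK h : involutive (xor_coins h).
Proof.
move=> r; apply: eq_from_tnth => i; rewrite !(tnth_nth false) nth_xor // nth_xor //.
by rewrite -addbA addbb addbF.
Qed.

Lemma sum_half (z : nat) (x : bool) (G : O -> R) : z < T ->
  (forall r, G (xor_coins (pred1 z) r) = G r) ->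
  (\sum_r G r = 2 * \sum_(r : O) (co r z == x)%:R * G r)%R.
Proof.
move=> zT inv.
have E : (\sum_(r : O) (co r z == x)%:R * G r = \sum_(r : O) (co r z != x)%:R * G r)%R.
  rewrite (reindex_inj (inv_inj (xor_coinsK (pred1 z)))); apply: eq_bigr => r _.
  by rewrite inv nth_xor //= eqxx; case: (co r z); case: x.
rewrite mulr_natl mulr2n {2}E -big_split /=; apply: eq_bigr => r _; rewrite -mulrDl.
by case: eqP; rewrite ?addr0 ?add0r mul1r.
Qed.

(** Independence of coins in counting form: if [G] ignores the coins in [Z], prescribing them
    divides the sum by 2 to the power [size Z]. *)
Lemma sum_pattern (Z : seq nat) (x : nat -> bool) (G : O -> R) :
  uniq Z -> {in Z, forall z, z < T} ->
  (forall r z, z \in Z -> G (xor_coins (pred1 z) r) = G r) ->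
  (\sum_r G r = 2 ^+ size Z * \sum_(r : O) (all (fun z => co r z == x z) Z)%:R * G r)%R.
Proof.
elim: Z => [|z Z IH] /=; first by move=> _ _ _; rewrite expr0 mul1r; under [in RHS]eq_bigr do rewrite mul1r.
case/andP=> zZ uZ ZT inv; rewrite IH //; first last.
- by move=> r y yZ; rewrite inv // inE yZ orbT.
- by move=> y yZ; rewrite ZT // inE yZ orbT.
rewrite (@sum_half z (x z)); first last.
- move=> r; rewrite inv ?mem_head //; congr ((nat_of_bool _)%:R * _)%R.
  apply: eq_in_all => y yZ; rewrite nth_xor ?ZT ?inE ?yZ ?orbT //=.
  by case: (eqVneq y z) => [E|_]; rewrite ?addbF //; rewrite -E yZ in zZ.
- by rewrite ZT ?mem_head.
rewrite mulrA -exprSr; congr (_ * _)%R; apply: eq_bigr => r _.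
by rewrite mulrA -natrM mulnb.
Qed.

(** Each tape is paired with its complement; the two counts add up to at least [m], so by
    subadditivity [f] averages at least half of [f m]. *)
Lemma sum_compl (f : nat -> R) (S : O -> nat) m :
  (forall i j, i <= j -> (f i <= f j)%R) -> (forall i j, (f (i + j)%N <= f i + f j)%R) ->
  (forall r, m <= S r + S (xor_coins xpredT r)) ->
  (2 ^+ T * f m <= 2 * \sum_r f (S r))%R.
Proof.
move=> f_mono f_sub H; rewrite [X in (_ <= X)%R](mulr_natl _ 2) [X in (_ <= X)%R]mulr2n.
rewrite [X in (_ <= X + _)%R](reindex_inj (inv_inj (xor_coinsK xpredT))) -big_split /=.
apply: (@le_trans _ _ (\sum_(r : O) f m)%R).
  by rewrite sumr_const card_tuple card_bool -natrX mulr_natl.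
apply: ler_sum => r _; rewrite addrC; apply: le_trans (f_sub _ _); exact: f_mono.
Qed.

Lemma sum_pattern_le (Z : seq nat) (x : nat -> bool) (G h : O -> R) m :
  uniq Z -> {in Z, forall z, z < T} -> size Z <= m ->
  (forall r z, z \in Z -> G (xor_coins (pred1 z) r) = G r) ->
  (forall r, 0 <= h r)%R ->
  (forall r : O, all (fun z => co r z == x z) Z -> (G r <= h r)%R) ->
  (\sum_r G r <= 2 ^+ m * \sum_r h r)%R.
Proof.
move=> uZ ZT Zm inv h0 H; rewrite (sum_pattern x uZ ZT inv).
apply: (@le_trans _ _ (2 ^+ size Z * \sum_r h r)%R).
  rewrite ler_wpM2l ?exprn_ge0 //; apply: ler_sum => r _.
  by case: (boolP (all _ _)) => [/H|_]; rewrite ?mul1r ?mul0r.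
by rewrite ler_wpM2r ?sumr_ge0 // -!natrX ler_nat leq_exp2l.
Qed.

End Coins.

Lemma sumN_size n (p : pred nat) : sumN n p = size [seq z <- iota 0 n | p z].
Proof.
rewrite -sum1_size big_filter big_mkcond /= -[n in iota 0 n]subn0 big_mkord.
by apply: eq_bigr => i _; case: (p i).
Qed.

(** * Expected revenue of one commodity *)

Section OneCommodity.
Variables (R : realType) (f : nat -> R).
Hypothesis f_mono : forall i j, i <= j -> (f i <= f j)%R.
Hypothesis f_sub : forall i j, (f (i + j)%N <= f i + f j)%R.

Lemma f_add m x : (f (m + x)%N <= f m + (0 < x)%:R * f x)%R.
Proof. by case: x => [|x]; rewrite ?addn0 ?mul0r ?addr0 // mul1r. Qed.

Lemma f_add_sum m (Z : seq nat) (g : nat -> nat) :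
  (f (m + \sum_(z <- Z) g z)%N <= f m + \sum_(z <- Z) (0 < g z)%:R * f (g z))%R.
Proof.
elim: Z => [|z Z IH]; first by rewrite !big_nil addn0 addr0.
rewrite !big_cons addnCA addnC; apply: le_trans (f_add _ _) _.
by rewrite [X in (_ <= X)%R]addrCA [X in (_ <= X)%R]addrC lerD2r.
Qed.

Variables (n : nat) (par dep : nat -> nat) (Tr : rtree n par dep) (U M : pred nat).
Variables (a s t : nat) (P : lpath n par dep U M a s t) (Fs : nat -> bool) (w : R).
Hypothesis w_ge0 : (0 <= w)%R.
Variables (T : nat) (nT : n <= T) (rA rK rM : T.-tuple bool -> R).
Hypothesis r_ge0 : forall r, [/\ 0 <= rA r, 0 <= rK r & 0 <= rM r]%R.
Local Notation anc := (ancM n par dep).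
Local Notation prl := (prlM n par).
Local Notation co r z := (nth false (r : seq bool) z).
Local Notation part := (part n par dep U M a s t).
Local Notation piecec := (piecec n par dep U M a s t Fs).
Local Notation side := (side n par dep U M a Fs).
Local Notation key := (keyr n par dep U M).

Definition mids (x : nat -> bool) := sumN n (fun z =>
  [&& Mh n anc prl U M z, ~~ part z & pathP anc a s t z] *
  if x z && (0 < segc n par dep U M Fs z) then 2 ^ trunc_log 2 (segc n par dep U M Fs z) else 0).

(** The factor [2 ^+ 2] pays for two prescribed coins: 1 for the hanging subtree of [x], 0 for that
    of [x']. If [x'] has no hanging subtree, one coin suffices. *)
Lemma side_avg (x x' : nat) (rB : T.-tuple bool -> R) : (x, x') = (s, t) \/ (x, x') = (t, s) ->
  (forall r, 0 <= rB r)%R ->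
  (forall (r : T.-tuple bool) (y : nat), key x y -> co r y -> (forall y', key x' y' -> ~~ co r y') ->
     (w * f (side x) <= rB r)%R) ->
  (2 ^+ T * (w * ((0 < side x)%:R * f (side x))) <= 2 ^+ 2 * \sum_r rB r)%R.
Proof.
move=> xx' rB0 H; case: (boolP (0 < side x)) => [s0|_]; last first.
  by rewrite mul0r !mulr0 mulr_ge0 ?sumr_ge0.
rewrite mul1r.
have cax : conn n anc U a x /\ conn n anc U a x'.
  by case: xx' => -[-> ->]; split; first [exact: (lp_conns Tr P)|exact: (lp_connt Tr P)].
have nx : ~~ hasm n anc U M x.
  apply: contraL s0 => hx; rewrite -leqNgt leqn0 /side; apply/eqP; apply: sumN0 => v vn.
  case: (boolP [&& _, _, _ & _]) => // /and4P[av vx nv _].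
  by case/negP: nv; apply: has_up Tr _ _ _ _ _ hx; have [] := conn_split Tr cax.1 av vx.
have [y ky] := key_ex Tr cax.1 (lp_has Tr P) nx.
have yT : y < T by apply: leq_trans nT; case/(keyrP Tr): ky => /conn_anc/anc_ltl.
(* If both ends hung in the same subtree, its root would lie above the top [a], which belongs to the
   skeleton. *)
have nkk : ~ key x' y.
  case/(keyrP Tr)=> c' ny _; have /(keyrP Tr)[c _ _] := ky.
  have ya : anc y a by apply: (lp_lca P); case: xx' c c' => -[-> ->] c c'; first [exact: (conn_anc c)|exact: (conn_anc c')].
  by case/negP: ny; apply: has_up Tr _ _ _ _ _ (lp_has Tr P); have [] := conn_split Tr c ya (conn_anc cax.1).
have -> : (2 ^+ T * (w * f (side x)) = \sum_(r : T.-tuple bool) w * f (side x))%R.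
  by rewrite sumr_const card_tuple card_bool -natrX mulr_natl.
case: (boolP (hasN n (key x'))) => [/hasNP[y' y'n ky']|no].
  apply: (@sum_pattern_le _ _ [:: y; y'] (pred1 y)) => //=.
  - by rewrite inE andbT; apply: contra_notN nkk => /eqP ->.
  - by move=> z; rewrite !inE => /orP[]/eqP-> //; exact: leq_trans nT.
  move=> r /and3P[/eqP c1 /eqP c2 _]; apply: H ky _ _; first by rewrite c1 eqxx.
  move=> y2 /(key_uniq Tr ky') <-; rewrite c2.
  by apply/negP => /eqP E; rewrite E in ky'.
apply: (@sum_pattern_le _ _ [:: y] (pred1 y)) => //=.
- by move=> z; rewrite inE => /eqP ->.
move=> r /andP[/eqP c1 _]; apply: H ky _ _; first by rewrite c1 eqxx.
move=> y2 k2; case/negP: no; apply/hasNP; exists y2 => //.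
by case/(keyrP Tr): k2 => /conn_anc/anc_ltl.
Qed.

Hypothesis hA : forall (r : T.-tuple bool) (y : nat), key s y -> co r y -> (forall y', key t y' -> ~~ co r y') ->
  (w * f (side s) <= rA r)%R.
Hypothesis hA' : forall (r : T.-tuple bool) (y : nat), key t y -> co r y -> (forall y', key s y' -> ~~ co r y') ->
  (w * f (side t) <= rA r)%R.
Hypothesis hK : forall (r : T.-tuple bool) (z : nat), part z -> 0 < piecec z -> co r z ->
  (forall z', z' != z -> part z' -> ~~ co r z') -> (w * f (piecec z) <= 2 * rK r)%R.
Hypothesis hM : forall r : T.-tuple bool, (forall z, part z -> ~~ co r z) ->
  (w * f (mids (nth false r)) <= rM r)%R.

Let Z := [seq z <- iota 0 n | part z].

Lemma part_lt z : part z -> z < n.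
Proof. by case/partP=> -[v /zr_anc/anc_ltr]. Qed.

Lemma memZ z : (z \in Z) = part z.
Proof.
rewrite mem_filter mem_iota add0n leq0n andTb; apply: andb_idr; exact: part_lt.
Qed.

Lemma Z_lt : {in Z, forall z, z < T}.
Proof. by move=> z; rewrite memZ => /part_lt zn; exact: leq_trans nT. Qed.

Lemma size_Z : size Z <= 3.
Proof. by rewrite -sumN_size; exact: part_le3. Qed.

(** The 16 is [2 ^ 3] for the coins of at most three partial segments, times 2 for rounding the
    budget. *)
Lemma piece_avg z : part z ->
  (2 ^+ T * (w * ((0 < piecec z)%:R * f (piecec z))) <= 16 * \sum_r rK r)%R.
Proof.
move=> pz; have K0 : (0 <= \sum_r rK r)%R by apply: sumr_ge0 => r _; have [] := r_ge0 r.
case: (boolP (0 < piecec z)) => [s0|_]; last by rewrite mul0r !mulr0 mulr_ge0.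
rewrite mul1r.
have -> : (2 ^+ T * (w * f (piecec z)) = \sum_(r : T.-tuple bool) w * f (piecec z))%R.
  by rewrite sumr_const card_tuple card_bool -natrX mulr_natl.
have -> : (16 * \sum_r rK r = 2 ^+ 3 * \sum_r 2 * rK r)%R.
  by rewrite -mulr_sumr mulrA -natrX -natrM.
apply: (@sum_pattern_le _ _ Z (pred1 z)) => //.
- by rewrite filter_uniq ?iota_uniq.
- exact: Z_lt.
- exact: size_Z.
- by move=> r; rewrite mulr_ge0 //; have [] := r_ge0 r.
move=> r /allP al; apply: (hK pz s0).
  by rewrite (eqP (al z _)) ?memZ //= eqxx.
by move=> z' ne pz'; rewrite (eqP (al z' _)) ?memZ.
Qed.

(** The 32 is [2 ^ 3] for coin 0 on the partial segments, times 2 because only full segments with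
    coin 1 have a budget, times 2 for rounding. The coins of the full segments are distinct from
    those prescribed. *)
Lemma mid_avg : (2 ^+ T * (w * f (fullc n par dep U M a s t Fs)) <= 32 * \sum_r rM r)%R.
Proof.
have H1 : (\sum_(r : T.-tuple bool) w * f (mids (nth false r)) <= 2 ^+ 3 * \sum_r rM r)%R.
  apply: (@sum_pattern_le _ _ Z pred0) => //.
  - by rewrite filter_uniq ?iota_uniq.
  - exact: Z_lt.
  - exact: size_Z.
  - move=> r z; rewrite memZ => pz; congr (_ * f _)%R; apply: eq_sumN => y yn.
    case: (boolP [&& _, _ & _]) => // /and3P[_ npy _]; congr (_ * _); rewrite nth_xor ?(leq_trans yn nT) //=.
    by case: (eqVneq y z) => [E|_]; rewrite ?addbF //; rewrite E pz in npy.
  - by move=> r; have [] := r_ge0 r.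
  move=> r /allP al; apply: hM => z pz; by rewrite (eqP (al z _)) ?memZ.
have H2 : (2 ^+ T * f (mids xpredT) <= 2 * \sum_(r : T.-tuple bool) f (mids (nth false r)))%R.
  apply: sum_compl => // r; rewrite /mids -sumND; apply: leq_sumN => z zn.
  rewrite nth_xor ?(leq_trans zn nT) // addbT -mulnDr leq_mul2l; apply/orP; right.
  by case: (co r z) => /=; rewrite ?addn0.
have H3 : (f (fullc n par dep U M a s t Fs) <= 2 * f (mids xpredT))%R.
  apply: (@le_trans _ _ (f (mids xpredT + mids xpredT)%N)); last first.
    by apply: le_trans (f_sub _ _) _; rewrite mulr_natl mulr2n.
  apply: f_mono; rewrite /fullc /mids -sumND; apply: leq_sumN => z zn.
  rewrite -mulnDr leq_mul2l; apply/orP; right; rewrite andTb addnn -mul2n.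
  case: ltnP => [s0|]; last by rewrite leqn0 => /eqP ->.
  by rewrite -expnS ltnW // trunc_log_ltn.
rewrite -mulr_sumr in H1.
apply: (@le_trans _ _ (4 * (w * \sum_(r : T.-tuple bool) f (mids (nth false r))))%R).
  rewrite mulrCA [X in (_ <= X)%R]mulrCA ler_wpM2l //.
  apply: (@le_trans _ _ (2 ^+ T * (2 * f (mids xpredT)))%R).
    by rewrite ler_pM2l ?exprn_gt0.
  have -> : (4 = 2 * 2 :> R)%R by rewrite -natrM.
  by rewrite mulrCA -mulrA ler_pM2l.
rewrite (_ : 32 = 4 * 2 ^+ 3)%R; last by rewrite -natrX -natrM.
by rewrite -mulrA ler_pM2l.
Qed.

(** Subadditivity splits the path: 48 collects [piece_avg] over at most three pieces, 8 collects
    [side_avg] over the two ends. *)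
Lemma commodity_avg : (2 ^+ T * (w * f (pathc n par dep a s t Fs)) <=
  32 * \sum_r rM r + 48 * \sum_r rK r + 8 * \sum_r rA r)%R.
Proof.
set fu := fullc n par dep U M a s t Fs.
have le1 : (f (pathc n par dep a s t Fs) <= f fu + (0 < side s)%:R * f (side s) +
    (0 < side t)%:R * f (side t) + \sum_(z <- Z) (0 < piecec z)%:R * f (piecec z))%R.
  have := pathc_le Tr U M a s t Fs; rewrite -/fu.
  have -> : sumN n (fun z => part z * piecec z) = \sum_(z <- Z) piecec z.
    rewrite big_filter big_mkcond /= -[n in iota 0 n]subn0 big_mkord.
    by apply: eq_bigr => i _; case: (part i); rewrite ?mul1n.
  rewrite !addnA => /f_mono le; apply: (le_trans le).
  apply: le_trans (f_add_sum _ _ _) _; rewrite lerD2r.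
  apply: le_trans (f_add _ _) _; rewrite lerD2r; exact: f_add.
have A0 r : (0 <= rA r)%R by have [] := r_ge0 r.
have S1 := @side_avg s t rA (or_introl erefl) A0 hA.
have S2 := @side_avg t s rA (or_intror erefl) A0 hA'.
have S3 := mid_avg.
have S4 : (2 ^+ T * (w * \sum_(z <- Z) (0 < piecec z)%:R * f (piecec z)) <= 48 * \sum_r rK r)%R.
  rewrite [(w * _)%R]mulr_sumr [(2 ^+ T * _)%R]mulr_sumr big_seq_cond.
  apply: (@le_trans _ _ (\sum_(z <- Z | (z \in Z) && true) (16 * \sum_r rK r))%R).
    by apply: ler_sum => z /andP[zZ _]; apply: piece_avg; rewrite -memZ.
  rewrite -big_seq_cond big_const_seq iter_addr_0 count_predT -[X in (X <= _)%R]mulr_natl mulrA.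
  rewrite -natrM ler_wpM2r ?sumr_ge0 //; last by rewrite ler_nat (leq_mul size_Z (leqnn 16)).
  by move=> r _; have [] := r_ge0 r.
have W : (0 <= 2 ^+ T * w)%R by rewrite mulr_ge0 ?exprn_ge0.
rewrite mulrA; apply: le_trans (ler_wpM2l W le1) _; rewrite !mulrDr -!mulrA.
rewrite (_ : 8 = 2 ^+ 2 + 2 ^+ 2)%R ?mulrDl; last by rewrite -natrX -natrD.
lra.
Qed.

End OneCommodity.

Definition with_coins (st : memory nat) (x : nat -> bool) : memory nat :=
  fun A j => if A == 8 then x j : nat else st A j.

Lemma last_true (Q : pred nat) L : Q 0 -> ~~ Q L.+1 -> exists2 l, l <= L & Q l && ~~ Q l.+1.
Proof.
elim: L => [|L IH] Q0 QL; first by exists 0; rewrite ?Q0.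
case: (boolP (Q L.+1)) => [q|/(IH Q0)[l lL Ql]]; first by exists L.+1; rewrite ?q.
by exists l => //; exact: leqW.
Qed.

(** * Summation over commodities and levels *)

Section Average.
Variables (R : realType) (f : nat -> R).
Hypothesis f_ge0 : forall j, (0 <= f j)%R.
Hypothesis f_mono : forall i j, i <= j -> (f i <= f j)%R.
Hypothesis f_sub : forall i j, (f (i + j)%N <= f i + f j)%R.
Variables (st : memory nat) (par dep pa ps pt : nat -> nat).
Hypothesis GS : gst st par dep pa ps pt.
Variable Fs : nat -> bool.
Local Notation n := (bv Bn st).
Local Notation k := (bv Bk st).
Local Notation anc := (ancM n par dep).
Local Notation prl := (prlM n par).
Let Tr := g_tree GS.
Variables (T : nat) (nT : n <= T) (dd : T.-tuple bool -> dyn R).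
Let cs (r : T.-tuple bool) := with_coins st (fun j => (j < n) && nth false r j).
Let best r := bestF f (cs r) (dd r).
Variable b : nat.
Hypothesis (b2 : 1 < b) (bn : b < n + 8).
Hypothesis codes : (lam n + 2) ^ (2 * b) <= 64 * (n * n).
Local Notation L := (trunc_log b n).

Lemma L_lt : 0 < n -> L < n.
Proof.
move=> n0; have := trunc_logP b2 n0; apply: leq_trans.
exact: ltn_expl.
Qed.

(** At [l = 0] every vertex is marked, at [l = L.+1] none because [b ^ L.+1] exceeds [n]; the last
    level at which the path meets a mark is the one wanted. *)
Lemma path_level i : i < k -> exists2 l, l <= L &
  lpath n par dep (US st b l) (MS st b l) (pa i) (ps i) (pt i).
Proof.
move=> ik; have as_ := g_s GS ik; have at_ := g_t GS ik.
have an := anc_ltl as_; have n0 : 0 < n by exact: leq_ltn_trans an.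
pose on v := anc (pa i) v && (anc v (ps i) || anc v (pt i)).
pose Q l := hasN n (fun v => on v && mk n anc prl (b ^ l) v).
have [||l lL /andP[/hasNP[m mn /andP[/andP[om1 om2] mm]] nQ]] := @last_true Q L.
- apply/hasNP; exists (pa i) => //; rewrite expn0 (mk1 Tr) // andbT /on as_ andbT; exact: anc_refl.
- apply/negP => /hasNP[v _ /andP[_]]; rewrite mk_large //; exact: trunc_log_ltn.
have ln : l < n := leq_ltn_trans lL (L_lt n0).
exists l => //; split=> //.
- by move=> v; exact: (g_lca GS ik).
- move=> v av vst; rewrite /US /mkS /pwS pwE // (g_anc GS) (g_prl GS).
  apply/negP => mv; case/negP: nQ; apply/hasNP; exists v; first exact: (anc_ltr av).
  by rewrite /on av vst.
by exists m; split=> //; rewrite /MS /mkS /pwS pwE ?(ltnW ln) // (g_anc GS) (g_prl GS).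
Qed.

(** Each of the [L.+1] levels costs [136 = 32 + 2 * 48 + 8], the [rK] shares being bounded by twice
    the kept revenue. One more unit covers the commodities with empty path, which earn the same
    under every set. *)
Lemma average_bound : (2 ^+ T * revS f st Fs <=
  (136 * L.+2)%:R * \sum_r revS f (cs r) (best r))%R.
Proof.
case: (posnP n) => [n0|n0].
  rewrite revSE big1 ?mulr0; first by apply: mulr_ge0 => //; apply: sumr_ge0 => r _; apply: sumr_ge0 => i _; exact: mulr_ge0.
  by move=> i _; have := anc_ltl (g_s GS (ltn_ord i)); rewrite n0.
have ex l r : exists rr : (nat -> R) * (nat -> R) * (nat -> R), l <= L ->
  let y := revS f (cs r) (best r) in
  [/\ (\sum_(i < k) rr.1.1 i <= y)%R, (\sum_(i < k) rr.1.2 i <= 2 * y)%R, (\sum_(i < k) rr.2 i <= y)%R,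
     (forall i, [/\ 0 <= rr.1.1 i, 0 <= rr.1.2 i & 0 <= rr.2 i])%R &
     forall i a s t, lpath n par dep (US st b l) (MS st b l) a s t ->
       (forall v, v < n -> inPS st i v = pathP anc a s t v) ->
       cntS st Fs i <= st 3 i -> hasN n (fun v => inPS st i v) ->
     [/\ forall y, keyr n par dep (US st b l) (MS st b l) s y -> coinS (cs r) y ->
           (forall y', keyr n par dep (US st b l) (MS st b l) t y' -> ~~ coinS (cs r) y') ->
           ((st 4 i)%:R * f (side n par dep (US st b l) (MS st b l) a Fs s) <= rr.1.1 i)%R,
         forall z, part n par dep (US st b l) (MS st b l) a s t z ->
           0 < piecec n par dep (US st b l) (MS st b l) a s t Fs z ->
           coinS (cs r) z ->
           (forall z', z' != z -> part n par dep (US st b l) (MS st b l) a s t z' -> ~~ coinS (cs r) z') ->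
           ((st 4 i)%:R * f (piecec n par dep (US st b l) (MS st b l) a s t Fs z) <= 2 * rr.1.2 i)%R &
         (forall z, part n par dep (US st b l) (MS st b l) a s t z -> ~~ coinS (cs r) z) ->
           ((st 4 i)%:R * f (mids n par dep (US st b l) (MS st b l) a s t Fs (coinS (cs r))) <= rr.2 i)%R]].
  case: (leqP l L) => [lL|_]; last by exists (fun=> 0%R, fun=> 0%R, fun=> 0%R).
  have ln : l < n := leq_ltn_trans lL (L_lt n0).
  have GSr : gst (cs r) par dep pa ps pt by case: GS.
  have [r1 [r2 [r3 H]]] := level_bounds f_ge0 f_mono f_sub GSr Fs b2 ln bn codes (dd r).
  by exists (r1, r2, r3) => _.
have {ex}[rr Hrr] := choice (fun lr => ex lr.1 lr.2).
pose y r := revS f (cs r) (best r).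
have y0 r : (0 <= y r)%R by apply: sumr_ge0 => i _; exact: mulr_ge0.
pose ra l r i := (rr (l, r)).1.1 i; pose rk l r i := (rr (l, r)).1.2 i; pose rm l r i := (rr (l, r)).2 i.
have bound (l : 'I_L.+1) r : [/\ (\sum_(i < k) ra l r i <= y r)%R,
    (\sum_(i < k) rk l r i <= 2 * y r)%R & (\sum_(i < k) rm l r i <= y r)%R].
  have lL : l <= L by rewrite -ltnS.
  by have [] := Hrr (l : nat, r) lL.
have pos (l : 'I_L.+1) r i : [/\ 0 <= ra l r i, 0 <= rk l r i & 0 <= rm l r i]%R.
  have lL : l <= L by rewrite -ltnS.
  by have [_ _ _ H _] := Hrr (l : nat, r) lL; exact: H.
pose tot (l : 'I_L.+1) i : R := (32 * \sum_r rm l r i + 48 * \sum_r rk l r i + 8 * \sum_r ra l r i)%R.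
have tot0 l i : (0 <= tot l i)%R.
  have A (g : T.-tuple bool -> R) : (forall r, 0 <= g r)%R -> (0 <= \sum_r g r)%R by move=> h; apply: sumr_ge0.
  by rewrite !addr_ge0 ?mulr_ge0 ?A // => r; have [] := pos l r i.
have comm (i : 'I_k) : (2 ^+ T * revi f st Fs i <=
    \sum_(l < L.+1) tot l i + \sum_r revi f (cs r) (best r) i)%R.
  have v0 : (0 <= \sum_r revi f (cs r) (best r) i)%R by apply: sumr_ge0 => r _; exact: revi_ge0.
  have t0 : (0 <= \sum_(l < L.+1) tot l i)%R by apply: sumr_ge0.
  case: (boolP (hasN n (fun v => inPS st i v))) => [ne|em]; last first.
    have c0 r : revi f st Fs i = revi f (cs r) (best r) i.
      apply: (@revi_ext R f st) => v vn iv; case/negP: em; apply/hasNP; by exists v.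
    apply: ler_wpDl => //; under eq_bigr => r _ do rewrite -c0.
    by rewrite sumr_const card_tuple card_bool -natrX mulr_natl.
  case: (leqP (cntS st Fs i) (st 3 i)) => [cu|cu]; last first.
    by rewrite /revi leqNgt cu mul0n mul0r mulr0 addr_ge0.
  have [l lL P] := path_level (ltn_ord i); rewrite -ltnS in lL.
  apply: ler_wpDr => //; rewrite (bigD1 (Ordinal lL)) //=; apply: ler_wpDr; first by apply: sumr_ge0.
  rewrite /revi cu mul1n.
  have inE v : v < n -> inPS st i v = pathP anc (pa i) (ps i) (pt i) v := g_in GS (ltn_ord i).
  have -> : cntS st Fs i = pathc n par dep (pa i) (ps i) (pt i) Fs.
    by apply: eq_sumN => v vn; rewrite inE.
  have co r v : v < n -> coinS (cs r) v = nth false r v.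
    by move=> vn; rewrite /coinS /cs /with_coins /= vn; case: (nth false r v).
  have Hl (r : T.-tuple bool) := let: And5 _ _ _ _ H := Hrr (l, r) lL in H i _ _ _ P inE cu ne.
  have inE' v : v < n -> inPS st i v = pathP anc (pa i) (pt i) (ps i) v by move=> vn; rewrite pathPC inE.
  have Hl' (r : T.-tuple bool) := let: And5 _ _ _ _ H := Hrr (l, r) lL in H i _ _ _ (lpathC P) inE' cu ne.
  have kl x z : keyr n par dep (US st b l) (MS st b l) x z -> z < n.
    by case/(keyrP Tr) => /conn_anc/anc_ltl.
  apply: (commodity_avg f_mono f_sub Tr P _ nT).
  - exact: ler0n.
  - by move=> r; exact: (pos (Ordinal lL) r i).
  - move=> r z kz cz H; have [H1 _ _] := Hl r; apply: (H1 z kz); first by rewrite co ?(kl _ _ kz).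
    by move=> z' kz'; rewrite co ?(kl _ _ kz') // H.
  - move=> r z kz cz H; have [H1 _ _] := Hl' r; apply: (H1 z kz); first by rewrite co ?(kl _ _ kz).
    by move=> z' kz'; rewrite co ?(kl _ _ kz') // H.
  - move=> r z pz p0 cz H; have [_ H2 _] := Hl r; apply: (H2 z pz p0); first by rewrite co ?(part_lt pz).
    by move=> z' ne' pz'; rewrite co ?(part_lt pz') // H.
  move=> r H; have [_ _ H3] := Hl r.
  have -> : mids n par dep (US st b l) (MS st b l) (pa i) (ps i) (pt i) Fs (nth false r) =
            mids n par dep (US st b l) (MS st b l) (pa i) (ps i) (pt i) Fs (coinS (cs r)).
    by apply: eq_sumN => z zn; rewrite co.
  by apply: H3 => z pz; rewrite co ?(part_lt pz) // H.
rewrite revSE mulr_sumr; apply: le_trans (ler_sum _ (fun i _ => comm i)) _.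
rewrite big_split /= exchange_big /= [X in (_ + X <= _)%R]exchange_big /=.
set S := (\sum_r revS _ _ _)%R.
have S0 : (0 <= S)%R by apply: sumr_ge0 => r _; exact: y0.
apply: (@le_trans _ _ (\sum_(l < L.+1) 136 * S + S)%R).
  rewrite lerD2r; apply: ler_sum => l _; rewrite /tot !big_split /= -!mulr_sumr.
  have e1 : (\sum_(i < k) \sum_r rm l r i <= S)%R.
    by rewrite exchange_big; apply: ler_sum => r _; have [] := bound l r.
  have e2 : (\sum_(i < k) \sum_r ra l r i <= S)%R.
    by rewrite exchange_big; apply: ler_sum => r _; have [] := bound l r.
  have e3 : (\sum_(i < k) \sum_r rk l r i <= 2 * S)%R.
    by rewrite exchange_big mulr_sumr; apply: ler_sum => r _; have [] := bound l r.
  lra.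
rewrite sumr_const card_ord -[X in (X + _ <= _)%R]mulr_natl mulrA -natrM.
rewrite -[X in (_ + X <= _)%R]mul1r -mulrDl natr1.
rewrite ler_wpM2r // ler_nat; lia.
Qed.

End Average.

(** * The branching parameter *)

(** For positive [n], the largest [b] whose codes fit into the range searched by the program,
    [(trunc_log 2 n + 2) ^ (2 * b) <= 64 * (n * n)]. *)
Definition brn n := (trunc_log (trunc_log 2 n + 2) (64 * (n * n)))./2.

Lemma isqrt_ex K : exists2 q, q * q <= K & K < q.+1 * q.+1.
Proof.
elim: K => [|K [q h1 h2]]; first by exists 0.
by case: (ltnP K.+1 (q.+1 * q.+1)) => h; [exists q => //; lia|exists q.+1 => //; nia].
Qed.

(** The origin of the 64: with this factor the exponent 4 always fits, so [brn n] is at least 2 for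
    every positive [n]. *)
Lemma pow4_bound l : (l + 2) ^ 4 <= 64 * 4 ^ l.
Proof.
elim: l => [//|[//|l] IH]; apply: (@leq_trans (4 * (l.+1 + 2) ^ 4)); last by rewrite [4 ^ l.+2]expnS; lia.
move: (l) => m; rewrite !expnS expn0; nia.
Qed.

Section Branching.
Variable n : nat.
Hypothesis n0 : 0 < n.
Local Notation lm := (trunc_log 2 n).
Local Notation b := (brn n).

Lemma sq_ge : 64 * 4 ^ lm <= 64 * (n * n).
Proof.
have h := trunc_logP (ltnSn 1) n0.
by rewrite leq_mul2l (_ : 4 = 2 * 2) // expnMn leq_mul.
Qed.

Lemma tl_ge : 2 * b <= trunc_log (lm + 2) (64 * (n * n)) < 2 * b + 2.
Proof.
rewrite /brn mul2n; have := odd_double_half (trunc_log (lm + 2) (64 * (n * n))).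
by case: odd => /=; lia.
Qed.

Lemma brn_codes : (lam n + 2) ^ (2 * b) <= 64 * (n * n).
Proof.
rewrite lamE //; have /andP[h _] := tl_ge.
have n64 : 0 < 64 * (n * n) by rewrite !muln_gt0 n0.
have k1 : 1 < lm + 2 by rewrite addn2.
apply: leq_trans (trunc_logP k1 n64); by rewrite leq_exp2l.
Qed.

Lemma brn_gt1 : 1 < b.
Proof.
have /andP[_ h] := tl_ge.
suff : 4 <= trunc_log (lm + 2) (64 * (n * n)) by lia.
apply: trunc_log_max; first by rewrite addn2.
exact: leq_trans (pow4_bound _) sq_ge.
Qed.

(** This justifies the loop bound [n + 8]: the base of the codes is at least 2, and their number is
    at most [2 ^ (2 * (lm + 4))]. *)
Lemma brn_lt : b < n + 8.
Proof.
have := brn_codes; rewrite lamE // => h.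
have lt : n < 2 ^ lm.+1 by exact: trunc_log_ltn.
have lm_lt : lm < n.
  by apply: leq_trans (ltn_expl _ (ltnSn 1)) _; exact: trunc_logP.
have h2 : 2 ^ (2 * b) <= 2 ^ (2 * (lm + 4)).
  apply: (@leq_trans ((lm + 2) ^ (2 * b))).
    by rewrite leq_exp2r ?addn2 //; have := brn_gt1; lia.
  apply: leq_trans h _; apply: (@leq_trans (2 ^ 6 * (2 ^ lm.+1 * 2 ^ lm.+1))).
    by rewrite leq_mul2l leq_mul // ltnW.
  by rewrite -!expnD leq_exp2l //; lia.
rewrite leq_exp2l // leq_mul2l /= in h2; lia.
Qed.

(** Let [q] be the integer square root of [K = lm + 2]. Maximality of [b] gives
    [2 ^ (2 * K + 2) < K ^ (2 * b + 2)], while [K < q.+1 * q.+1 <= 2 ^ (2 * q)]; comparing exponents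
    yields [q <= 2 * b + 1], and [b >= 2] absorbs the additive constants. *)
Lemma brn_sq : lm + 2 <= 9 * (b * b).
Proof.
set K := lm + 2.
have [q qK Kq] := isqrt_ex K.
have b1 := brn_gt1.
have n64 : 0 < 64 * (n * n) by rewrite !muln_gt0 n0.
have k1 : 1 < K by rewrite /K addn2.
have h1 : 2 ^ (2 * K + 2) < K ^ (2 * b + 2).
  have /andP[_ h] := tl_ge.
  apply: (@leq_ltn_trans (64 * (n * n))).
    apply: leq_trans sq_ge; rewrite /K (_ : 64 = 2 ^ 6) // (_ : 4 = 2 ^ 2) // -expnM -expnD leq_exp2l //; lia.
  apply: leq_trans (trunc_log_ltn _ k1) _; rewrite leq_exp2l //.
have h2 : K ^ (2 * b + 2) <= 2 ^ (2 * q * (2 * b + 2)).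
  rewrite expnM leq_exp2r; last by lia.
  apply: leq_trans (ltnW Kq) _; rewrite mul2n -addnn expnD; apply: leq_mul; exact: ltn_expl.
have := leq_trans h1 h2; rewrite ltn_exp2l // => h3.
have q2 : q <= 2 * b + 1 by nia.
have : q.+1 * q.+1 <= (3 * b) * (3 * b) by apply: leq_mul; lia.
lia.
Qed.

Lemma brn_pow : lm + 2 <= b ^ 6.
Proof.
apply: leq_trans brn_sq _; have b1 := brn_gt1.
have b4 : 9 <= b ^ 4 by apply: (@leq_trans (2 ^ 4)) => //; rewrite leq_exp2r.
by rewrite (_ : 6 = 4 + 2) // expnD leq_mul // mulnn.
Qed.

End Branching.

Definition ratio n := 136 * (trunc_log (brn n) n).+2.

(** * The ratio compared with ln n / ln ln n *)

Section Asymptotics.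
Local Open Scope classical_set_scope.
Variable R : realType.
Local Open Scope ring_scope.

(** Euler's number is at most 4: the tangent bound gives [expR (- (1/2)) >= 1/2], hence
    [expR (1/2) <= 2]. *)
Lemma ln_gt1 (x : R) : 4 < x -> 1 < ln x.
Proof.
move=> x4; have x0 : 0 < x by apply: lt_trans x4.
rewrite -[1]expRK ltr_ln ?posrE ?expR_gt0 //; apply: le_lt_trans x4.
have h : expR (- (1/2)) >= 1 / 2 :> R by apply: le_trans (expR_ge1Dx _); lra.
have e : expR (1/2) <= 2 :> R.
  have y0 := expR_gt0 (1/2 : R); rewrite expRN in h.
  by have := divff (lt0r_neq0 y0); nra.
have -> : 1 = 1/2 + 1/2 :> R by lra.
rewrite expRD; have := expR_gt0 (1/2 : R); nra.
Qed.

(** The 1088 is [136 * 8]. Put [x = ln n / ln (ln n)], which is at least 1; the logarithm of [n] to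
    base [b] is at most [6 * x] because [ln (ln n) <= 6 * ln b] by [brn_pow], and the additive 2 is
    at most [2 * x]. Beyond 4 the iterated logarithm is positive. *)
Lemma ratio_bound n : (4 < n)%N ->
  (ratio n)%:R <= 1088 * (ln n%:R / ln (ln n%:R)) :> R.
Proof.
move=> n4; have n0 : (0 < n)%N by exact: leq_ltn_trans n4.
have l1 : 1 < ln (n%:R : R) by apply: ln_gt1; rewrite ltr_nat.
have l0 : 0 < ln (n%:R : R) by apply: lt_trans l1.
have ll0 : 0 < ln (ln (n%:R : R)) by rewrite ln_gt0.
have b1 := brn_gt1 n0; set b := brn n in b1.
have bp : 0 < (b%:R : R) by rewrite ltr0n ltnW.
have lb0 : 0 < ln (b%:R : R) by rewrite ln_gt0 // ltr1n.
have hL : (trunc_log b n)%:R * ln (b%:R : R) <= ln n%:R.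
  have -> : (trunc_log b n)%:R * ln (b%:R : R) = ln ((b ^ trunc_log b n)%:R).
    by rewrite natrX lnXn // mulr_natl.
  rewrite ler_ln ?posrE ?ltr0n ?expn_gt0 ?(ltnW b1) // ler_nat; exact: trunc_logP.
have h2 : ln (n%:R : R) <= (trunc_log 2 n + 2)%:R.
  have : ln (n%:R : R) <= ln (2 ^+ (trunc_log 2 n).+1).
    rewrite ler_ln ?posrE ?exprn_gt0 ?ltr0n // -natrX ler_nat ltnW //; exact: trunc_log_ltn.
  rewrite lnXn // -[(ln 2 *+ _)]mulr_natl => h; apply: le_trans h _.
  apply: (@le_trans _ _ ((trunc_log 2 n).+1%:R * 1)).
    rewrite ler_wpM2l // -[X in _ <= X]expRK ler_ln ?posrE ?expR_gt0 //.
    by apply: le_trans (expR_ge1Dx _); lra.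
  by rewrite mulr1 ler_nat addn2.
have h3 : ln (ln (n%:R : R)) <= 6 * ln b%:R.
  rewrite mulr_natl -lnXn // ler_ln ?posrE ?exprn_gt0 //; apply: le_trans h2 _.
  rewrite -natrX ler_nat; exact: brn_pow.
have h4 : 1 <= ln (n%:R : R) / ln (ln n%:R).
  by rewrite ler_pdivlMr // mul1r ltW // ln_sublinear.
have h5 : (trunc_log b n)%:R <= 6 * (ln (n%:R : R) / ln (ln n%:R)).
  rewrite mulrA ler_pdivlMr //.
  apply: le_trans (ler_wpM2l (ler0n _ _) h3) _; rewrite mulrCA ler_pM2l //.
rewrite /ratio -/b natrM -addn2 natrD; nra.
Qed.

Lemma ratio_asymptotics : (fun n => (ratio n)%:R : R) =O_\oo (fun n : nat => ln n%:R / ln (ln n%:R) : R).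
Proof.
apply/eqO_exP; exists 1088; first by rewrite ltr0n.
near=> n.
have n4 : (4 < n)%N by near: n; exact: nbhs_infty_gt.
rewrite ger0_norm ?ler0n //; apply: le_trans (ratio_bound n4) _.
by rewrite ler_pM2l ?ltr0n // ler_norm.
Unshelve. all: by end_near.
Qed.

End Asymptotics.

(** * Rooting a tree by distance *)

(** For a monotone predicate the number of failures is the first index of success; depth thereby
    becomes a counting expression that the program can evaluate. *)
Lemma sum_neg_le N (p : nat -> bool) t : t < N -> (forall s, p s -> p s.+1) ->
  (sumN N (fun s => ~~ p s) <= t) = p t.
Proof.
move=> tN pS.
have pm s s' : s <= s' -> p s -> p s'.
  by move/subnK <-; elim: (s' - s) => [//|m IH] /IH /pS; rewrite addSn.
have E m : m <= N -> sumN N (fun s => s < m) = m.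
  move=> mN; rewrite /sumN -big_mkcond /= -(big_ord_widen N (fun=> 1) mN).
  by rewrite sum1_card card_ord.
case: (boolP (p t)) => [pt|npt].
  rewrite -[X in _ <= X](E _ (ltnW tN)); apply: leq_sumN => s _.
  by case: (leqP t s) => // ts; rewrite ?(pm _ _ ts pt) //; case: (p s).
apply/negbTE; rewrite -ltnNge -[X in X <= _](E t.+1) //; apply: leq_sumN => s _.
rewrite ltnS; case: (leqP s t) => // st; case ps: (p s) => //.
by rewrite (pm _ _ st ps) in npt.
Qed.

Section Depth.
Variables (V : finType) (e : rel V) (r : V).
Hypothesis et : is_tree e.

Let e_sym : symmetric e. Proof. by case: et. Qed.
Let e_irr : irreflexive e. Proof. by case: et. Qed.

Fixpoint reach t v :=
  if t is t'.+1 then reach t' v || [exists w, e w v && reach t' w] else v == r.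

Definition depth v := sumN #|V| (fun t => ~~ reach t v).

Lemma reachS t v : reach t v -> reach t.+1 v.
Proof. by move=> /= ->. Qed.

Lemma reach_path p : path e r p -> reach (size p) (last r p).
Proof.
elim/last_ind: p => [|p x IH] /=; first by rewrite eqxx.
rewrite rcons_path size_rcons last_rcons => /andP[/IH rp ex].
by apply/orP; right; apply/existsP; exists (last r p); rewrite ex.
Qed.

Lemma reach_ex v : exists2 t, t < #|V| & reach t v.
Proof.
have [_ _ _ /(_ r v)/connectP[p pp ->] _] := et.
case/shortenP: pp => p' pp' up' _; exists (size p'); last exact: reach_path.
by have := max_card (mem (r :: p')); rewrite (card_uniqP up').
Qed.

Lemma depth_le t v : t < #|V| -> (depth v <= t) = reach t v.
Proof. by move=> tV; rewrite /depth sum_neg_le // => s; exact: reachS. Qed.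

Lemma depth_lt v : depth v < #|V|.
Proof. by have [t tV rt] := reach_ex v; apply: leq_ltn_trans (tV); rewrite depth_le. Qed.

Lemma depth_eq0 v : (depth v == 0) = (v == r).
Proof. by rewrite -leqn0 depth_le //; apply/card_gt0P; exists r. Qed.

Lemma depth_edge v w : e v w -> depth w <= (depth v).+1.
Proof.
move=> vw; case: (ltnP (depth v).+1 #|V|) => lt; last exact: leq_trans (ltnW (depth_lt w)) lt.
rewrite depth_le //=; apply/orP; right; apply/existsP; exists v; rewrite vw /=.
by rewrite -depth_le // depth_lt.
Qed.

Lemma depth_pred v : v != r -> exists2 w, e v w & depth v = (depth w).+1.
Proof.
move=> vr; have := vr; rewrite -depth_eq0; case E: (depth v) => [//|d] _.
have dV : d < #|V| by apply: ltn_trans (depth_lt v); rewrite E.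
have : reach d.+1 v by rewrite -depth_le ?E // -E depth_lt.
rewrite /= -depth_le // E ltnn /= => /existsP[w /andP[wv rw]].
exists w; first by rewrite e_sym.
rewrite -depth_le // in rw; have := depth_edge wv; rewrite E => le.
by congr _.+1; apply/eqP; rewrite eqn_leq rw andbT -ltnS.
Qed.

Let ev v := [rel x y | [&& e x y, x != v & y != v]].

(** Every step of the walk goes to smaller depth, so it never meets [v]. *)
Lemma descend v w : w != v -> depth w <= depth v -> connect (ev v) w r.
Proof.
have [m] := ubnP (depth w); elim: m w => // m IH w lt wv le.
have [->|wr] := eqVneq w r; first exact: connect0.
have [w' ww' E] := depth_pred wr.
have w'v : w' != v by apply: contraTneq le => <-; rewrite E -ltnNge.
apply: (@connect_trans _ _ w').
  by apply: connect1; rewrite /= ww' wv w'v.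
by apply: IH => //; lia.
Qed.

(** Two such neighbours would be joined by a walk avoiding [v], which closes to a cycle through [v]
    with at least three vertices. *)
Lemma uniq_lower v w1 w2 : e v w1 -> e v w2 -> depth w1 <= depth v -> depth w2 <= depth v ->
  w1 = w2.
Proof.
move=> e1 e2 d1 d2; apply/eqP; apply: contraT => ne.
have n1 : w1 != v by apply: contraTneq e1 => ->; rewrite e_irr.
have n2 : w2 != v by apply: contraTneq e2 => ->; rewrite e_irr.
have evs : connect_sym (ev v).
  by apply: sym_connect_sym => x y /=; rewrite e_sym; case: (e y x) => //=; rewrite andbC.
have /connectP[p pp lp] : connect (ev v) w1 w2.
  by apply: connect_trans (descend n1 d1) _; rewrite evs; exact: descend.
case/shortenP: pp lp => q pq uq _ lq.
have [_ _ _ _ /(_ (v :: w1 :: q))] := et.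
have pe : path e w1 q by apply: sub_path pq => x y /= /and3P[].
have nv : v \notin q.
  elim: (q) (w1) pq => [|y q' IH] x //= /andP[/and3P[_ _ yv] /IH].
  by rewrite inE eq_sym (negPf yv).
have q0 : 2 < size [:: v, w1 & q].
  by case: (q) lq => [/= E|//]; rewrite E eqxx in ne.
move/(_ q0)/negP; case; rewrite /= e1 rcons_path pe -lq e_sym e2 /= inE eq_sym (negPf n1) nv.
exact: uq.
Qed.

Lemma edge_depth v w : e v w -> depth v != depth w.
Proof.
move=> vw; apply/negP => /eqP E.
have vr : v != r.
  apply: contraTneq vw => vr; have : depth w == 0 by rewrite -E depth_eq0 vr.
  by rewrite depth_eq0 => /eqP ->; rewrite vr e_irr.
have [p vp Ep] := depth_pred vr.
have pw : p = w by apply: (uniq_lower vp vw); lia.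
by rewrite pw E in Ep; lia.
Qed.

(** The default makes the root its own parent, as [rt_par0] asks. *)
Definition parent v := odflt r [pick w | e v w && (depth w < depth v)].

Lemma parentP v : v != r -> e v (parent v) /\ depth v = (depth (parent v)).+1.
Proof.
move=> vr; have [w vw E] := depth_pred vr; rewrite /parent; case: pickP => [x /andP[vx lt]|/(_ w)].
  split=> //=; have -> // : x = w by apply: (uniq_lower vx vw); lia.
by rewrite vw E ltnSn.
Qed.

Lemma parent_root : parent r = r.
Proof.
rewrite /parent; case: pickP => // x /andP[_]; have /eqP -> : depth r == 0 by rewrite depth_eq0.
by rewrite ltn0.
Qed.

Lemma lower_parent v w : e v w -> depth w < depth v -> v != r /\ parent v = w.
Proof.
move=> vw lt; have vr : v != r by rewrite -depth_eq0 -lt0n (leq_ltn_trans _ lt).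
have [h1 h2] := parentP vr; split=> //; apply: (uniq_lower h1 vw); lia.
Qed.

End Depth.

(** * Tree paths as two vertical chains below a common ancestor *)

Section RootedPaths.
Variables (n : nat) (n0 : 0 < n) (e : rel 'I_n).
Hypothesis et : is_tree e.
Local Notation V := 'I_n.
Let r : V := Ordinal n0.

Definition tpar (v : nat) : nat := parent e r (insubd r v).
Definition tdep (v : nat) : nat := depth e r (insubd r v).

Lemma tparE (x : V) : tpar x = parent e r x. Proof. by rewrite /tpar valKd. Qed.
Lemma tdepE (x : V) : tdep x = depth e r x. Proof. by rewrite /tdep valKd. Qed.

Lemma tree_rtree : rtree n tpar tdep.
Proof.
have r0 : insubd r 0 = r by exact: (valKd r r).
split=> //.
- by rewrite /tpar r0 parent_root.
- by apply/eqP; rewrite /tdep r0 depth_eq0.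
- by move=> v vn; rewrite /tpar; exact: ltn_ord.
- move=> v /andP[v0 vn]; rewrite -[v]/(val (Ordinal vn)) tdepE tparE tdepE.
  by have [] := parentP et (_ : Ordinal vn != r); rewrite -?val_eqE /= -?lt0n.
- by move=> v vn; rewrite -[v]/(val (Ordinal vn)) tdepE -[X in _ < X]card_ord depth_lt.
Qed.

Local Notation anc := (ancM n tpar tdep).
Let T := tree_rtree.

Lemma edge_par (x y : V) : e x y -> (0 < x /\ tpar x = y) \/ (0 < y /\ tpar y = x).
Proof.
move=> xy; have := edge_depth r et xy; rewrite neq_ltn => /orP[] lt.
  right; rewrite tparE; have [|h ->] := lower_parent et _ lt; first by case: et => ->.
  by rewrite lt0n.
by left; rewrite tparE; have [h ->] := lower_parent et xy lt; rewrite lt0n.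
Qed.

Definition pedge (v : V) : {set V} := [set v; parent e r v].

Lemma pedge_inj (v w : V) : 0 < v -> 0 < w -> pedge v = pedge w -> v = w.
Proof.
move=> v0 w0 E; apply/eqP; apply: contraT => ne.
have h1 : v \in pedge w by rewrite -E !inE eqxx.
have h2 : w \in pedge v by rewrite E !inE eqxx.
move: h1 h2; rewrite !inE (negPf ne) [w == v]eq_sym (negPf ne) /= => /eqP h1 /eqP h2.
have vr : v != r by rewrite -lt0n.
have wr : w != r by rewrite -lt0n.
have [_] := parentP et vr; have [_] := parentP et wr; rewrite -h1 -h2; lia.
Qed.

Lemma pedge_edge (x y : V) : 0 < x -> tpar x = y -> [set x; y] = pedge x.
Proof. by move=> x0; rewrite tparE => /val_inj <-. Qed.

Lemma walk_cons (x y : V) p : walk_edges x (y :: p) = [set x; y] |: walk_edges y p.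
Proof.
apply/setP => S; rewrite !inE; apply/imsetP/orP => /=.
  case=> -[u v]; rewrite inE => /orP[/eqP[-> ->] ->|uv ->]; first by left.
  by right; apply/imsetP; exists (u, v).
case=> [/eqP ->|/imsetP[[u v] uv ->]]; first by exists (x, y); rewrite // inE eqxx.
by exists (u, v); rewrite // inE uv orbT.
Qed.

Lemma walk_mem (x : V) p (S : {set V}) (v : V) : S \in walk_edges x p -> v \in S -> v \in x :: p.
Proof.
elim: p x => [|y p IH] x; first by case/imsetP=> -[].
rewrite walk_cons !inE => /orP[/eqP->|h] vS.
  by rewrite !inE in vS; case/orP: vS => ->; rewrite ?orbT.
by have := IH _ h vS; rewrite inE => ->; rewrite orbT.
Qed.

(* A walk without repetitions climbs to the least common ancestor [a] of its
   ends and then descends; [a] is found by peeling off the first edge. *)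
Lemma path_lca (x : V) p : path e x p -> uniq (x :: p) -> exists a : nat,
  [/\ anc a x, anc a (last x p), forall v, anc v x -> anc v (last x p) -> anc v a &
   forall v : V, ((0 < v) && (pedge v \in walk_edges x p)) = pathP anc a x (last x p) v].
Proof.
elim: p x => [|y p IH] x /=.
  move=> _ _; exists (val x); have xx : anc x x by exact: anc_refl.
  split=> // v; rewrite /pathP orbb.
  have -> : pedge v \in walk_edges x [::] = false.
    by apply/negP => /imsetP[[u w]]; rewrite inE.
  rewrite andbF; apply/esym/negP => /and3P[h1 h2 h3].
  by rewrite (anc_anti h1 h3) eqxx in h2.
case/andP=> xy pp /andP[xn up]; have [a [ay at_ lca E]] := IH y pp up.
set t := last y p in at_ lca E *.
have inw v : 0 < (v : V) -> pedge v \in walk_edges y p -> v != x /\ parent e r v != x.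
  move=> v0 h; split; apply: contraNneq xn => E'.
    by rewrite -E'; apply: walk_mem h _; rewrite !inE eqxx.
  by rewrite -E'; apply: walk_mem h _; rewrite !inE eqxx orbT.
have tn : t < n by exact: ltn_ord.
case: (edge_par xy) => -[x0 px].
  have yx : anc y x by rewrite -px; exact: (anc_par T).
  have ax := anc_trans T ay yx.
  have xa : val x != a.
    apply: contraTneq ay => <-; apply/negP => /anc_dep.
    by have := rt_dep T (_ : 0 < x < n); rewrite x0 ltn_ord px => ->; rewrite ?ltnn.
  (* To end below [x] the rest of the path would have to use the edge from [x] to its parent, but
     [x] is not visited again. *)
  have nxt : ~~ anc x t.
    apply/negP => xt; have := E x; rewrite /pathP ax xa xt orbT x0 /= => /(inw _ x0)[].
    by rewrite eqxx.
  have ancx v : anc v x = (v == x) || anc v y.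
    apply/idP/orP => [h|[/eqP->|h]].
    - case: (eqVneq v x) => [->|ne]; first by left.
      by right; rewrite -px; exact: (anc_to_par T h ne).
    - exact: anc_refl.
    - exact: anc_trans T _ _ _ h yx.
  exists a; split=> //.
    move=> v; rewrite ancx => /orP[/eqP->|vy] vt; last exact: lca.
    by rewrite vt in nxt.
  move=> v; rewrite walk_cons in_setU1 /pathP ancx.
  case: (eqVneq v x) => [->|vx].
    by rewrite x0 (pedge_edge x0 px) eqxx ax xa eqxx.
  have -> : (val v == x) = false by apply/negbTE.
  rewrite andb_orr E /pathP.
  have -> // : (0 < v) && (pedge v == [set x; y]) = false.
  apply/negP => /andP[v0]; rewrite (pedge_edge x0 px) => /eqP /(pedge_inj v0 x0) h.
  by rewrite h eqxx in vx.
(* If the top were strictly above [y], the rest of the path would use the edge from [y] to its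
   parent [x], which is not visited again. *)
have ya : a = y.
  apply/eqP; apply: contraT; rewrite eq_sym => ya.
  have := E y; rewrite /pathP ay ya (anc_refl _ _ (ltn_ord y)) x0 /= => /(inw _ x0)[_].
  by rewrite -val_eqE /= -tparE px eqxx.
rewrite {}ya in ay at_ lca E *.
have xy' : anc x y by rewrite -px; exact: (anc_par T).
have dxy : tdep x < tdep y.
  by have := rt_dep T (_ : 0 < y < n); rewrite x0 ltn_ord px => ->.
exists (val x); split=> //.
- exact: (anc_refl _ _ (ltn_ord x)).
- exact: anc_trans T _ _ _ xy' at_.
move=> v; rewrite walk_cons in_setU1.
have pxy : [set x; y] = pedge y by rewrite -(pedge_edge x0 px) finset.setUC.
have key : [&& anc x v, val v != x & anc v x || anc v t] = anc y v && anc v t.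
  apply/idP/idP.
    case/and3P=> xv ne /orP[vx|vt]; first by rewrite (anc_anti xv vx) eqxx in ne.
    rewrite vt andbT; case/orP: (anc_total at_ vt) => // vy.
    case: (eqVneq (val v) y) => [->|ney]; first exact: anc_refl.
    have := anc_to_par T vy ney; rewrite px => vx.
    by rewrite (anc_anti xv vx) eqxx in ne.
  case/andP=> yv vt; rewrite (anc_trans T xy' yv) vt orbT andbT /=.
  by apply: contraTneq (anc_dep yv) => ->; rewrite -ltnNge.
rewrite /pathP key; case: (eqVneq v y) => [->|vy].
  by rewrite pxy eqxx x0 at_ (anc_refl _ _ (ltn_ord y)).
rewrite andb_orr E /pathP.
have -> : (0 < v) && (pedge v == [set x; y]) = false.
  apply/negP => /andP[v0]; rewrite pxy => /eqP /(pedge_inj v0 x0) h.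
  by rewrite h eqxx in vy.
have ne : val v != y by [].
rewrite ne /=; case: (boolP (anc y v)) => //= yv.
by case: (boolP (anc v y)) => //= v_y; case/negP: ne; rewrite -(anc_anti v_y yv).
Qed.

End RootedPaths.

(** * The instance as seen by the program *)

Section Instance.
Variables (R : realType) (I : fza R).
Local Notation n := (fza_n I).
Local Notation k := (fza_k I).
Local Notation e := (@fza_adj R I).
Let et : is_tree e := @fza_tree R I.

Lemma fza_n_gt0 : 0 < n.
Proof. by case: et => _ _; rewrite card_ord. Qed.

Let r : 'I_n := Ordinal fza_n_gt0.
Let par := tpar fza_n_gt0 e.
Let dep := tdep fza_n_gt0 e.
Let T : rtree n par dep := tree_rtree fza_n_gt0 et.
Local Notation anc := (ancM n par dep).
Local Notation prl := (prlM n par).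
Local Notation pedge := (pedge fza_n_gt0 e).

(** The memory as the main stage reads it, apart from the coins: the input and the completed tables
    of distances and of ancestors. *)
Definition ist : memory nat := fun A j =>
  match A with
  | 10 => (j < n * n) && reach e r (j %/ n) (insubd r (j %% n)) : nat
  | 11 => (j < n * n) && anc (j %/ n) (j %% n) : nat
  | _ => if A <= 4 then input_nmem I A j else 0
  end.

Lemma bvn : bv Bn ist = n. Proof. by []. Qed.

Lemma ix_div v w : w < n -> (v * n + w) %/ n = v.
Proof. by move=> wn; rewrite divnMDl ?fza_n_gt0 // divn_small // addn0. Qed.

Lemma ix_mod v w : w < n -> (v * n + w) %% n = w.
Proof. by move=> wn; rewrite modnMDl modn_small. Qed.

Lemma ix_lt v w : v < n -> w < n -> v * n + w < n * n.
Proof. by move=> vn wn; apply: (@leq_trans (v.+1 * n)); rewrite ?leq_mul2r ?vn ?orbT // mulSn addnC ltn_add2r. Qed.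

Lemma ist1 (x y : 'I_n) : (ist 1 (x * n + y) != 0) = e x y.
Proof.
rewrite /ist /= eqb0 negbK; apply/existsP/idP => [[x' /existsP[y' /andP[/eqP E]]]|xy].
  have := congr1 (divn^~ n) E; rewrite !ix_div // => /val_inj ->.
  by have := congr1 (modn^~ n) E; rewrite !ix_mod // => /val_inj ->.
by exists x; apply/existsP; exists y; rewrite eqxx.
Qed.

Lemma ist2 (i : 'I_k) (x y : 'I_n) : (ist 2 ((i * n + x) * n + y) != 0) = ([set x; y] \in fza_P i).
Proof.
rewrite /ist /= eqb0 negbK; apply/existsP/idP => [[i' /existsP[x' /existsP[y' /andP[/eqP E]]]]|xy].
  have E1 := congr1 (divn^~ n) E; rewrite !ix_div // in E1.
  have := congr1 (divn^~ n) E1; rewrite !ix_div // => /val_inj ->.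
  have := congr1 (modn^~ n) E1; rewrite !ix_mod // => /val_inj ->.
  by have := congr1 (modn^~ n) E; rewrite !ix_mod // => /val_inj ->.
by exists i; apply/existsP; exists x; apply/existsP; exists y; rewrite eqxx.
Qed.

Lemma ist3 (i : 'I_k) : ist 3 i = fza_u i.
Proof. by rewrite /ist /= valK. Qed.

Lemma ist4 (i : 'I_k) : ist 4 i = fza_w i.
Proof. by rewrite /ist /= valK. Qed.

Lemma depS_ist (x : 'I_n) : depS ist x = dep x.
Proof.
rewrite /dep tdepE /depth card_ord; apply: eq_sumN => t tn.
rewrite [ist 10 _]/(nat_of_bool (_ && _)) ix_lt // ix_div // ix_mod // valKd.
by case: (reach _ _ _ _).
Qed.

Lemma prlS_ist : prlS ist = prl.
Proof.
apply: funext => v; apply: funext => w; rewrite /prlS /prlM bvn.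
case: (ltnP v n) => //= vn; case: (ltnP w n) => /= wn; last first.
  apply/esym/negP => /andP[_ /eqP E]; have := rt_par T vn; rewrite E; lia.
rewrite -[v]/(val (Ordinal vn)) -[w]/(val (Ordinal wn)); move: (Ordinal vn) (Ordinal wn) => x y.
rewrite ist1 !depS_ist /dep /par !tdepE tparE; apply/andP/andP => -[h1 h2].
  have [h3 ->] := lower_parent et h1 h2; by rewrite lt0n.
have xr : x != r by rewrite -lt0n.
have [h3 h4] := parentP et xr; move/eqP/val_inj: h2 => <-.
by rewrite h4.
Qed.

Lemma ancS_ist : ancS ist = anc.
Proof.
apply: funext => v; apply: funext => w; rewrite /ancS bvn.
case: (ltnP v n) => vn; last by rewrite /ancM [v < n]ltnNge vn.
case: (ltnP w n) => wn; last by rewrite /ancM vn [w < n]ltnNge wn.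
rewrite !andTb [ist 11 _]/(nat_of_bool (_ && _)) ix_lt // ix_div // ix_mod //.
by case: (anc v w).
Qed.

Lemma inPS_ist (i : 'I_k) (v : 'I_n) : inPS ist i v = (0 < v) && (pedge v \in fza_P i).
Proof.
rewrite /inPS prlS_ist; apply/hasNP/andP => [[w wn /andP[pv h]]|[v0 h]].
  have /and3P[_ v0 /eqP E] := pv; split=> //.
  rewrite -[w]/(val (Ordinal wn)) ist2 in h.
  by rewrite -(pedge_edge _ (y := Ordinal wn)).
exists (parent e r v); first exact: ltn_ord.
rewrite ist2 h andbT /prlM ltn_ord v0 /= /par tparE //.
Qed.

Lemma fza_gst : exists pa ps pt, gst ist par dep pa ps pt.
Proof.
have H i : exists q : nat * nat * nat, i < k ->
  [/\ anc q.1.1 q.1.2, anc q.1.1 q.2,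
      forall v, anc v q.1.2 -> anc v q.2 -> anc v q.1.1 &
      forall v, v < n -> inPS ist i v = pathP anc q.1.1 q.1.2 q.2 v].
  case: (ltnP i k) => [ik|_]; last by exists (0, 0, 0).
  have [x [p [pp up EP]]] := @fza_P_path R I (Ordinal ik).
  have [a [h1 h2 h3 h4]] := path_lca fza_n_gt0 et pp up.
  exists (a, val x, val (last x p)) => _; split=> // v vn.
  by rewrite -[i]/(val (Ordinal ik)) -[v]/(val (Ordinal vn)) inPS_ist EP h4.
have {H}[q Hq] := choice H.
exists (fun i => (q i).1.1), (fun i => (q i).1.2), (fun i => (q i).2); split.
- exact: T.
- exact: prlS_ist.
- exact: ancS_ist.
- by move=> i /Hq[].
- by move=> i /Hq[].
- by move=> i v /Hq[_ _ h _]; exact: h.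
- by move=> i v /Hq[_ _ _ h]; exact: h.
Qed.

Definition edges_of (F : {set {set 'I_n}}) v := (0 < v) && (pedge (insubd r v) \in F).

Definition out_edges (best : nat -> bool) : {set {set 'I_n}} :=
  [set pedge v | v : 'I_n & (0 < v) && best v].

Lemma edgeP S : S \in fza_E I -> exists2 v : 'I_n, 0 < v & S = pedge v.
Proof.
case/imsetP=> -[x y]; rewrite inE /= => xy ->.
have [[x0 px]|[y0 py]] := edge_par fza_n_gt0 et xy.
  by exists x => //; exact: pedge_edge.
by exists y => //; rewrite finset.setUC; exact: pedge_edge.
Qed.

Lemma pedge_E (v : 'I_n) : 0 < v -> pedge v \in fza_E I.
Proof.
move=> v0; have vr : v != r by rewrite -lt0n.
have [h _] := parentP et vr.
by apply/imsetP; exists (v, parent e r v); rewrite ?inE.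
Qed.

Lemma path_sub_E i : fza_P i \subset fza_E I.
Proof.
have [x [p [pp _ ->]]] := @fza_P_path R I i.
elim: p x pp => [|y p IH] x /=.
  by move=> _; apply/fintype.subsetP => S /imsetP[[]].
case/andP=> xy /IH h; rewrite walk_cons finset.subUset h andbT finset.sub1set.
by apply/imsetP; exists (x, y); rewrite ?inE.
Qed.

Lemma count_edges (F : {set {set 'I_n}}) (i : 'I_k) :
  #|fza_P i :&: F| = cntS ist (edges_of F) i.
Proof.
have -> : fza_P i :&: F = [set pedge v | v : 'I_n & inPS ist i v && edges_of F v].
  apply/setP => S; rewrite !inE; apply/andP/imsetP.
    case=> SP SF; have [v v0 E] := edgeP (fintype.subsetP (path_sub_E i) _ SP).
    by exists v => //; rewrite inE inPS_ist /edges_of valKd v0 -E SP SF.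
  case=> v; rewrite inE inPS_ist /edges_of valKd => /andP[/andP[v0 h1] /andP[_ h2]] ->.
  by rewrite h1 h2.
rewrite card_in_imset; last first.
  move=> v w; rewrite !inE /edges_of => /andP[_ /andP[v0 _]] /andP[_ /andP[w0 _]].
  exact: (pedge_inj et).
rewrite -sum1_card big_mkcond /cntS /sumN /=.
by apply: eq_bigr => v _; rewrite inE; case: (_ && _).
Qed.

Lemma revenue_revS (F : {set {set 'I_n}}) : revenue F = revS (fza_f I) ist (edges_of F).
Proof.
apply: eq_bigr => i _; rewrite /fza_rev count_edges ist3 ist4.
by case: leqP => _; rewrite ?mul1n // mul0n mul0r.
Qed.

Lemma out_edges_sub best : out_edges best \subset fza_E I.
Proof.
apply/fintype.subsetP => S /imsetP[v]; rewrite inE => /andP[v0 _] ->; exact: pedge_E.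
Qed.

Lemma revenue_out best : revenue (out_edges best) = revS (fza_f I) ist best.
Proof.
rewrite revenue_revS; apply: eq_bigr => i _; apply: (@revi_ext R (fza_f I) ist) => v vn.
rewrite -[v]/(val (Ordinal vn)) inPS_ist => /andP[v0 _]; rewrite /edges_of valKd v0 /=.
apply/imsetP/idP => [[w]|bv]; last by exists (Ordinal vn) => //; rewrite inE v0.
by rewrite inE => /andP[w0 bw] /(pedge_inj et v0 w0) /(congr1 val) /= ->.
Qed.

Lemma output_out (best : nat -> bool) (s : state R) :
  (forall v w, v < n -> w < n -> nmem s 5 (v * n + w) = prl v w && best v) ->
  @output_set R I s = out_edges best.
Proof.
move=> H; apply/setP => S; apply/imsetP/imsetP => [[[x y]]|[v]]; rewrite inE /=.
  rewrite H // eqb0 negbK => /andP[/and3P[_ x0 /eqP E] bx] ->.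
  by exists x; [rewrite inE x0|exact: pedge_edge].
case/andP=> v0 bv ->; exists (v, parent e r v) => //.
by rewrite inE H // /prlM ltn_ord v0 bv /par tparE eqxx.
Qed.

Lemma bfs_ok (d : dyn R) j : (forall j, dB d 10 j = false) ->
  (dB (bfsS ist d) 10 j : nat) = ist 10 j.
Proof.
move=> d0; rewrite /bfsS bvn.
set body := fun _ => _.
have out m j' : n * n <= j' -> dB (forD m body d) 10 j' = false.
  by move=> le; elim: m => [|m IH]; rewrite ?forDS //= ltnNge le.
(* Row [t] depends on row [t - 1] only and is final after [t + 1] rounds. *)
have ok m t (x : 'I_n) : t < m -> t < n -> dB (forD m body d) 10 (t * n + x) = reach e r t x.
  elim: m t x => // m IH t x tm tn; rewrite forDS /= [bv _ _]/(n * n) ix_lt // ix_div // ix_mod //.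
  case: t tm tn => [|t] tm tn //=; rewrite subn1 /= IH //; last exact: ltnW.
  congr orb; apply/hasNP/existsP => [[w wn /andP[h1 h2]]|[w /andP[h1 h2]]].
    rewrite -[w]/(val (Ordinal wn)) ist1 in h1; exists (Ordinal wn); rewrite h1.
    by rewrite -[w]/(val (Ordinal wn)) IH ?(ltnW tn) // in h2.
  by exists w => //; rewrite ist1 h1 IH // ltnW.
rewrite [ist 10 j]/(nat_of_bool (_ && _)); case: (ltnP j (n * n)) => jn; last by rewrite out.
have dn : j %/ n < n by rewrite ltn_divLR ?fza_n_gt0.
have mn : j %% n < n by rewrite ltn_mod fza_n_gt0.
have := ok n (j %/ n) (Ordinal mn) dn dn; rewrite /= -divn_eq => ->.
by congr (nat_of_bool (reach _ _ _ _)); apply: val_inj; rewrite val_insubd mn.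
Qed.

Lemma ancest_ok (d : dyn R) j : (forall j, dB d 11 j = false) ->
  (dB (ancestS ist d) 11 j : nat) = ist 11 j.
Proof.
move=> d0; rewrite /ancestS bvn.
set body := fun _ => _.
have out m j' : n * n <= j' -> dB (forD m body d) 11 j' = false.
  by move=> le; elim: m => [|m IH]; rewrite ?forDS //= ltnNge le.
(* Column [v] depends on the column of its parent and is final after [dep v + 1] rounds. *)
have ok m u v : u < n -> v < n -> dep v < m -> dB (forD m body d) 11 (u * n + v) = anc u v.
  elim: m u v => // m IH u v un vn dm; rewrite forDS /= [bv _ _]/(n * n) ix_lt // ix_div // ix_mod //.
  case: (eqVneq u v) => [->|ne] /=; first by rewrite anc_refl.
  apply/hasNP/idP => [[p pn /andP[]]|uv].
    rewrite prlS_ist => pv; have dv := prl_dep T pv.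
    rewrite IH //; last by rewrite -ltnS -dv.
    by move=> up; exact: anc_trans T _ _ _ up (prl_anc T pv).
  have v0 : 0 < v.
    rewrite lt0n -(dep_eq0 T) // -lt0n; exact: leq_ltn_trans (anc_ltdep uv ne).
  have pv : prl v (par v) by rewrite /prlM vn v0 eqxx.
  exists (par v); first exact: (rt_par T).
  rewrite prlS_ist pv IH ?(anc_to_par T uv) ?(rt_par T) //.
  by have := prl_dep T pv; lia.
rewrite [ist 11 j]/(nat_of_bool (_ && _)); case: (ltnP j (n * n)) => jn; last by rewrite out.
have dn : j %/ n < n by rewrite ltn_divLR ?fza_n_gt0.
have mn : j %% n < n by rewrite ltn_mod fza_n_gt0.
by rewrite {1}(divn_eq j n) ok // (rt_depn T).
Qed.

Lemma tab_frame (N : nat) A (F : nat -> dyn R -> dyn R) (d : dyn R) B :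
  (forall x d, exists M phi, F x d = tabB A M phi d) -> B != A ->
  dB (forD N F d) B = dB d B.
Proof.
move=> H BA; elim: N => [//|N IH]; rewrite forDS -IH.
have [M [phi ->]] := H N (forD N F d); apply: funext => j /=.
by rewrite (negPf BA).
Qed.

(** The input size dominates [n], [k] and every bit length in memory; all cost bounds are
    polynomials in it. *)
Lemma ist_wf x : wf (input_size I) (with_coins ist x).
Proof.
have n0 := fza_n_gt0.
have k1 : n ^ 2 * k.+1 <= input_size I by exact: leq_addr.
have nk : k.+1 <= input_size I by apply: leq_trans k1; rewrite leq_pmull // expn_gt0 n0.
have nn' : n <= input_size I.
  by apply: leq_trans k1; rewrite -[X in X <= _]muln1 leq_mul // -mulnn leq_pmull.
have bl m : m <= 2 ^ bitlen m by rewrite ltnW // /bitlen trunc_log_ltn.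
have uw (i : 'I_k) : bitlen (fza_u i) + bitlen (fza_w i) <= input_size I.
  by apply: leq_trans (leq_addl _ _); rewrite (bigD1 i) //= leq_addr.
have bb (b : bool) : b <= 2 ^ input_size I by apply: leq_trans (leq_b1 b) _; rewrite expn_gt0.
have lt m : m <= input_size I -> m <= 2 ^ input_size I.
  by move=> h; apply: leq_trans h _; exact: ltnW (ltn_expl _ _).
split=> //; first exact: leq_trans nk.
  exact: ltnW.
move=> A j; rewrite /with_coins; case: eqP => // _.
have ub (i : 'I_k) (m : nat) : bitlen m <= bitlen (fza_u i) + bitlen (fza_w i) -> m <= 2 ^ input_size I.
  by move=> h; apply: leq_trans (bl m) _; rewrite leq_exp2l //; apply: leq_trans h (uw i).
case: A => [|[|[|[|[|[|[|[|[|[|[|[|A]]]]]]]]]]]] //=; try exact: bb.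
- by case: j => [|[|j]] //; apply: lt => //; exact: ltnW.
- by case: insubP => // i _ _; apply: (ub i); exact: leq_addr.
- by case: insubP => // i _ _; apply: (ub i); exact: leq_addl.
Qed.

End Instance.

(** * The whole program *)

Section Run.
Variables (R : realType) (I : fza R).
Local Notation n := (fza_n I).
Local Notation f := (@fza_f R I).

(** All [n] coins are drawn at the start and stored in array 8; the rest of the program is
    deterministic and treats them as read-only input. *)
Definition flips := cfor Bn 0 (CFlip 8 (AGet 7 (ANat 0))).

Definition coin_memory (r : seq bool) := with_coins (ist I) (fun j => (j < n) && nth false r j).

Let d0 : dyn R := Dyn (fun _ _ => false) (fun _ _ => 0%R).

Lemma flips_ok (r : seq bool) : n <= size r -> exists t s,
  [/\ exec f flips (init_state I r) t s, t <= n.+1 * (6 * n + 57) &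
      rep 10 (coin_memory r) d0 s].
Proof.
move=> nr.
pose Inv x (s : state R) := [/\ nmem s 7 0 = x, coins s = drop x r, rmem s = (fun _ _ => 0%R) &
  forall A j, A != 7 -> nmem s A j = if A == 8 then (j < x) && nth false r j : nat else input_nmem I A j].
have [x s xn [h1 h2 h3 h4]|x s xn [h1 h2 h3 h4]||t [s [E [h1 h2 h3 h4] le]]] :=
  @exec_for R f 0 Bn n (CFlip 8 (AGet 7 (ANat 0))) (init_state I r) Inv (n + 5) (n + 2).
- by split=> //=; rewrite h4 //=; have := bitlen_leS n; rewrite /bitlen trunc_log0; lia.
- eexists _, _; split.
  + by apply: ExecFlip; rewrite h2 (drop_nth false) ?(leq_trans xn nr).
  + by rewrite /= h1; have := bitlen_leS x; rewrite /bitlen trunc_log0; lia.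
  + by rewrite /= /upd.
  split=> //= A j A7; rewrite /upd (negPf A7) /= h1; case: (A =P 8) => [->|A8] /=; last first.
    by rewrite h4 //; case: eqP.
  by rewrite ltnS leq_eqVlt; case: eqP => [->//|_] /=; rewrite h4.
- split; rewrite ?drop0 //= => A j A7; rewrite /upd (negPf A7) /=.
  by case: eqP => [->|].
exists t, s; split=> //; first by apply: leq_trans le _; lia.
split=> [A j sA|A j _]; last by rewrite h3.
have A7 : A != 7 by apply: contraNneq sA => ->.
rewrite h4 // /coin_memory /with_coins; case: (A =P 8) => [->//|A8].
case: (boolP (dy 10 A)) => [|]; rewrite /dy.
  by case/orP=> [/eqP ->//|]; move: A {sA A7 A8} => [|[|[|[|[|A]]]]].
rewrite negb_or -ltnNge => /andP[A5 A10].
by move: A A5 A10 A7 A8 sA => [|[|[|[|[|[|[|[|[|[|A]]]]]]]]]].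
Qed.

Definition tables (r : seq bool) := ancestS (coin_memory r) (bfsS (coin_memory r) d0).

(** A finished table passes from the writable to the read-only side of [rep]. *)
Lemma rep_next lim (st : memory nat) d (s : state R) : 5 < lim -> ~~ scr lim ->
  (forall j, (dB d lim j : nat) = st lim j) -> rep lim st d s -> rep lim.+1 st d s.
Proof.
move=> l5 sl E [h1 h2]; split=> // A j sA; rewrite h1 // /dy.
case: (A =P 5) => //= _; rewrite leq_eqVlt.
by case: (lim =P A) => [<-|] //=; rewrite ltnn E.
Qed.

Lemma tables_ok (r : seq bool) :
  (forall j, (dB (bfsS (coin_memory r) d0) 10 j : nat) = coin_memory r 10 j) /\
  (forall j, (dB (tables r) 11 j : nat) = coin_memory r 11 j).
Proof.
split=> j; first exact: (@bfs_ok R I d0).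
apply: (@ancest_ok R I) => j'.
rewrite (@tab_frame R _ 10) // => x d; by eexists _, _.
Qed.

End Run.

(** Increments decrease, so [f (i + j) - f i] is at most [f j - f 0], and [f 0] is nonnegative. *)
Lemma concave_sub (R : realType) (f : nat -> R) : (forall j, 0 <= f j)%R ->
  (forall j, f j.+2 - f j.+1 <= f j.+1 - f j)%R ->
  forall i j, (f (i + j)%N <= f i + f j)%R.
Proof.
move=> f0 fc.
have inc i j : (f (i + j).+1 - f (i + j)%N <= f i.+1 - f i)%R.
  by elim: j => [|j IH]; rewrite ?addn0 // addnS; apply: le_trans (fc _) IH.
suff H i j : (f (i + j)%N - f i <= f j - f 0)%R.
  by move=> i j; have := H i j; have := f0 0; lra.
elim: i => [|i IH]; first by rewrite add0n.
by have := inc i j; rewrite addSn; lra.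
Qed.

Section Expectation.
Variables (R : realType) (I : fza R) (T : nat).
Hypothesis nT : fza_n I <= T.
Local Open Scope ring_scope.

Lemma opt_le_expectation : opt I / (ratio (fza_n I))%:R <=
  coin_expectation (fun r : T.-tuple bool =>
    revenue (out_edges I (bestF (fza_f I) (coin_memory I r) (tables I r)))).
Proof.
have f0 := @fza_f_ge0 R I; have n0 := fza_n_gt0 I.
have fs := concave_sub f0 (@fza_f_concave R I).
have fm := @fza_f_nondecreasing R I.
have [pa [ps [pt GS]]] := fza_gst I.
rewrite ler_pdivrMr ?ltr0n // mulrC /coin_expectation mulrA ler_pdivlMr ?exprn_gt0 //.
rewrite -ler_pdivlMr ?exprn_gt0 //.
apply: Order.POrderTheory.bigmax_le => [|F FE].
  rewrite mulr_ge0 ?invr_ge0 ?exprn_ge0 // mulr_ge0 // sumr_ge0 // => r _.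
  by rewrite revenue_out; apply: sumr_ge0 => i _; exact: mulr_ge0.
rewrite ler_pdivlMr ?exprn_gt0 // [X in X <= _]mulrC revenue_revS.
have := @average_bound R (fza_f I) f0 fm fs (ist I) _ _ pa ps pt GS (edges_of F) T nT
  (fun r => tables I r) (brn (fza_n I)) (brn_gt1 n0) (brn_lt n0) (brn_codes n0).
move=> h; apply: (le_trans h); rewrite ler_wpM2l //; apply: ler_sum => r _.
by rewrite revenue_out.
Qed.

End Expectation.

Lemma program_exists (R : realType) : exists (c : cmd) (a : nat), forall I : fza R,
  let T := a * input_size I ^ a in
  fza_n I <= T /\
  computes_within (I := I) c (fun r : T.-tuple bool =>
    out_edges I (bestF (fza_f I) (coin_memory I r) (tables I r))).
Proof.
have nol (i : nat) : i < 0 -> 0 < 0 by [].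
have [c1 [T1 [p1 H1]]] := @df_bfsS R (fun=> 0) 0 nol.
have [c2 [T2 [p2 H2]]] := @df_ancestS R (fun=> 0) 0 nol.
have [c3 [T3 [p3 H3]]] := @df_mainS R (fun=> 0) 0 nol.
(* The last summand [X] ensures [n <= T], so that the tape contains the coins drawn by [flips]. *)
have pT : polyb (fun X => 3 + X.+1 * (6 * X + 57) + T1 X + T2 X + T3 X + X) by polyb_tac.
have [a Ha] := pT.
exists (CSeq flips (CSeq c1 (CSeq c2 c3))), a => I T.
set X := input_size I.
have W r := ist_wf I (fun j => (j < fza_n I) && nth false r j).
have [X0 nX _ _] := W [::]; rewrite -/X in X0 nX.
have {}Ha := Ha X X0; rewrite -/T in Ha.
have nT : fza_n I <= T by apply: leq_trans Ha; apply: leq_trans nX _; exact: leq_addl.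
split=> // r.
have [|t0 [s0 [E0 L0 R0]]] := @flips_ok R I r; first by rewrite size_tuple.
have [h1 h2] := tables_ok I r.
pose st := Env (coin_memory I r) (fza_f I).
have nc X' (s : state R) : @repc R X' 0 (fun=> 0) tt s by [].
have [t1 [s1 [E1 L1 _ R1]]] := H1 X st _ _ s0 (W r) R0 (nc X s0).
have R1' := rep_next (lim := 10) isT isT h1 R1.
have [t2 [s2 [E2 L2 _ R2]]] := H2 X st _ _ s1 (W r) R1' (nc X s1).
have R2' := rep_next (lim := 11) isT isT h2 R2.
have [t3 [s3 [E3 L3 _ R3]]] := H3 X st _ _ s2 (W r) R2' (nc X s2).
eexists _, s3; split.
- exact: ExecSeq E0 (ExecSeq E1 (ExecSeq E2 E3)).
- apply: leq_trans Ha; have : (fza_n I).+1 * (6 * fza_n I + 57) <= X.+1 * (6 * X + 57).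
    by rewrite leq_mul // leq_add2r leq_mul2l nX.
  move: L0 L1 L2 L3; rewrite -/X; lia.
apply: output_out => v w vn wn; rewrite R3.1 // mainS_5 //.
by congr (nat_of_bool (_ && _)); rewrite -(prlS_ist I).
Qed.

Local Open Scope classical_set_scope.
Local Open Scope ring_scope.

Theorem theorem3 (R : realType) :
  exists (c : cmd) (a d : nat) (alpha : nat -> R),
    [/\ forall n : nat, 0 < alpha n,
        alpha =O_\oo (fun n : nat => ln n%:R / ln (ln n%:R) : R)
      & forall I : fza R,
          let T := (a * input_size I ^ d)%N in
          exists F : T.-tuple bool -> {set {set 'I_(fza_n I)}},
            [/\ computes_within (I := I) c F,
                forall r : T.-tuple bool, F r \subset fza_E I
              & opt I / alpha (fza_n I)
                  <= coin_expectation (fun r : T.-tuple bool => revenue (F r))]].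
Proof.
have [c [a H]] := program_exists R.
exists c, a, a, (fun n => (ratio n)%:R); split.
- by move=> n; rewrite ltr0n.
- exact: ratio_asymptotics.
move=> I T; have [nT C] := H I.
exists (fun r => out_edges I (bestF (fza_f I) (coin_memory I r) (tables I r))); split=> //.
  by move=> r; exact: out_edges_sub.
exact: opt_le_expectation.
Qed.
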